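(* There exist universal constants $C_0,\gamma,\upsilon>0$ such that the following holds. Let $m\in\mathbb N^*$ with $m\ge C_0\sqrt K\,d^{3/2}\Delta_+^{-1}$, let $\mathcal P_m=\Phi c_{0,m}$ be a dual certificate as described in the context, let $(\rho_n)_{n\ge1}$ be a positive sequence with $\mathbb E[\|\Gamma_n\|_{\mathbb L}^2]\le\rho_n^2$ for all $n$, and let $\hat\mu_n$ be a solution of $$\inf_{\mu\in\mathcal M(\mathbb R^d,\mathbb R)}\Big\{\tfrac12\|L\hat f_n-L\circ\Phi\mu\|_{\mathbb L}^2+\kappa\|\mu\|_1\Big\}\quad\text{with }\kappa=\kappa_n=\frac{\rho_n}{\|c_{0,m}\|_{\mathbb L}},$$ with Jordan decomposition $\hat\mu_n=\hat\mu_n^+-\hat\mu_n^-$. Let $\mathcal C_m(\varphi,\lambda)$ be as in the context and $\epsilon=\frac{\upsilon}{md}$. Then: (i) (Far region and negative part) $$\mathbb E[\hat\mu_n^-(\mathbb R^d)]\le\frac{3\sqrt2}2\rho_n\,\mathcal C_m(\varphi,\lambda)\quad\text{and}\quad\mathbb E[\hat\mu_n^+(\mathbb F(\epsilon))]\le\frac{3\sqrt2}2\,\frac{d^3}{\gamma\upsilon^2}\,\rho_n\,\mathcal C_m(\varphi,\lambda).$$ (ii) (Near region, spike detection) A positive constant $\mathcal C$ exists such that for every Borel set $A\subset\mathbb R^d$, $$\mathbb E[\hat\mu_n^+(A)]>\frac{3\sqrt2}2\,\frac{d^3}{\gamma\upsilon^2}\,\rho_n\,\mathcal C_m(\varphi,\lambda)\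 \Longrightarrow\ \min_{k\in[K]}\inf_{t\in A}\|t-t_k\|_2^2\le\frac{\gamma\upsilon^2}{\mathcal C d^3m^2}.$$ (iii) (Near region, weight reconstruction) For any $k\in[K]$, $$\mathbb E\big[|a_k^0-\hat\mu_n(\mathbb N_k(\epsilon))|\big]\lesssim\rho_n\,\mathcal C_m(\varphi,\lambda),$$ where $\lesssim$ hides a constant independent of $n$.
   Context: $\varphi$ is a known probability density on $\mathbb R^d$; $\varphi$ and the function $\lambda$ are bounded, continuous, symmetric and of positive definite type. $\mathcal F[f](x)=\int e^{-\imath x^\top\omega}f(\omega)\,d\omega$, $\sigma=\mathcal F[\varphi]\ge0$, and $\mathcal F[\lambda]\ge0$ is the spectral density of $\lambda$: $\lambda(x)=(2\pi)^{-d}\int e^{\imath x^\top\omega}\mathcal F[\lambda](\omega)\,d\omega$. It is assumed that $[-4m,4m]^d\subset\{\sigma\ne0\}$ and $\inf_{\|t\|_\infty\le4m}\{\sigma^2(t)\mathcal F[\lambda](t)\}>0$. $[K]=\{1,\dots,K\}$; $t_1,\dots,t_K\in\mathbb R^d$ are distinct, $a_k^0>0$, $\sum_ka_k^0=1$, $\mu^0=\sum_ka_k^0\delta_{t_k}$; $\Delta=\min_{k\ne\ell}\|t_k-t_\ell\|_2$ (minimum over the empty set is $+\infty$), $\Delta_+=\min(\Delta,1)$. $X_1,\dots,X_n$ are i.i.d. with density $f^0=\sum_ka_k^0\varphi(\cdot-t_k)$, $\hat f_n=\frac1n\sum_i\delta_{X_i}$. $\mathcal M(\mathbb R^d,\mathbb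 R)$: finite signed measures, total variation norm $\|\cdot\|_1$. $\Phi\mu=\varphi\star\mu$ (and $\Phi c=\varphi\star c$ for functions); $\mathbb L$ is the RKHS with reproducing kernel $(x,y)\mapsto\lambda(x-y)$; $L\nu=\lambda\star\nu$; $\Gamma_n=L\hat f_n-L\circ\Phi\mu^0$. Near and far regions: $\mathbb N_k(\epsilon)=\{t:\|t-t_k\|_2\le\epsilon\}$, $\mathbb N(\epsilon)=\bigcup_k\mathbb N_k(\epsilon)$, $\mathbb F(\epsilon)=\mathbb R^d\setminus\mathbb N(\epsilon)$. Dual certificate: a function $\mathcal P_m$ with $0\le\mathcal P_m\le1$; $\mathcal P_m(t)=1$ iff $t\in\{t_1,\dots,t_K\}$; $\mathcal P_m(t)\le1-\mathcal C m^2\|t-t_k\|_2^2$ for $t\in\mathbb N_k(\epsilon)$; $\mathcal P_m(t)\le1-\gamma\upsilon^2/d^3$ for $t\in\mathbb F(\epsilon)$; $\mathrm{Supp}(\mathcal F[\mathcal P_m])\subset[-4m,4m]^d$; $\|\mathcal P_m\|_2\le C_3K^2m^{-d/2}$, with positive constants $\mathcal C,C_3$ not depending on $n,m,K$ (for suitable constants such a function exists whenever $m\ge C_0\sqrt Kd^{3/2}\Delta_+^{-1}$). $c_{0,m}\in\mathbb L$ is defined by $\mathcal F[c_{0,m}]=\mathcal F[\mathcal P_m]\,\sigma^{-1}\,\mathbf 1_{\mathrm{Supp}(\mathcal F[\mathcal P_m])}$, so that $\mathcal P_m=\Phi c_{0,m}$. Finally $$\mathcal C_m(\varphi,\lambda)=\frac{K^2m^{-d/2}}{\sqrt{\inf_{\|t\|_\infty\le4m}\{\sigma^2(t)\mathcal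 F[\lambda](t)\}}}$$ (up to the multiplicative constant $C_3$, so that $\|c_{0,m}\|_{\mathbb L}\le\mathcal C_m(\varphi,\lambda)$). *)

(* Defs.v *)
From HB Require Import structures.
From mathcomp Require Import all_boot all_order all_algebra.
From mathcomp Require Import complex.
From mathcomp Require Import all_classical all_reals all_analysis.
From mathcomp Require Import measurable_realfun.

Set Implicit Arguments.
Unset Strict Implicit.
Unset Printing Implicit Defensive.

Import Order.TTheory GRing.Theory Num.Theory.
Import numFieldNormedType.Exports.

Local Open Scope classical_set_scope.
Local Open Scope ring_scope.

(* R^d is 'rV[R]_d: its library norm `|x| is the sup norm, and it carries the
   Borel sigma-algebra. *)
HB.instance Definition _ (R : realType) (d : nat) :=
  @isMeasurable.Build (sigma_display (@open 'rV[R]_d)) 'rV[R]_d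
    <<s @open 'rV[R]_d >> (@sigma_algebra0 _ setT _)
    (@sigma_algebraC _ _) (@sigma_algebra_bigcup _ setT _).

Section lebesgue_rV.
Context (R : realType).

Lemma measurable_coord (d : nat) (i : 'I_d) :
  measurable_fun [set: 'rV[R]_d] (fun x : 'rV[R]_d => x ord0 i).
Proof.
apply: (measurability _ (RGenOpens.measurableE R)) => _ [_ [x [y ->]] <-].
rewrite setTI; apply: sub_sigma_algebra.
by apply: open_comp => [? _|]; [exact: coord_continuous|exact: interval_open].
Qed.

Lemma measurable_rV d (T : measurableType d) (k : nat) (f : T -> 'rV[R]_k) :
  (forall i, measurable_fun [set: T] (fun t => f t ord0 i)) ->
  measurable_fun [set: T] f.
Proof.
move=> mf; apply: (measurability (@open 'rV[R]_k)) => // _ [U oU <-].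
rewrite setTI.
pose box (p : 'rV[rat]_k * nat) : set 'rV[R]_k :=
  [set x | forall i, x ord0 i \in `]ratr (p.1 ord0 i) - p.2.+1%:R^-1,
                                  ratr (p.1 ord0 i) + p.2.+1%:R^-1[].
pose F p := if pselect (box p `<=` U) then box p else set0.
have -> : U = \bigcup_p F p.
  apply/seteqP; split => [x Ux|x [p _]]; last first.
    by rewrite /F; case: pselect => [h /h|].
  have /nbhs_ballP[e /= e0 eU] : nbhs x U by exact: open_nbhs_nbhs.
  have [n ne] : exists n, n.+1%:R^-1 < e / 2.
    have [n] := near_infty_natSinv_lt (PosNum (divr_gt0 e0 (ltr0n R 2))).
    by move=> _ /(_ n (leqnn _)) /= ?; exists n.
  have n0 : 0 < n.+1%:R^-1 :> R by rewrite invr_gt0.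
  have H i : exists q : rat, `|x ord0 i - ratr q| < n.+1%:R^-1.
    have : ball (x ord0 i) n.+1%:R^-1 !=set0 by exists (x ord0 i); exact: ballxx.
    move=> /dense_rat /(_ (ball_open _ _)) [y [xq [q _ qE]]].
    by exists q; rewrite qE.
  have [q qx] := choice H.
  pose p := (\row_i q i, n) : 'rV[rat]_k * nat.
  have bpx : box p x.
    by move=> i; rewrite in_itv /= mxE -ltr_distl.
  have bU : box p `<=` U.
    move=> y yb; apply: eU; split => // i j; rewrite (ord1 i) /ball /=.
    have := yb j; rewrite in_itv /= mxE -ltr_distl => yj.
    rewrite (splitr e); apply: le_lt_trans (ler_distD (ratr (q j)) _ _) _.
    by rewrite ltrD // ?(lt_trans (qx j)) // distrC (lt_trans yj).
  by exists p => //; rewrite /F; case: pselect.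
rewrite preimage_bigcup; apply: countable_bigcupT_measurable => // p.
rewrite /F; case: pselect => [bU|nbU]; last by rewrite preimage_set0.
have -> : f @^-1` box p = \bigcap_(i in [set: 'I_k])
    ((fun t => f t ord0 i) @^-1` `]ratr (p.1 ord0 i) - p.2.+1%:R^-1,
                                  ratr (p.1 ord0 i) + p.2.+1%:R^-1[).
  by apply/seteqP; split => [t h i _|t h i]; [exact: h|exact: (h i)].
apply: fin_bigcap_measurable => // i _.
by rewrite -[X in measurable X]setTI; exact: mf.
Qed.

Definition rV_cons (d : nat) (p : 'rV[R]_d * measurableTypeR R) : 'rV[R]_d.+1 :=
  \row_i (if unlift ord0 i is Some j then p.1 ord0 j else p.2).

Lemma measurable_rV_cons (d : nat) :
  measurable_fun [set: 'rV[R]_d * measurableTypeR R] (@rV_cons d).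
Proof.
apply: measurable_rV => i; rewrite /rV_cons.
under eq_fun do rewrite mxE.
case: unliftP => [j|] _; last exact: measurable_snd.
exact: (measurableT_comp (measurable_coord j) measurable_fst).
Qed.


Section cons_measure.
Local Open Scope ereal_scope.
Context (d : nat) (mu : {measure set 'rV[R]_d -> \bar R}).

Definition cons_measure : set 'rV[R]_d.+1 -> \bar R :=
  pushforward (mu \x lebesgue_measure) (@rV_cons d).

Let cons0 : cons_measure set0 = 0.
Proof. by rewrite /cons_measure /pushforward preimage_set0 measure0. Qed.

Let cons_ge0 A : 0 <= cons_measure A.
Proof. by rewrite /cons_measure /pushforward measure_ge0. Qed.

Let cons_sigma_additive : semi_sigma_additive cons_measure.
Proof.
move=> F mF tF mUF; rewrite /cons_measure /pushforward preimage_bigcup.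
apply: measure_semi_sigma_additive.
- by move=> n; rewrite -[X in measurable X]setTI; exact: measurable_rV_cons.
- apply/trivIsetP => /= i j _ _ ij; rewrite -preimage_setI.
  by move/trivIsetP : tF => /(_ _ _ _ _ ij) ->//; rewrite preimage_set0.
- by rewrite -preimage_bigcup -[X in measurable X]setTI;
    exact: measurable_rV_cons.
Qed.

HB.instance Definition _ := isMeasure.Build _ _ _ cons_measure
  cons0 cons_ge0 cons_sigma_additive.
End cons_measure.

Fixpoint lebesgue_rV (d : nat) : {measure set 'rV[R]_d -> \bar R} :=
  match d with
  | 0 => \d_ (0 : 'rV[R]_0)
  | d'.+1 => cons_measure (lebesgue_rV d')
  end.
End lebesgue_rV.

Section fourier.
Context (R : realType) (d : nat).
Implicit Types x w : 'rV[R]_d.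

Definition dot x w : R := \sum_i x ord0 i * w ord0 i.

Definition norm2 x : R := Num.sqrt (\sum_i x ord0 i ^+ 2).

Definition expi (theta : R) : R[i] := (cos theta +i* sin theta)%C.

Definition cintegral (g : 'rV[R]_d -> R[i]) : R[i] :=
  ((\int[lebesgue_rV R d]_w complex.Re (g w)) +i*
   (\int[lebesgue_rV R d]_w complex.Im (g w)))%C.

Definition fourier (f : 'rV[R]_d -> R) x : R[i] :=
  cintegral (fun w => expi (- dot x w) * (f w)%:C%C).

Definition inv_fourier (g : 'rV[R]_d -> R[i]) x : R[i] :=
  ((2 * pi) ^- d)%:C%C * cintegral (fun w => expi (dot x w) * g w).

Definition fsupport (g : 'rV[R]_d -> R[i]) : set 'rV[R]_d :=
  closure [set w | g w != 0].

(* [Lam] is the density of the spectral measure of [lam]; it is the Fourier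
   transform of [lam] when [lam] is integrable, which is not required. *)
Definition spectral_density (lam Lam : 'rV[R]_d -> R) : Prop :=
  [/\ (lebesgue_rV R d).-integrable setT (EFin \o Lam),
      forall w, 0 <= Lam w
    & forall x, (lam x)%:C%C = inv_fourier (fun w => (Lam w)%:C%C) x].

Definition positive_type (f : 'rV[R]_d -> R) : Prop :=
  forall (N : nat) (x : 'I_N -> 'rV[R]_d) (c : 'I_N -> R),
    0 <= \sum_i \sum_j c i * c j * f (x i - x j).

Definition regular_kernel (f : 'rV[R]_d -> R) : Prop :=
  [/\ bounded_fun f, continuous f, forall x, f (- x) = f x & positive_type f].

Definition probability_density (f : 'rV[R]_d -> R) : Prop :=
  (forall x, 0 <= f x) /\ (\int[lebesgue_rV R d]_x (f x)%:E = 1)%E.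

End fourier.

(* A Hilbert space of real functions with reproducing kernel [k].  By the
   Moore-Aronszajn theorem its domain, and its inner product on that domain,
   are determined by [k]. *)
Record rkhs (R : realType) (T : Type) (k : T -> T -> R) := Rkhs {
  rkhs_dom : set (T -> R) ;
  rkhs_ip : (T -> R) -> (T -> R) -> R ;
  rkhs_dom0 : rkhs_dom (fun=> 0) ;
  rkhs_domP : forall c f g, rkhs_dom f -> rkhs_dom g ->
    rkhs_dom (fun x => c * f x + g x) ;
  rkhs_ipC : forall f g, rkhs_dom f -> rkhs_dom g -> rkhs_ip f g = rkhs_ip g f ;
  rkhs_ipP : forall c f g h, rkhs_dom f -> rkhs_dom g -> rkhs_dom h ->
    rkhs_ip (fun x => c * f x + g x) h = c * rkhs_ip f h + rkhs_ip g h ;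
  rkhs_ip_ge0 : forall f, rkhs_dom f -> 0 <= rkhs_ip f f ;
  rkhs_ip_eq0 : forall f, rkhs_dom f -> rkhs_ip f f = 0 -> f = fun=> 0 ;
  rkhs_complete : forall u : nat -> T -> R, (forall n, rkhs_dom (u n)) ->
    (forall e, 0 < e -> exists N, forall p q, (N <= p)%N -> (N <= q)%N ->
      rkhs_ip (u p \- u q) (u p \- u q) < e) ->
    exists2 f, rkhs_dom f &
      (fun n => rkhs_ip (u n \- f) (u n \- f)) @ \oo --> (0 : R) ;
  rkhs_kernel : forall x, rkhs_dom (k ^~ x) ;
  rkhs_reproducing : forall f x, rkhs_dom f -> rkhs_ip f (k ^~ x) = f x
}.

Definition rkhs_norm (R : realType) (T : Type) (k : T -> T -> R) (H : rkhs k)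
    (f : T -> R) : \bar R :=
  if f \in rkhs_dom H then (Num.sqrt (rkhs_ip H f f))%:E else +oo%E.

Section signed_measures.
Context d (T : measurableType d) (R : realType).
Implicit Types nu : {charge set T -> \bar R}.

Definition hahn_sets nu : {PN : set T * set T | hahn_decomposition nu PN.1 PN.2} :=
  cid (let: ex_intro P (ex_intro N PN) := Hahn_decomposition nu in
       ex_intro (fun PN => hahn_decomposition nu PN.1 PN.2) (P, N) PN).

Definition pos_part nu : {finite_measure set T -> \bar R} :=
  jordan_pos (proj2_sig (hahn_sets nu)).

Definition neg_part nu : {finite_measure set T -> \bar R} :=
  jordan_neg (proj2_sig (hahn_sets nu)).

Definition total_variation nu : \bar R :=
  charge_variation (proj2_sig (hahn_sets nu)) setT.

Definition charge_integral nu (f : T -> R) : R :=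
  \int[pos_part nu]_x f x - \int[neg_part nu]_x f x.

Definition charge_add nu1 nu2 : {charge set T -> \bar R} := cadd nu1 nu2.

Definition charge_scale (c : R) nu : {charge set T -> \bar R} := cscale c nu.

Definition charge_dirac (x : T) : {charge set T -> \bar R} :=
  charge_of_finite_measure \d_x.

Definition point_masses (N : nat) (c : 'I_N -> R) (x : 'I_N -> T) :
    {charge set T -> \bar R} :=
  \big[charge_add/(czero : {charge set T -> \bar R})]_(i < N)
    charge_scale (c i) (charge_dirac (x i)).

End signed_measures.

Section mixture.
Context (R : realType) (d : nat).
Local Notation Rd := 'rV[R]_d.
Local Notation leb := (lebesgue_rV R d).

Definition charge_convolution (f : Rd -> R) (nu : {charge set Rd -> \bar R}) (x : Rd) : R :=
  charge_integral nu (fun y => f (x - y)).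

Definition convolution (f g : Rd -> R) (x : Rd) : R :=
  \int[leb]_y (f (x - y) * g y).

(* [min(Delta, 1)], with [Delta = +oo] when there is only one point. *)
Definition separation K (t : 'I_K -> Rd) : \bar R :=
  \big[Order.min/+oo%E]_(p : 'I_K * 'I_K | p.1 != p.2) (norm2 (t p.1 - t p.2))%:E.

Definition separation_plus K (t : 'I_K -> Rd) : R :=
  fine (Order.min (separation t) 1%E).

Definition bandwidth_ok K (C0 : R) (t : 'I_K -> Rd) (m : nat) : Prop :=
  C0 * Num.sqrt K%:R * d%:R `^ (3 / 2) / separation_plus t <= m%:R.

Definition near_region (c : Rd) (eps : R) : set Rd := [set x | norm2 (x - c) <= eps].

Definition far_region K (t : 'I_K -> Rd) (eps : R) : set Rd :=
  ~` \bigcup_k near_region (t k) eps.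

Definition near_radius (ups : R) (m : nat) : R := ups / (m%:R * d%:R).

Definition cube (m : nat) : set Rd := [set w | `|w| <= 4 * m%:R].

(* Integrability is what gives a meaning to the Fourier transform of [P]. *)
Record dual_certificate (gamma ups C C3 : R) K (t : 'I_K -> Rd) (m : nat)
    (P : Rd -> R) : Prop := DualCertificate {
  cert_integrable : leb.-integrable setT (EFin \o P) ;
  cert_itv : forall x, 0 <= P x <= 1 ;
  cert_eq1 : forall x, P x = 1 <-> exists k, x = t k ;
  cert_near : forall k x, near_region (t k) (near_radius ups m) x ->
    P x <= 1 - C * m%:R ^+ 2 * norm2 (x - t k) ^+ 2 ;
  cert_far : forall x, far_region t (near_radius ups m) x ->
    P x <= 1 - gamma * ups ^+ 2 / d%:R ^+ 3 ;
  cert_support : fsupport (fourier P) `<=` cube m ;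
  cert_norm : ('N[leb]_2%:E [EFin \o P] <=
    (C3 * K%:R ^+ 2 * m%:R `^ (- (d%:R / 2)))%:E)%E
}.

Definition sigma (phi : Rd -> R) (w : Rd) : R := complex.Re (fourier phi w).

(* [c_{0,m}], whose Fourier transform is in general only an L^2 one, is given
   by the inversion formula; the integral is real since [P] is real and [phi]
   is real and symmetric. *)
Definition c0 (phi P : Rd -> R) (x : Rd) : R :=
  complex.Re (inv_fourier (fun w =>
    fourier P w * ((sigma phi w)^-1 * \1_(fsupport (fourier P)) w)%:C%C) x).

Definition spectral_inf (phi Lam : Rd -> R) (m : nat) : R :=
  inf [set sigma phi w ^+ 2 * Lam w | w in cube m].

(* The constant [C3] of the certificate is part of [C_m(phi, lambda)]: this is
   the normalization for which it bounds the norm of [c_{0,m}]. *)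
Definition Cm (C3 : R) (K : nat) (phi Lam : Rd -> R) (m : nat) : R :=
  C3 * K%:R ^+ 2 * m%:R `^ (- (d%:R / 2)) / Num.sqrt (spectral_inf phi Lam m).

Definition empirical Om (X : nat -> Om -> Rd) (n : nat) (w : Om) :
    {charge set Rd -> \bar R} :=
  point_masses (fun _ : 'I_n => n%:R^-1) (fun i : 'I_n => X i w).

Definition residual (phi lam : Rd -> R) (fhat mu : {charge set Rd -> \bar R}) :
    Rd -> R :=
  charge_convolution lam fhat \- convolution lam (charge_convolution phi mu).

Definition objective (phi lam : Rd -> R) (H : rkhs (fun x y => lam (x - y)))
    (kappa : R) (fhat mu : {charge set Rd -> \bar R}) : \bar R :=
  (2^-1%:E * rkhs_norm H (residual phi lam fhat mu) ^+ 2
   + kappa%:E * total_variation mu)%E.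

End mixture.

(* A triple of constants for which dual certificates exist at every bandwidth
   allowed by the separation of the points. *)
Definition certificate_constants (R : realType) (C0 gamma ups : R) : Prop :=
  [/\ 0 < C0, 0 < gamma, 0 < ups
    & forall d : nat, (0 < d)%N -> exists C C3 : R, [/\ 0 < C, 0 < C3
      & forall (K m : nat) (t : 'I_K -> 'rV[R]_d),
        (0 < K)%N -> (0 < m)%N -> injective t -> bandwidth_ok C0 t m ->
        exists P, dual_certificate gamma ups C C3 t m P]].

Definition mutually_independent d d' (Om : measurableType d)
    (T : measurableType d') (R : realType) (Pr : probability Om R)
    (X : nat -> Om -> T) : Prop :=
  forall (s : seq nat) (A : nat -> set T), uniq s ->
    (forall i, measurable (A i)) ->
    Pr (\bigcap_(i in [set` s]) X i @^-1` A i)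
    = (\prod_(i <- s) Pr (X i @^-1` A i))%E.

Definition has_density d (Om : measurableType d) (R : realType) (k : nat)
    (Pr : probability Om R) (X : Om -> 'rV[R]_k) (f : 'rV[R]_k -> R) : Prop :=
  measurable_fun setT X /\ forall A, measurable A ->
    Pr (X @^-1` A) = (\int[lebesgue_rV R k]_(x in A) (f x)%:E)%E.

(* Main.v *)
Require Import Defs.
From HB Require Import structures.
From mathcomp Require Import all_boot all_order all_algebra.
From mathcomp Require Import complex.
From mathcomp Require Import all_classical all_reals all_analysis.
From mathcomp Require Import measurable_realfun.
From mathcomp Require Import ring lra.

(** The positions and weights are read off the optimality of the estimator
    against the true measure, tested with the dual certificate [P].

    The certificate is [P = convolution phi c0], and [c0] lies in the reproducing
    kernel space.  So the pairing of [P] with the difference of two measures is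
    the inner product of [c0] with the difference of their residuals
    ([ip_residualB]), hence bounded by the norm of [c0] times the residual norms.
    Since the true measure pairs to 1 with [P] and has total variation 1,
    comparing the objective at the minimiser and at the true measure bounds
    [kappa] times the excess, the total variation of the minimiser minus its
    pairing with [P], by [|res mu0|^2 + rho^2] ([excess_le]).  The excess is the
    integral of [1 - P] against the positive part plus that of [1 + P] against the
    negative part.  It therefore controls the negative mass, and the positive mass
    of every set where [P] stays below 1 by a fixed gap: the far region, and, by
    contraposition for the detection of spikes, any set away from the points.
    Taking expectations, the constant is 2, as [kappa = rho / |c0|].

    That [c0] is in the space, with norm at most [Cm], needs the spectral
    description of the space.  An abstract space is given, known only by its
    reproducing property; the half of the description that is used says that a
    trigonometric integral whose density [u] has [u^2 / Lam] integrable belongs to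
    it ([trig_int_rkhs]).  This follows from a Riesz argument on the span of the
    kernels ([rkhs_mem]).  On the cube, dividing a density by [sigma phi] inverts
    the convolution by [phi], and [sigma phi ^+ 2 * Lam] is bounded below
    ([dual_coefP]).  The norm of [c0] is then the [L^2] norm of [P], by a
    Plancherel identity that comes from Fubini's theorem because [P] is known to
    be the convolution of [c0] ([c0_rkhs]).

    For the weights the certificate alone is not enough: the weight at [t k] is tested
    with a function [Q] of the same band, equal to 1 at [t k] and vanishing to
    second order at the other points ([interpolation_exists]).  The pairing of [Q]
    with the difference of the measures is bounded as before, and [Q] differs from
    the indicator of the near region by at most a multiple of [1 - P]
    ([interpolant_gap]), so that this error is bounded by the excess.  The
    constant may depend on the points but not on [m], so [Q] can be built
    explicitly: a product of cardinal sines of bandwidth [m] times a fixed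
    trigonometric polynomial of bandwidth at most 1.

    All the bounds are proved sample by sample, as affine functions of the squared
    residual norm of the true measure, and then integrated by
    [ge0_integral_affine_le]. *)

Set Implicit Arguments.
Unset Strict Implicit.
Unset Printing Implicit Defensive.

Import Order.TTheory GRing.Theory Num.Theory.
Import numFieldNormedType.Exports.

Local Open Scope classical_set_scope.
Local Open Scope ring_scope.

(** * Reproducing kernel Hilbert spaces *)

Section rkhs_theory.
Context (R : realType) (T : Type) (k : T -> T -> R) (H : rkhs k).
Local Notation dom := (rkhs_dom H).
Local Notation ip := (rkhs_ip H).
Implicit Types (f g h : T -> R) (s : seq (R * T)).

Lemma rkhs_domZ a f : dom f -> dom (fun x => a * f x).
Proof.
move=> df; have := rkhs_domP a df (rkhs_dom0 H).
by under eq_fun do rewrite addr0.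
Qed.

Lemma rkhs_domB f g : dom f -> dom g -> dom (f \- g).
Proof.
move=> df dg; have := rkhs_domP (-1) dg df.
by under eq_fun do rewrite mulN1r addrC.
Qed.

Lemma rkhs_ip0l h : dom h -> ip (fun=> 0) h = 0.
Proof.
move=> dh; have := rkhs_ipP 1 (rkhs_dom0 H) (rkhs_dom0 H) dh.
under eq_fun do rewrite mulr0 addr0.
by move/eqP; rewrite mul1r -subr_eq0 opprD addNKr oppr_eq0 => /eqP.
Qed.

Lemma rkhs_ipZl a f h : dom f -> dom h -> ip (fun x => a * f x) h = a * ip f h.
Proof.
move=> df dh; have := rkhs_ipP a df (rkhs_dom0 H) dh.
by under eq_fun do rewrite addr0; rewrite rkhs_ip0l// addr0.
Qed.

Lemma rkhs_ipBl f g h : dom f -> dom g -> dom h ->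
  ip (f \- g) h = ip f h - ip g h.
Proof.
move=> df dg dh; have := rkhs_ipP (-1) dg df dh.
rewrite mulN1r addrC => <-.
by congr ip; apply/funext => x; rewrite mulN1r addrC.
Qed.

Lemma rkhs_ipBr f g h : dom f -> dom g -> dom h ->
  ip h (f \- g) = ip h f - ip h g.
Proof.
move=> df dg dh; rewrite rkhs_ipC//; last exact: rkhs_domB.
by rewrite rkhs_ipBl// (rkhs_ipC df)// (rkhs_ipC dg).
Qed.

Lemma rkhs_ipBB f g : dom f -> dom g ->
  ip (f \- g) (f \- g) = ip f f - 2 * ip f g + ip g g.
Proof.
move=> df dg; have dfg := rkhs_domB df dg.
by rewrite rkhs_ipBl// !rkhs_ipBr// (rkhs_ipC dg df); ring.
Qed.

Lemma rkhs_cauchy_schwarz f g : dom f -> dom g ->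
  ip f g ^+ 2 <= ip f f * ip g g.
Proof.
move=> df dg; have := rkhs_ip_ge0 df; rewrite le_eqVlt => /orP[/eqP f0|f0].
  have -> : f = fun=> 0 by apply: (rkhs_ip_eq0 df).
  by rewrite !rkhs_ip0l ?expr0n ?mul0r//; exact: rkhs_dom0.
have dz := rkhs_domZ (ip f g / ip f f) df.
have := rkhs_ip_ge0 (rkhs_domB dg dz).
rewrite rkhs_ipBB// (rkhs_ipC dg)// rkhs_ipZl// rkhs_ipZl// (rkhs_ipC df dz) rkhs_ipZl//.
have fN0 : ip f f != 0 by rewrite gt_eqF.
have -> : ip g g - 2 * (ip f g / ip f f * ip f g) +
  ip f g / ip f f * (ip f g / ip f f * ip f f) = ip g g - ip f g ^+ 2 / ip f f.
  by field.
by rewrite subr_ge0 ler_pdivrMr// mulrC.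
Qed.

Lemma rkhs_norm_cauchy_schwarz f g : dom f -> dom g ->
  `|ip f g| <= Num.sqrt (ip f f) * Num.sqrt (ip g g).
Proof.
move=> df dg; rewrite -sqrtrM ?rkhs_ip_ge0// -sqrtr_sqr ler_wsqrtr//.
exact: rkhs_cauchy_schwarz.
Qed.

Definition kernel_comb s : T -> R := fun y => \sum_(p <- s) p.1 * k y p.2.

Lemma rkhs_dom_comb s : dom (kernel_comb s).
Proof.
rewrite /kernel_comb; elim: s => [|p s IH].
  by under eq_fun do rewrite big_nil; exact: rkhs_dom0.
under eq_fun do rewrite big_cons.
exact: rkhs_domP (rkhs_kernel H p.2) IH.
Qed.

Lemma rkhs_ip_comb s g : dom g -> ip (kernel_comb s) g = \sum_(p <- s) p.1 * g p.2.
Proof.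
move=> dg; elim: s => [|p s IH].
  rewrite big_nil -(rkhs_ip0l dg); congr ip; apply/funext => y.
  by rewrite /kernel_comb big_nil.
rewrite big_cons -IH.
have -> : kernel_comb (p :: s) = fun x => p.1 * k x p.2 + kernel_comb s x.
  by apply/funext => y; rewrite /kernel_comb big_cons.
rewrite rkhs_ipP//; [|exact: rkhs_kernel|exact: rkhs_dom_comb].
by rewrite (rkhs_ipC (rkhs_kernel H p.2))// rkhs_reproducing.
Qed.

Lemma rkhs_eval_le f x : dom f -> f x ^+ 2 <= ip f f * k x x.
Proof.
move=> df; rewrite -{1}(rkhs_reproducing x df).
rewrite -[X in _ * X](rkhs_reproducing x (rkhs_kernel H x)).
exact: rkhs_cauchy_schwarz (rkhs_kernel H x).
Qed.

Lemma rkhs_kernel_ge0 x : 0 <= k x x.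
Proof.
by rewrite -(rkhs_reproducing x (rkhs_kernel H x)) rkhs_ip_ge0//; exact: rkhs_kernel.
Qed.

Section membership.
Variables (c : T -> R) (C2 : R).
Hypothesis cC2 : forall s, 2 * \sum_(p <- s) p.1 * c p.2
  <= C2 + \sum_(p <- s) \sum_(q <- s) p.1 * q.1 * k p.2 q.2.

Let ell s := \sum_(p <- s) p.1 * c p.2.
Let N s := ip (kernel_comb s) (kernel_comb s).
Let J s := N s / 2 - ell s.

Let NE s : N s = \sum_(p <- s) \sum_(q <- s) p.1 * q.1 * k p.2 q.2.
Proof.
rewrite /N rkhs_ip_comb; last exact: rkhs_dom_comb.
apply: eq_bigr => p _; rewrite /kernel_comb mulr_sumr; apply: eq_bigr => q _.
by rewrite mulrA.
Qed.

Let J_ge s : - (C2 / 2) <= J s.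
Proof. by have := cC2 s; rewrite -NE /J /ell; lra. Qed.

Let Jset := [set J s | s in setT].

Let Jset_inf : has_inf Jset.
Proof.
split; first by exists (J [::]), [::].
by exists (- (C2 / 2)) => _ [s _ <-]; exact: J_ge.
Qed.

Let I := inf Jset.

Let I_le s : I <= J s.
Proof. by apply: ge_inf; [exact: Jset_inf.2|exists s]. Qed.

Let scale (a : R) s : seq (R * T) := [seq (a * p.1, p.2) | p <- s].

Let comb_cat_scale s a t :
  kernel_comb (s ++ scale a t) = fun x => a * kernel_comb t x + kernel_comb s x.
Proof.
apply/funext => y; rewrite /kernel_comb big_cat/= addrC; congr (_ + _).
by rewrite big_map mulr_sumr; apply: eq_bigr => p _; rewrite mulrA.
Qed.

Let J_cat_scale s a t : J (s ++ scale a t) =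
  J s + a * (ip (kernel_comb s) (kernel_comb t) - ell t) + a ^+ 2 * (N t / 2).
Proof.
have ds := rkhs_dom_comb s; have dt := rkhs_dom_comb t.
have -> : J (s ++ scale a t) = N (s ++ scale a t) / 2 - (ell s + a * ell t).
  rewrite /J; congr (_ - _); rewrite /ell big_cat/=; congr (_ + _).
  by rewrite big_map mulr_sumr; apply: eq_bigr => p _; rewrite mulrA.
rewrite /N comb_cat_scale.
have dst := rkhs_domP a dt ds.
rewrite (rkhs_ipP a dt ds dst) (rkhs_ipC dt dst) (rkhs_ipC ds dst).
rewrite !(rkhs_ipP a dt ds)// (rkhs_ipC dt ds) /J /N.
by field.
Qed.

(** The midpoint of two almost-minimisers has value at least [I], so the
    parallelogram identity bounds their distance by the excess of their values. *)
Let comb_close s t e : J s <= I + e -> J t <= I + e ->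
  ip (kernel_comb s \- kernel_comb t) (kernel_comb s \- kernel_comb t) <= 8 * e.
Proof.
move=> sI tI; have ds := rkhs_dom_comb s; have dt := rkhs_dom_comb t.
pose u := scale 2^-1 s ++ scale 2^-1 t.
have := I_le u.
have -> : J u = (J s + J t) / 2 -
  ip (kernel_comb s \- kernel_comb t) (kernel_comb s \- kernel_comb t) / 8.
  have J0 a s0 : J (scale a s0) = a ^+ 2 * (N s0 / 2) - a * ell s0.
    have := J_cat_scale [::] a s0; rewrite cat0s => ->.
    have -> : kernel_comb [::] = fun=> 0.
      by apply/funext => y; rewrite /kernel_comb big_nil.
    rewrite rkhs_ip0l; last exact: rkhs_dom_comb.
    suff -> : J [::] = 0 by ring.
    have c0 : kernel_comb [::] = fun=> 0.
      by apply/funext => y; rewrite /kernel_comb big_nil.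
    rewrite /J /N /ell big_nil c0 rkhs_ip0l ?mul0r ?subr0//.
    exact: rkhs_dom0.
  rewrite /u J_cat_scale J0 rkhs_ipBB//.
  have -> : kernel_comb (scale 2^-1 s) = fun x => 2^-1 * kernel_comb s x.
    apply/funext => y; rewrite /kernel_comb big_map mulr_sumr.
    by apply: eq_bigr => p _; rewrite mulrA.
  by rewrite rkhs_ipZl// /J /N; field.
by move=> ?; lra.
Qed.

(** The Riesz argument, carried out on the span of the kernels only.  The
    hypothesis says that [J], the functional [|f|^2 / 2 - c(f)], is bounded below
    on that span.  A minimising sequence is Cauchy by [comb_close], and its limit
    takes the value [c x] at [x] because [J] cannot decrease along the kernel at
    [x].  The approximation by kernel combinations, which the argument gives for
    free, is what lets the reproducing property be extended to integrals in
    [ip_convolution]. *)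
Lemma rkhs_mem :
  [/\ dom c, ip c c <= C2 &
      forall e, 0 < e -> exists s, ip (kernel_comb s \- c) (kernel_comb s \- c) < e].
Proof.
have Hs n : exists s, J s <= I + n.+1%:R^-1.
  have n0 : 0 < n.+1%:R^-1 :> R by rewrite invr_gt0.
  have [_ [s _ <-] sI] := inf_adherent n0 Jset_inf.
  by exists s; exact: ltW.
have [S SI] := choice Hs.
have dS n := rkhs_dom_comb (S n).
have cauchy e : 0 < e -> exists M, forall p q, (M <= p)%N -> (M <= q)%N ->
    ip (kernel_comb (S p) \- kernel_comb (S q))
       (kernel_comb (S p) \- kernel_comb (S q)) < e.
  move=> e0; have e16 : 0 < e / 16 by rewrite divr_gt0.
  have [M _ HM] := near_infty_natSinv_lt (PosNum e16).
  exists M => p q Mp Mq.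
  have lep r : (M <= r)%N -> J (S r) <= I + e / 16.
    move=> Mr; apply: (le_trans (SI r)); rewrite lerD2l ltW//.
    exact: (HM r).
  apply: le_lt_trans (comb_close (lep _ Mp) (lep _ Mq)) _; lra.
have [g dg Sg] := rkhs_complete dS cauchy.
have Sg_small e : 0 < e -> exists M, forall n, (M <= n)%N ->
    ip (kernel_comb (S n) \- g) (kernel_comb (S n) \- g) < e.
  move=> e0; have /cvgrPdist_lt/(_ _ e0)[M _ HM] := Sg.
  exists M => n /HM /=; rewrite sub0r normrN ger0_norm//.
  by apply: rkhs_ip_ge0; apply: rkhs_domB.
have cg : c = g.
  apply/funext => x; apply/eqP; rewrite -subr_eq0 -normr_le0 leNgt.
  apply/negP => cgx; set dl := `|c x - g x| in cgx.
  have K0 : 0 <= k x x := rkhs_kernel_ge0 x.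
  have e1 : 0 < (dl / 2) ^+ 2 / (2 * (k x x + 1)).
    by rewrite divr_gt0// ?exprn_gt0 ?mulr_gt0 ?divr_gt0//; lra.
  have [M1 HM1] := Sg_small _ e1.
  have [M2 _ HM2] := near_infty_natSinv_lt (PosNum e1).
  pose n := maxn M1 M2.
  have A1 := HM1 n (leq_maxl _ _).
  have A2 : n.+1%:R^-1 < _ := HM2 n (leq_maxr _ _).
  have kx1 : 0 < k x x + 1 by lra.
  have B1 : (kernel_comb (S n) x - g x) ^+ 2 < (dl / 2) ^+ 2.
    apply: le_lt_trans (rkhs_eval_le x (rkhs_domB (dS n) dg)) _.
    apply: (@le_lt_trans _ _ ((dl / 2) ^+ 2 / (2 * (k x x + 1)) * k x x)).
      by rewrite ler_wpM2r// ltW.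
    rewrite mulrAC ltr_pdivrMr; last by lra.
    by rewrite ltr_pM2l ?exprn_gt0 ?divr_gt0//; lra.
  have B2 : (kernel_comb (S n) x - c x) ^+ 2 < (dl / 2) ^+ 2.
    pose A := kernel_comb (S n) x - c x.
    (* A descent step along the kernel at [x]; the step length minimises the
       value up to a factor that stays finite when [k x x = 0]. *)
    have := I_le (S n ++ scale (- (A / (k x x + 1))) [:: (1, x)]).
    rewrite J_cat_scale.
    have -> : ip (kernel_comb (S n)) (kernel_comb [:: (1, x)]) = kernel_comb (S n) x.
      rewrite rkhs_ipC//; last exact: rkhs_dom_comb.
      by rewrite rkhs_ip_comb// big_seq1 mul1r.
    have -> : N [:: (1, x)] = k x x by rewrite NE !big_seq1 !mul1r.
    have -> : ell [:: (1, x)] = c x by rewrite /ell big_seq1 mul1r.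
    rewrite -/A => HA.
    have h1 : A ^+ 2 / (k x x + 1) - (A / (k x x + 1)) ^+ 2 * (k x x / 2) <= n.+1%:R^-1.
      have := SI n; move: HA; set v := A / (k x x + 1).
      have -> : A ^+ 2 / (k x x + 1) = v * A by rewrite /v; field; rewrite gt_eqF.
      by move: (J _) (n.+1%:R^-1) => j i; lra.
    have h2 : A ^+ 2 / (2 * (k x x + 1)) <= A ^+ 2 / (k x x + 1) - (A / (k x x + 1)) ^+ 2 * (k x x / 2).
      rewrite -subr_ge0.
      have -> : A ^+ 2 / (k x x + 1) - (A / (k x x + 1)) ^+ 2 * (k x x / 2) - A ^+ 2 / (2 * (k x x + 1)) = (A / (k x x + 1)) ^+ 2 / 2.
        by field; rewrite gt_eqF.
      by rewrite divr_ge0// sqr_ge0.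
    have := le_lt_trans (le_trans h2 h1) A2; rewrite /=.
    by rewrite ltr_pM2r ?invr_gt0// mulr_gt0.
  have sq_lt (z : R) : z ^+ 2 < (dl / 2) ^+ 2 -> `|z| < dl / 2.
    by move=> h; rewrite -ltr_sqr ?nnegrE ?divr_ge0// ?real_normK ?num_real// ltW.
  have := ltrD (sq_lt _ B1) (sq_lt _ B2).
  have : dl <= `|kernel_comb (S n) x - g x| + `|kernel_comb (S n) x - c x|.
    rewrite /dl (_ : c x - g x = (kernel_comb (S n) x - g x) - (kernel_comb (S n) x - c x)).
      exact: ler_normB.
    by ring.
  by lra.
rewrite cg; split => //.
- apply/ler_addgt0Pr => e e0; have [M HM] := Sg_small _ e0.
  have := J_ge (S M); have := HM M (leqnn M).
  rewrite rkhs_ipBB// /J /N /ell.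
  have -> : \sum_(p <- S M) p.1 * c p.2 = ip (kernel_comb (S M)) g.
    by rewrite rkhs_ip_comb// cg.
  by lra.
- by move=> e e0; have [M HM] := Sg_small _ e0; exists (S M); exact: HM.
Qed.

End membership.
End rkhs_theory.

(** * Lebesgue measure on row vectors *)

Section lebesgue_rV_theory.
Context (R : realType).
Local Notation leb d := (lebesgue_rV R d).

Definition box d (r : R) : set 'rV[R]_d := [set x | forall i, `|x ord0 i| <= r].

Lemma rV_normP d (x : 'rV[R]_d) (r : R) : 0 <= r -> (`|x| <= r) = `[< box r x >].
Proof.
move=> r0; apply/idP/asboolP => [xr i|xr].
  apply: le_trans xr; rewrite [leRHS]mx_normrE.
  exact: (le_bigmax _ (fun ij => `|x ij.1 ij.2|) (ord0, i)).
rewrite [leLHS]mx_normrE; apply/bigmax_leP; split => // -[i j] _ /=.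
by rewrite (ord1 i).
Qed.

Lemma cube_box d m : @cube R d m = box (4 * m%:R).
Proof.
by apply/seteqP; split => x; rewrite /cube/= rV_normP ?mulr_ge0// => /asboolP.
Qed.

Lemma measurable_box d r : measurable (@box d r).
Proof.
have -> : @box d r = \bigcap_(i in [set: 'I_d]) ((fun x : 'rV[R]_d => x ord0 i) @^-1` `[- r, r]).
  apply/seteqP; split => x /= h i; last by have := h i I; rewrite set_itvcc/= -ler_norml.
  by move=> _; rewrite set_itvcc/= -ler_norml.
apply: fin_bigcap_measurable => // i _.
by rewrite -[X in measurable X]setTI; apply: measurable_coord.
Qed.

Lemma rV_consE0 d (p : 'rV[R]_d * measurableTypeR R) : rV_cons p ord0 ord0 = p.2.
Proof. by rewrite /rV_cons mxE unlift_none. Qed.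

Lemma rV_consE d (p : 'rV[R]_d * measurableTypeR R) j :
  rV_cons p ord0 (lift ord0 j) = p.1 ord0 j.
Proof. by rewrite /rV_cons mxE liftK. Qed.

Lemma lebesgue_rV_box d (r : R) : 0 <= r -> leb d (box r) = ((2 * r) ^+ d)%:E.
Proof.
move=> r0; elim: d => [|d IH].
  by rewrite /= diracE expr0 mem_set// => -[].
rewrite /= /cons_measure /pushforward.
have -> : @rV_cons R d @^-1` box r = box r `*` `[- r, r].
  rewrite set_itvcc; apply/seteqP; split => -[x y] /=.
    move=> h; split => [j|]; first by have := h (lift ord0 j); rewrite rV_consE.
    by have := h ord0; rewrite rV_consE0/= -ler_norml.
  rewrite -ler_norml => -[h1 h2] i; case: (unliftP ord0 i) => [j|] ->.
    by rewrite rV_consE; exact: h1.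
  by rewrite rV_consE0.
rewrite product_measure1E//; last exact: measurable_box.
have := lebesgue_measure_itv `[- r, r]; rewrite set_itvcc /= => Lr.
rewrite [X in (X * _)%E]IH [X in (_ * X)%E]Lr lte_fin.
case: ltP => rr.
  by rewrite -EFinB -EFinM exprSr; congr (_ * _)%:E; ring.
have -> : r = 0 by lra.
by rewrite mule0 mulr0 expr0n.
Qed.

Lemma sigma_finite_lebesgue_rV d : sigma_finite setT (leb d).
Proof.
exists (fun n => box n%:R).
  apply/seteqP; split => // x _.
  exists (Num.trunc `|x|).+1 => //=.
  apply/asboolP; rewrite -rV_normP// ltW//.
  exact: truncnS_gt.
by move=> n; split; [exact: measurable_box|rewrite lebesgue_rV_box// ltry].
Qed.

(** [lebesgue_rV R d] is already a bundled measure, so it cannot carry a further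
    canonical structure; this unbundled copy can, and is convertible to it. *)
Definition lebesgue_rV_sf d : set 'rV[R]_d -> \bar R := leb d.

HB.instance Definition _ d := Measure.on (@lebesgue_rV_sf d).
HB.instance Definition _ d :=
  @Measure_isSigmaFinite.Build _ _ _ (@lebesgue_rV_sf d) (@sigma_finite_lebesgue_rV d).

Lemma lebesgue_rV_Fubini d d' (T : measurableType d')
    (mu : {sigma_finite_measure set T -> \bar R}) (f : T * 'rV[R]_d -> R) :
  measurable_fun setT f ->
  (\int[mu]_x \int[leb d]_y `|(f (x, y))%:E| < +oo)%E ->
  (\int[mu]_x \int[leb d]_y (f (x, y))%:E =
   \int[leb d]_y \int[mu]_x (f (x, y))%:E)%E.
Proof.
move=> mf foo.
have mf' : measurable_fun setT (EFin \o f) by apply/measurable_EFinP.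
have /(integrable12ltyP mu (@lebesgue_rV_sf d) mf') :
  (\int[mu]_x \int[@lebesgue_rV_sf d]_y `|(EFin \o f) (x, y)| < +oo)%E by [].
exact: Fubini.
Qed.

Lemma lebesgue_measure_shift (a : R) (A : set (measurableTypeR R)) : measurable A ->
  lebesgue_measure ((fun x => x + a) @^-1` A) = lebesgue_measure A.
Proof.
pose s (x : measurableTypeR R) : measurableTypeR R := x + a.
have ms : measurable_fun setT s by exact: measurable_funD.
move=> mA; transitivity (pushforward lebesgue_measure s A) => //.
apply/esym/lebesgue_measure_unique => //= _ [[b c]] _ <-.
rewrite /pushforward.
have -> : s @^-1` `]b, c] = [set` `]b - a, c - a]].
  by apply/seteqP; split => x; rewrite /s/= !in_itv/= ltrBlDr lerBrDr.
rewrite !lebesgue_measure_itv/= !lte_fin ltrD2r -!EFinB.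
by rewrite (_ : c - a - (b - a) = c - b)//; ring.
Qed.

Lemma measurable_rV_shift d (a : 'rV[R]_d) : measurable_fun setT (fun x : 'rV[R]_d => x + a).
Proof.
apply: measurable_rV => i; under eq_fun do rewrite mxE.
by apply: measurable_funD => //; exact: measurable_coord.
Qed.

(** By induction on the dimension: a translation shifts every section of a set in
    the last variable added, and moves the section's base point in the others. *)
Lemma lebesgue_rV_shift d (a : 'rV[R]_d) (A : set 'rV[R]_d) : measurable A ->
  leb d ((fun x => x + a) @^-1` A) = leb d A.
Proof.
elim: d a A => [|d IH] a A mA; first by congr (leb 0 _); apply/funext => x /=; rewrite [a]thinmx0 addr0.
pose a' : 'rV[R]_d := \row_j a ord0 (lift ord0 j).
pose B := @rV_cons R d @^-1` A.
have mB : measurable B.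
  by rewrite -[X in measurable X]setTI; exact: measurable_rV_cons.
rewrite /= /cons_measure /pushforward -/B /product_measure1.
pose g x := lebesgue_measure (xsection B x).
have mg : measurable_fun setT g by exact: measurable_fun_xsection.
transitivity (\int[leb d]_x g (x + a')%R)%E.
  apply: eq_integral => x _ /=; rewrite /g -[RHS](lebesgue_measure_shift (a ord0 ord0)).
    congr (lebesgue_measure _); apply/seteqP; split => y;
    rewrite /xsection /= !inE /B /=;
    suff -> : rV_cons (x, y) + a = rV_cons (x + a', y + a ord0 ord0) by [];
    apply/rowP => i; rewrite mxE;
    case: (unliftP ord0 i) => [j|] ->; by rewrite ?rV_consE ?rV_consE0//= !mxE.
  exact: measurable_xsection.
pose s (x : 'rV[R]_d) := x + a'.
have ms : measurable_fun setT s by exact: measurable_rV_shift.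
transitivity (\int[pushforward (leb d) s]_x g x)%E.
  by rewrite [RHS]ge0_integral_pushforward.
by apply: eq_measure_integral => C mC _; exact: IH.
Qed.

Lemma integral_lebesgue_rV_shift d (a : 'rV[R]_d) (f : 'rV[R]_d -> \bar R) :
  measurable_fun setT f ->
  (\int[leb d]_x f (x + a)%R = \int[leb d]_x f x)%E.
Proof.
move=> mf; pose s (x : 'rV[R]_d) := x + a.
have ms : measurable_fun setT s by exact: measurable_rV_shift.
have E g : measurable_fun setT g -> (forall x, 0 <= g x)%E ->
    (\int[leb d]_x g (s x) = \int[leb d]_x g x)%E.
  move=> mg g0; transitivity (\int[pushforward (leb d) s]_x g x)%E.
    by rewrite [RHS]ge0_integral_pushforward.
  by apply: eq_measure_integral => C mC _; exact: lebesgue_rV_shift.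
rewrite integralE [RHS]integralE; congr (_ - _)%E.
  by rewrite -[RHS]E//; [by under eq_integral do rewrite funepos_comp|exact: measurable_funepos].
by rewrite -[RHS]E//; [by under eq_integral do rewrite funeneg_comp|exact: measurable_funeneg].
Qed.
End lebesgue_rV_theory.

(** * Integration of real functions *)

Section integration_facts.
Context d (T : measurableType d) (R : realType).

Lemma measurable_invr (f : T -> R) :
  measurable_fun setT f -> measurable_fun setT (fun x => (f x)^-1).
Proof.
move=> mf.
have -> : (fun x => (f x)^-1) = f \* (fun x => (f x ^+ 2) `^ (-1)).
  apply/funext => x /=; rewrite powR_inv1 ?sqr_ge0//.
  have [->|f0] := eqVneq (f x) 0; first by rewrite mul0r invr0.
  by rewrite expr2 invfM mulrA divff// mul1r.
apply: measurable_funM => //.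
have mf2 : measurable_fun setT (fun x => f x ^+ 2) by exact: measurable_funX.
exact: (measurableT_comp (measurable_powR (-1)) mf2).
Qed.

Lemma measurable_cos_comp (f : T -> R) :
  measurable_fun setT f -> measurable_fun setT (fun x => cos (f x)).
Proof.
apply: measurableT_comp; apply: continuous_measurable_fun; exact: continuous_cos.
Qed.

Lemma measurable_sin_comp (f : T -> R) :
  measurable_fun setT f -> measurable_fun setT (fun x => sin (f x)).
Proof.
apply: measurableT_comp; apply: continuous_measurable_fun; exact: continuous_sin.
Qed.

Context (mu : {measure set T -> \bar R}).
Implicit Types f g : T -> R.
Local Notation itg f := (mu.-integrable setT (EFin \o f)).

Lemma itg_measurable f : itg f -> measurable_fun setT f.
Proof. by move/(measurable_int mu)/measurable_EFinP. Qed.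

Lemma itg_le f g : measurable_fun setT f -> (forall x, `|f x| <= g x) ->
  itg g -> itg f.
Proof.
move=> mf fg; apply: le_integrable => //; first exact/measurable_EFinP.
by move=> x _ /=; rewrite lee_fin (le_trans (fg x))// ler_norm.
Qed.

Lemma itgD f g : itg f -> itg g -> itg (fun x => f x + g x).
Proof. by move=> fi gi; exact: (integrableD measurableT fi gi). Qed.

Lemma itgB f g : itg f -> itg g -> itg (fun x => f x - g x).
Proof. by move=> fi gi; exact: (integrableB measurableT fi gi). Qed.

Lemma itgZ (a : R) f : itg f -> itg (fun x => a * f x).
Proof. by move=> itf; exact: (integrableZl measurableT a itf). Qed.

Lemma itg_norm f : itg f -> itg (fun x => `|f x|).
Proof. exact: integrable_norm. Qed.

Lemma itgM_bounded f g (M : R) : itg f -> measurable_fun setT g ->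
  (forall x, `|g x| <= M) -> itg (fun x => f x * g x).
Proof.
move=> itf mg gM; apply: (@itg_le _ (fun x => M * `|f x|)).
- by apply: measurable_funM => //; exact: itg_measurable.
- by move=> x; rewrite normrM mulrC ler_wpM2r.
- by apply: itgZ; exact: itg_norm.
Qed.

Lemma itg_sum (I : Type) (s : seq I) (F : I -> T -> R) : (forall i, itg (F i)) ->
  itg (fun x => \sum_(i <- s) F i x).
Proof.
move=> itF; elim: s => [|i s IH].
  by under [X in _.-integrable _ (_ \o X)]eq_fun do rewrite big_nil; exact: integrable0.
by under [X in _.-integrable _ (_ \o X)]eq_fun do rewrite big_cons; exact: itgD.
Qed.

Lemma Rintegral_sum (I : Type) (s : seq I) (F : I -> T -> R) : (forall i, itg (F i)) ->
  \int[mu]_x (\sum_(i <- s) F i x) = \sum_(i <- s) \int[mu]_x F i x.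
Proof.
move=> itF; elim: s => [|i s IH].
  under eq_Rintegral do rewrite big_nil; rewrite big_nil.
  by rewrite Rintegral_cst// mul0r.
under eq_Rintegral do rewrite big_cons; rewrite big_cons -IH RintegralD//.
exact: itg_sum.
Qed.

Lemma Rintegral_EFin f : itg f -> (\int[mu]_x (f x)%:E)%E = (\int[mu]_x f x)%:E.
Proof. by move=> itf; rewrite /Rintegral fineK//; exact: integrable_fin_num itf. Qed.

Lemma Rintegral_norm_le f g : itg f -> itg g -> (forall x, `|f x| <= g x) ->
  `|\int[mu]_x f x| <= \int[mu]_x g x.
Proof.
move=> fi gi fg; apply: le_trans (le_normr_Rintegral _ fi) _ => //.
by apply: le_Rintegral => //; exact: itg_norm.
Qed.

Import HBNNSimple.
Local Open Scope ereal_scope.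

(** The integral of a nonnegative function, measurable or not, is a supremum over
    the simple functions below it. *)
Lemma ge0_integral_mono (f g : T -> \bar R) : (forall x, 0 <= f x) ->
  (forall x, f x <= g x) -> \int[mu]_x f x <= \int[mu]_x g x.
Proof.
move=> f0 fg; have g0 x : 0 <= g x by exact: le_trans (fg x).
rewrite !ge0_integralTE//; apply: le_ereal_sup => _ [h /= hf <-].
by exists h => //= x; exact: le_trans (hf x) (fg x).
Qed.

(** A simple function below [g] becomes, once rescaled, lowered by [c] and
    truncated at [0], a measurable function below [f].  So expectations of
    functions of the sample can be bounded without proving them measurable. *)
Lemma ge0_integral_affine_le (f g : T -> \bar R) (al c A : R) :
  mu setT = 1 -> (0 < al)%R -> (0 <= c)%R -> (forall x, 0 <= f x) -> (forall x, 0 <= g x) ->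
  (forall x, g x <= al%:E * (f x + c%:E)) ->
  \int[mu]_x f x <= A%:E -> \int[mu]_x g x <= (al * (A + c))%:E.
Proof.
move=> mu1 al0 c0 f0 g0 gf fA; rewrite ge0_integralTE//.
apply: ge_ereal_sup => _ [h /= hg <-].
pose t x : R := Num.max (al^-1 * h x - c)%R 0%R.
have mh : measurable_fun setT h by exact: measurable_funP.
have mt : measurable_fun setT t.
  by apply: measurable_maxr => //; apply: measurable_funB => //; exact: measurable_funM.
have t0 x : (0 <= t x)%R by rewrite /t le_max lexx orbT.
have tf x : (t x)%:E <= f x.
  rewrite /t; case: (leP (al^-1 * h x - c)%R 0%R) => _; first exact: f0.
  have := le_trans (hg x) (gf x).
  case: (f x) (f0 x) => [r _|_ _|//]; last by rewrite leey.
  rewrite -EFinD -EFinM !lee_fin => hx.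
  by rewrite lerBlDr mulrC ler_pdivrMr// mulrC.
have tA : \int[mu]_x (t x)%:E <= A%:E.
  by apply: le_trans fA; apply: ge0_integral_mono => // x; rewrite ?lee_fin.
rewrite -integralT_nnsfun.
have mtE : measurable_fun setT (EFin \o t) by apply/measurable_EFinP.
apply: (@le_trans _ _ (\int[mu]_x (al%:E * ((t x)%:E + c%:E)))).
  apply: ge0_integral_mono => x; rewrite -?EFinD -?EFinM lee_fin.
    exact: fun_ge0.
  rewrite -(ler_pM2l (_ : 0 < al^-1)%R) ?invr_gt0// mulrA mulVf ?gt_eqF// mul1r.
  by rewrite -lerBlDr /t le_max lexx.
rewrite ge0_integralZl//; last 3 first.
- by apply: emeasurable_funD.
- by move=> x _; rewrite -EFinD lee_fin addr_ge0.
- exact: ltW.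
rewrite EFinM lee_pmul2l// ge0_integralD//; last by move=> x _; rewrite lee_fin.
by rewrite integral_cst// mu1 mule1 EFinD leeD2r.
Qed.

End integration_facts.

Lemma measurable_Rintegral d1 d2 (T1 : measurableType d1) (T2 : measurableType d2)
    (R : realType) (m2 : {sigma_finite_measure set T2 -> \bar R}) (f : T1 * T2 -> R) :
  measurable_fun setT f -> measurable_fun setT (fun x => \int[m2]_y f (x, y)).
Proof.
move=> mf; apply: (measurableT_comp (fine_measurable measurableT)) => //.
have mf' : measurable_fun setT (EFin \o f) by apply/measurable_EFinP.
have -> : (fun x => \int[m2]_y (f (x, y))%:E)%E =
    (fubini_F m2 (EFin \o f)^\+ \- fubini_F m2 (EFin \o f)^\-)%E.
  apply/funext => x; rewrite integralE /fubini_F/=.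
  by congr (_ - _)%E; apply: eq_integral => y _; rewrite ?funeposE ?funenegE.
apply: emeasurable_funB; apply: measurable_fun_fubini_tonelli_F => //.
  exact: measurable_funepos.
exact: measurable_funeneg.
Qed.

Section lebesgue_rV_fubini.
Context (R : realType) (d : nat).
Local Notation leb := (lebesgue_rV R d).
Local Notation Rd := 'rV[R]_d.

Lemma measurable_open (U : set Rd) : open U -> measurable U.
Proof. by move=> oU; exact: sub_sigma_algebra. Qed.

Lemma measurable_continuous (f : Rd -> R) : continuous f -> measurable_fun setT f.
Proof.
move=> cf; apply: (measurability _ (RGenOpens.measurableE R)) => _ [_ [x [y ->]] <-].
rewrite setTI; apply: measurable_open.
by apply: open_comp => [? _|]; [exact: cf|exact: interval_open].
Qed.

Lemma measurable_Rintegral_rV d' (T : measurableType d') (f : T * Rd -> R) :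
  measurable_fun setT f -> measurable_fun setT (fun x => \int[leb]_y f (x, y)).
Proof. exact: (@measurable_Rintegral _ _ _ _ _ (@lebesgue_rV_sf R d)). Qed.

Lemma Rintegral_rV_Fubini d' (T : measurableType d')
    (mu : {sigma_finite_measure set T -> \bar R}) (f : T * Rd -> R) :
  measurable_fun setT f ->
  (forall x, leb.-integrable setT (EFin \o (fun y => f (x, y)))) ->
  (forall y, mu.-integrable setT (EFin \o (fun x => f (x, y)))) ->
  (\int[mu]_x \int[leb]_y `|(f (x, y))%:E| < +oo)%E ->
  \int[mu]_x \int[leb]_y f (x, y) = \int[leb]_y \int[mu]_x f (x, y).
Proof.
move=> mf f1 f2 foo; rewrite /Rintegral; congr fine.
under eq_integral do rewrite -Rintegral_EFin//.
under [RHS]eq_integral do rewrite -Rintegral_EFin//.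
exact: lebesgue_rV_Fubini.
Qed.

Lemma Rintegral_rV_Fubini_prod (f : Rd * Rd -> R) (g h : Rd -> R) :
  measurable_fun setT f -> leb.-integrable setT (EFin \o g) ->
  leb.-integrable setT (EFin \o h) -> (forall x, 0 <= g x) ->
  (forall x y, `|f (x, y)| <= g x * h y) ->
  \int[leb]_x \int[leb]_y f (x, y) = \int[leb]_y \int[leb]_x f (x, y).
Proof.
move=> mf gi hi g0 fgh.
apply: (@Rintegral_rV_Fubini _ _ (@lebesgue_rV_sf R d)) => //.
- move=> x; apply: (itg_le _ (fgh x)); last exact: itgZ.
  by apply: measurableT_comp => //; exact: pair1_measurable.
- move=> y; apply: (@itg_le _ _ _ _ _ (fun x => h y * g x)); last exact: itgZ.
    by apply: measurableT_comp => //; exact: pair2_measurable.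
  by move=> x; rewrite mulrC.
have itgh x : leb.-integrable setT (EFin \o (fun y => g x * h y)) by exact: itgZ.
pose I := \int[leb]_y `|h y|.
apply: (@le_lt_trans _ _ (\int[leb]_x (I * g x)%:E)%E); last first.
  by rewrite Rintegral_EFin ?ltry//; exact: itgZ.
apply: ge0_integral_mono => x; first exact: integral_ge0.
rewrite mulrC -RintegralZl//; last exact: itg_norm.
rewrite -Rintegral_EFin; last by apply: itgZ; exact: itg_norm.
apply: ge0_integral_mono => // y; rewrite lee_fin.
by rewrite (le_trans (fgh x y))// ler_wpM2l// ler_norm.
Qed.
End lebesgue_rV_fubini.

(** * Real trigonometric integrals *)

Section trig_integrals.
Context (R : realType) (d : nat).
Local Notation leb := (lebesgue_rV R d).
Local Notation Rd := 'rV[R]_d.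
Local Notation itg f := (leb.-integrable setT (EFin \o f)).
Implicit Types (x y w : Rd) (u v f : Rd -> R).

Lemma dotC x w : dot x w = dot w x.
Proof. by apply: eq_bigr => i _; rewrite mulrC. Qed.

Lemma dotDl x y w : dot (x + y) w = dot x w + dot y w.
Proof. by rewrite -big_split; apply: eq_bigr => i _; rewrite mxE mulrDl. Qed.

Lemma dotNl x w : dot (- x) w = - dot x w.
Proof. by rewrite -sumrN; apply: eq_bigr => i _; rewrite mxE mulNr. Qed.

Lemma dotBl x y w : dot (x - y) w = dot x w - dot y w.
Proof. by rewrite dotDl dotNl. Qed.

Lemma dotDr x y w : dot w (x + y) = dot w x + dot w y.
Proof. by rewrite dotC dotDl !(dotC w). Qed.

Lemma measurable_dot : measurable_fun setT (fun p : Rd * Rd => dot p.1 p.2).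
Proof.
apply: measurable_sum => i; apply: measurable_funM.
  exact: (measurableT_comp (measurable_coord i) measurable_fst).
exact: (measurableT_comp (measurable_coord i) measurable_snd).
Qed.

Lemma measurable_dot1 x : measurable_fun setT (dot x).
Proof.
by apply: measurable_sum => i; apply: measurable_funM => //; exact: measurable_coord.
Qed.

Lemma measurable_rV_sub : measurable_fun setT (fun p : Rd * Rd => p.1 - p.2).
Proof.
apply: measurable_rV => i; under eq_fun do rewrite !mxE.
apply: measurable_funB.
  exact: (measurableT_comp (measurable_coord i) measurable_fst).
exact: (measurableT_comp (measurable_coord i) measurable_snd).
Qed.

Lemma itg_shift (a : Rd) f : itg f -> itg (fun x => f (x + a)).
Proof.
move=> /integrableP[mf foo]; apply/integrableP; split.
  exact: (measurableT_comp mf (measurable_rV_shift a)).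
by rewrite (integral_lebesgue_rV_shift a (measurableT_comp (@abse_measurable R _) mf)).
Qed.

Lemma Rintegral_shift (a : Rd) f : measurable_fun setT f ->
  \int[leb]_x f (x + a) = \int[leb]_x f x.
Proof.
move=> mf; rewrite /Rintegral.
by rewrite (integral_lebesgue_rV_shift a (f := EFin \o f))//; exact/measurable_EFinP.
Qed.

(** The inverse Fourier transform of [u - i v] when it is real, up to the factor
    [(2 pi)^-d].  Real pairs of densities spare the complex integrals. *)
Definition trig_int u v x : R :=
  \int[leb]_w (u w * cos (dot x w) + v w * sin (dot x w)).

Lemma itg_cos u x : itg u -> itg (fun w => u w * cos (dot x w)).
Proof.
move=> iu; apply: (itgM_bounded iu (M := 1)).
  by apply: measurable_cos_comp; exact: measurable_dot1.
by move=> w; exact: cos_max.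
Qed.

Lemma itg_sin u x : itg u -> itg (fun w => u w * sin (dot x w)).
Proof.
move=> iu; apply: (itgM_bounded iu (M := 1)).
  by apply: measurable_sin_comp; exact: measurable_dot1.
by move=> w; exact: sin_max.
Qed.

Lemma itg_trig u v x : itg u -> itg v ->
  itg (fun w => u w * cos (dot x w) + v w * sin (dot x w)).
Proof. by move=> iu iv; apply: itgD; [exact: itg_cos|exact: itg_sin]. Qed.

Lemma norm_trig_le u v x w :
  `|u w * cos (dot x w) + v w * sin (dot x w)| <= `|u w| + `|v w|.
Proof.
rewrite (le_trans (ler_normD _ _))// !normrM.
by rewrite lerD// ler_piMr// ?cos_max ?sin_max.
Qed.

Lemma measurable_trig_pair u v : measurable_fun setT u -> measurable_fun setT v ->
  measurable_fun setT (fun p : Rd * Rd =>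
    u p.2 * cos (dot p.1 p.2) + v p.2 * sin (dot p.1 p.2)).
Proof.
move=> mu mv; apply: measurable_funD; apply: measurable_funM.
- exact: (measurableT_comp mu measurable_snd).
- by apply: measurable_cos_comp; exact: measurable_dot.
- exact: (measurableT_comp mv measurable_snd).
- by apply: measurable_sin_comp; exact: measurable_dot.
Qed.

Lemma measurable_trig_int u v : measurable_fun setT u -> measurable_fun setT v ->
  measurable_fun setT (trig_int u v).
Proof. by move=> mu mv; exact: measurable_Rintegral_rV (measurable_trig_pair mu mv). Qed.

Lemma regular_kernelB f x y : regular_kernel f -> f (x - y) = f (y - x).
Proof. by case=> _ _ sym _; rewrite -sym opprB. Qed.

Section kernel.
Variable phi : Rd -> R.
Hypothesis phi_dens : probability_density phi.
Hypothesis phi_reg : regular_kernel phi.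
Hypothesis phi_pos : forall w, 0 <= fourier phi w.

Lemma phi_ge0 x : 0 <= phi x. Proof. exact: phi_dens.1. Qed.

Lemma measurable_phi : measurable_fun setT phi.
Proof. by case: phi_reg => _ cphi _ _; exact: measurable_continuous. Qed.

Lemma itg_phi : itg phi.
Proof.
apply/integrableP; split; first by apply/measurable_EFinP; exact: measurable_phi.
under eq_integral do rewrite /= ger0_norm ?phi_ge0//.
by rewrite phi_dens.2 ltry.
Qed.

Lemma Rintegral_phi : \int[leb]_x phi x = 1.
Proof. by rewrite /Rintegral phi_dens.2. Qed.

Lemma itg_phiB x : itg (fun y => phi (y - x)).
Proof. exact: itg_shift itg_phi. Qed.

Lemma sigmaE w : sigma phi w = \int[leb]_x (phi x * cos (dot w x)).
Proof.
rewrite /sigma /fourier /cintegral/=; apply: eq_Rintegral => x _ /=.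
by rewrite mulr0 subr0 cosN mulrC.
Qed.

(** The hypothesis [0 <= fourier phi w] contains that the imaginary part is 0. *)
Lemma phi_sin0 w : \int[leb]_x (phi x * sin (dot w x)) = 0.
Proof.
have := phi_pos w; rewrite lecE => /andP[/eqP + _] /=.
rewrite /fourier /cintegral/= => h.
have : \int[leb]_x (- 1 * (phi x * sin (dot w x))) = 0.
  rewrite -[RHS]h; apply: eq_Rintegral => x _ /=.
  by rewrite mulr0 add0r sinN mulN1r mulNr mulrC.
rewrite RintegralZl//; last by apply: itg_sin; exact: itg_phi.
by move/eqP; rewrite mulN1r oppr_eq0 => /eqP.
Qed.

Lemma measurable_sigma : measurable_fun setT (sigma phi).
Proof.
have -> : sigma phi = trig_int phi (fun=> 0).
  apply/funext => w; rewrite sigmaE; apply: eq_Rintegral => x _.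
  by rewrite mul0r addr0.
by apply: measurable_trig_int => //; exact: measurable_phi.
Qed.

(** As the sine transform of [phi] vanishes ([phi_sin0]), the characters are
    eigenvectors of the convolution by [phi] with a real eigenvalue. *)
Lemma conv_phi_trig (a b : R) x w :
  \int[leb]_y (phi (x - y) * (a * cos (dot w y) + b * sin (dot w y)))
  = sigma phi w * (a * cos (dot w x) + b * sin (dot w x)).
Proof.
under eq_Rintegral do rewrite (regular_kernelB _ _ phi_reg).
transitivity (\int[leb]_y (phi y *
    (a * cos (dot w (y + x)) + b * sin (dot w (y + x))))).
  rewrite -[RHS](Rintegral_shift (- x)).
    by apply: eq_Rintegral => y _; rewrite subrK.
  have mw := measurableT_comp (measurable_dot1 w) (measurable_rV_shift x).
  apply: measurable_funM; first exact: measurable_phi.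
  by apply: measurable_funD; apply: measurable_funM => //;
    [exact: measurable_cos_comp|exact: measurable_sin_comp].
pose A := a * cos (dot w x) + b * sin (dot w x).
pose B := b * cos (dot w x) - a * sin (dot w x).
transitivity (\int[leb]_y (A * (phi y * cos (dot w y)) + B * (phi y * sin (dot w y)))).
  by apply: eq_Rintegral => y _; rewrite dotDr cosD sinD /A /B; ring.
have ic := itg_cos w itg_phi; have is_ := itg_sin w itg_phi.
rewrite RintegralD//; [|exact: itgZ..].
by rewrite !RintegralZl// phi_sin0 mulr0 addr0 -sigmaE mulrC.
Qed.

(** [conv_phi_trig] under the integral sign. *)
Lemma convolution_trig_int u v x : itg u -> itg v ->
  convolution phi (trig_int u v) x =
  trig_int (fun w => sigma phi w * u w) (fun w => sigma phi w * v w) x.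
Proof.
move=> iu iv; have mu := itg_measurable iu; have mv := itg_measurable iv.
rewrite /convolution /trig_int.
transitivity (\int[leb]_y \int[leb]_w
    (phi (x - y) * (u w * cos (dot y w) + v w * sin (dot y w)))).
  by apply: eq_Rintegral => y _; rewrite RintegralZl//; exact: itg_trig.
rewrite (@Rintegral_rV_Fubini_prod _ _
  (fun p => phi (x - p.1) * (u p.2 * cos (dot p.1 p.2) + v p.2 * sin (dot p.1 p.2)))
  (fun y => phi (x - y)) (fun w => `|u w| + `|v w|)).
- apply: eq_Rintegral => w _.
  under eq_Rintegral do rewrite /= !(dotC _ w).
  by rewrite conv_phi_trig !(dotC w); ring.
- apply: measurable_funM; last exact: measurable_trig_pair.
  under eq_fun do rewrite (regular_kernelB _ _ phi_reg).
  apply: (measurableT_comp measurable_phi).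
  exact: (measurableT_comp (measurable_rV_shift (- x)) measurable_fst).
- by under [X in itg X]eq_fun do rewrite (regular_kernelB _ _ phi_reg); exact: itg_phiB.
- by apply: itgD; exact: itg_norm.
- by move=> y; exact: phi_ge0.
- by move=> y w; rewrite normrM (ger0_norm (phi_ge0 _)) ler_wpM2l ?phi_ge0// norm_trig_le.
Qed.
End kernel.
End trig_integrals.

(** * The spectral description of the reproducing kernel space *)

Section spectral.
Context (R : realType) (d : nat).
Local Notation leb := (lebesgue_rV R d).
Local Notation Rd := 'rV[R]_d.
Local Notation itg f := (leb.-integrable setT (EFin \o f)).
Variables (lam Lam : Rd -> R).
Hypothesis lamLam : spectral_density lam Lam.

Let C2pi : R := (2 * pi) ^+ d.

Let C2pi_gt0 : 0 < C2pi.
Proof. by rewrite exprn_gt0// mulr_gt0// pi_gt0. Qed.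

Lemma itg_Lam : itg Lam. Proof. by case: lamLam. Qed.

Lemma Lam_ge0 w : 0 <= Lam w. Proof. by case: lamLam. Qed.

Lemma spectralE x : C2pi * lam x = \int[leb]_w (Lam w * cos (dot x w)).
Proof.
have [_ _ /(_ x)] := lamLam.
rewrite /inv_fourier /cintegral/= => /(congr1 (@complex.Re R))/= ->.
rewrite mul0r subr0 mulrA divff ?gt_eqF// mul1r.
by apply: eq_Rintegral => w _ /=; rewrite mulr0 subr0 mulrC.
Qed.

Lemma spectral_quadratic (s : seq (R * Rd)) :
  C2pi * \sum_(p <- s) \sum_(q <- s) p.1 * q.1 * lam (p.2 - q.2) =
  \int[leb]_w (Lam w * ((\sum_(p <- s) p.1 * cos (dot p.2 w)) ^+ 2
                      + (\sum_(p <- s) p.1 * sin (dot p.2 w)) ^+ 2)).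
Proof.
have ic x := itg_cos x itg_Lam.
transitivity (\sum_(p <- s) \sum_(q <- s)
    \int[leb]_w (p.1 * q.1 * (Lam w * cos (dot (p.2 - q.2) w)))).
  rewrite mulr_sumr; apply: eq_bigr => p _; rewrite mulr_sumr; apply: eq_bigr => q _.
  by rewrite RintegralZl// -spectralE mulrCA.
under eq_bigr do (rewrite -Rintegral_sum; last by move=> ?; exact: itgZ).
rewrite -Rintegral_sum; last by move=> p; apply: itg_sum => q; exact: itgZ.
apply: eq_Rintegral => w _.
rewrite !expr2 !mulr_suml -big_split/= mulr_sumr; apply: eq_bigr => p _.
rewrite !mulr_sumr -big_split/= mulr_sumr; apply: eq_bigr => q _.
by rewrite dotBl cosB; ring.
Qed.

Section membership.
Variables u v : Rd -> R.
Hypotheses (mu : measurable_fun setT u) (mv : measurable_fun setT v).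
Hypothesis uv0 : forall w, Lam w = 0 -> u w = 0 /\ v w = 0.
Let q w := (u w ^+ 2 + v w ^+ 2) / Lam w.
Hypothesis itg_q : itg q.

Let q_ge0 w : 0 <= q w.
Proof. by rewrite divr_ge0 ?addr_ge0 ?sqr_ge0 ?Lam_ge0. Qed.

Let norm_le w (a b : R) : q w = (a ^+ 2 + b ^+ 2) / Lam w ->
  (Lam w = 0 -> a = 0) -> `|a| <= q w + Lam w.
Proof.
move=> qE a0; have := Lam_ge0 w; rewrite le_eqVlt => /orP[/eqP/esym L0|L0].
  by rewrite a0// normr0 addr_ge0// Lam_ge0.
rewrite -(ler_pM2r L0) mulrDl qE mulfVK ?gt_eqF//.
rewrite -[a ^+ 2]real_normK ?num_real//.
have := sqr_ge0 b; have := sqr_ge0 (`|a| - Lam w).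
have : 0 <= `|a| * Lam w by rewrite mulr_ge0// ltW.
by rewrite -!expr2; nra.
Qed.

Lemma spectral_itg_u : itg u.
Proof.
apply: (itg_le mu _ (itgD itg_q itg_Lam)) => w.
by apply: (norm_le (b := v w)) => // /uv0[].
Qed.

Lemma spectral_itg_v : itg v.
Proof.
apply: (itg_le mv _ (itgD itg_q itg_Lam)) => w.
by apply: (norm_le (b := u w)) => [|/uv0[]//]; rewrite addrC.
Qed.

(** In the spectral picture the kernel at [x] is a character in [L^2(Lam)], and
    the norm of a trigonometric integral is that of its density divided by [Lam].
    Only one inequality is proved: the bound required by [rkhs_mem] is
    [2 (uA + vB) <= c (u^2 + v^2) / Lam + Lam (A^2 + B^2) / c], integrated, where
    [A] and [B] are the trigonometric sums of a kernel combination, whose norm is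
    given by [spectral_quadratic]. *)
Lemma trig_int_rkhs (H : rkhs (fun x y => lam (x - y))) (c := trig_int u v) :
  [/\ rkhs_dom H c, rkhs_ip H c c <= C2pi * \int[leb]_w q w &
    forall e, 0 < e -> exists s,
      rkhs_ip H (kernel_comb (fun x y => lam (x - y)) s \- c)
                (kernel_comb (fun x y => lam (x - y)) s \- c) < e].
Proof.
apply: rkhs_mem => s; have iu := spectral_itg_u; have iv := spectral_itg_v.
pose A w := \sum_(p <- s) p.1 * cos (dot p.2 w).
pose B w := \sum_(p <- s) p.1 * sin (dot p.2 w).
have -> : 2 * (\sum_(p <- s) p.1 * c p.2) = \int[leb]_w (2 * (u w * A w + v w * B w)).
  under eq_bigr do (rewrite -RintegralZl//; last exact: itg_trig).
  rewrite -Rintegral_sum; last by move=> p; apply: itgZ; exact: itg_trig.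
  rewrite -RintegralZl//; last by apply: itg_sum => p; apply: itgZ; exact: itg_trig.
  apply: eq_Rintegral => w _; congr (_ * _).
  rewrite /A /B !mulr_sumr -big_split/=; apply: eq_bigr => p _; ring.
have mA : measurable_fun setT A.
  apply: measurable_sum => p; apply: measurable_funM => //.
  by apply: measurable_cos_comp; exact: measurable_dot1.
have mB : measurable_fun setT B.
  apply: measurable_sum => p; apply: measurable_funM => //.
  by apply: measurable_sin_comp; exact: measurable_dot1.
pose M := \sum_(p <- s) `|p.1|.
have AM w : `|A w| <= M.
  rewrite (le_trans (ler_norm_sum _ _ _))// ler_sum// => p _.
  by rewrite normrM ler_piMr// cos_max.
have BM w : `|B w| <= M.
  rewrite (le_trans (ler_norm_sum _ _ _))// ler_sum// => p _.
  by rewrite normrM ler_piMr// sin_max.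
have iuv : itg (fun w => 2 * (u w * A w + v w * B w)).
  by apply: itgZ; apply: itgD; [exact: (itgM_bounded iu mA AM)|exact: (itgM_bounded iv mB BM)].
have iL : itg (fun w => Lam w * (A w ^+ 2 + B w ^+ 2)).
  apply: (itgM_bounded itg_Lam (M := M ^+ 2 + M ^+ 2)).
    by apply: measurable_funD; exact: measurable_funX.
  move=> w; rewrite ger0_norm ?addr_ge0 ?sqr_ge0//.
  have sq (a : R) : `|a| <= M -> a ^+ 2 <= M ^+ 2.
    by move=> aM; rewrite -real_normK ?num_real// lerXn2r// nnegrE (le_trans _ aM).
  by rewrite lerD// sq.
have -> : \sum_(p <- s) \sum_(q <- s) p.1 * q.1 * lam (p.2 - q.2) =
    C2pi^-1 * \int[leb]_w (Lam w * (A w ^+ 2 + B w ^+ 2)).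
  by rewrite -spectral_quadratic mulrA mulVf ?mul1r// gt_eqF.
rewrite -!RintegralZl// -RintegralD//; [|exact: itgZ..].
apply: le_Rintegral => //; first by apply: itgD; exact: itgZ.
move=> w _; have := Lam_ge0 w; rewrite le_eqVlt => /orP[/eqP/esym L0|L0].
  have [-> ->] := uv0 L0; rewrite !mul0r addr0 mulr0 L0 mul0r mulr0 addr0.
  by rewrite mulr_ge0 ?q_ge0// ltW.
rewrite -subr_ge0 /q.
have -> : C2pi * ((u w ^+ 2 + v w ^+ 2) / Lam w) + C2pi^-1 * (Lam w * (A w ^+ 2 + B w ^+ 2))
    - 2 * (u w * A w + v w * B w) =
  ((C2pi * u w - Lam w * A w) ^+ 2 + (C2pi * v w - Lam w * B w) ^+ 2) / (C2pi * Lam w).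
  by field; rewrite !gt_eqF.
by rewrite divr_ge0 ?addr_ge0 ?sqr_ge0// mulr_ge0 ?ltW.
Qed.

End membership.
End spectral.

(** * Integration against finite signed measures *)

Section charges.
Context d (T : measurableType d) (R : realType).
Implicit Types (nu : {charge set T -> \bar R}) (f g : T -> R).

Definition bounded_mfun f := measurable_fun setT f /\ exists M, forall x, `|f x| <= M.

Lemma bounded_mfun_itg (mu : {measure set T -> \bar R}) f :
  mu setT \is a fin_num -> bounded_mfun f -> mu.-integrable setT (EFin \o f).
Proof.
move=> muT [mf [M fM]]; apply: measurable_bounded_integrable => //.
  by rewrite -ge0_fin_numE.
exists M; split; first exact: num_real.
by move=> x Mx y _ /=; rewrite (le_trans (fM y))// ltW.
Qed.

Lemma bounded_mfunP (mu : {finite_measure set T -> \bar R}) f :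
  bounded_mfun f -> mu.-integrable setT (EFin \o f).
Proof. by apply: bounded_mfun_itg; rewrite fin_num_measure. Qed.

Lemma pos_neg_part nu A : measurable A -> nu A = (pos_part nu A - neg_part nu A)%E.
Proof.
move=> mA; rewrite (jordan_decomp (proj2_sig (hahn_sets nu)) mA).
by rewrite /cadd/= cscaleN1.
Qed.

(** [charge_integral] is defined by one chosen Hahn decomposition.  Its linearity
    in the measure rests on this independence of the decomposition: the positive
    part plus [m2] and the negative part plus [m1] are the same measure. *)
Lemma charge_integral_diff nu (m1 m2 : {measure set T -> \bar R}) f :
  fin_num_fun m1 -> fin_num_fun m2 -> bounded_mfun f ->
  (forall A, measurable A -> nu A = (m1 A - m2 A)%E) ->
  charge_integral nu f = \int[m1]_x f x - \int[m2]_x f x.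
Proof.
move=> fin1 fin2 bf nuE; rewrite /charge_integral.
have ip := bounded_mfunP (pos_part nu) bf; have in_ := bounded_mfunP (neg_part nu) bf.
have i1 := bounded_mfun_itg (fin1 _ measurableT) bf.
have i2 := bounded_mfun_itg (fin2 _ measurableT) bf.
have mf : measurable_fun setT (EFin \o f) by apply/measurable_EFinP; case: bf.
have : (\int[measure_add (pos_part nu) m2]_x (f x)%:E =
        \int[measure_add m1 (neg_part nu)]_x (f x)%:E)%E.
  apply: eq_measure_integral => A mA _.
  transitivity (pos_part nu A + m2 A)%E; first exact: measure_addE.
  transitivity (m1 A + neg_part nu A)%E; last exact/esym/measure_addE.
  have := nuE A mA; rewrite pos_neg_part//.
  have : pos_part nu A \is a fin_num by rewrite fin_num_measure.
  have : neg_part nu A \is a fin_num by rewrite fin_num_measure.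
  have := fin1 A mA.
  have := fin2 A mA.
  case: (pos_part nu A) (neg_part nu A) (m1 A) (m2 A) => [p||] [q||] [r||] [s||]//.
  by move=> _ _ _ _; rewrite -!EFinB -!EFinD => -[h]; congr EFin; lra.
rewrite !integral_measure_add//.
have E (m : {measure set T -> \bar R}) : m.-integrable setT (EFin \o f) ->
  (\int[m]_x (f x)%:E)%E = (\int[m]_x f x)%:E by exact: Rintegral_EFin.
by rewrite !E// -!EFinD => -[h]; lra.
Qed.

Lemma charge_integral_add nu1 nu2 f : bounded_mfun f ->
  charge_integral (charge_add nu1 nu2) f = charge_integral nu1 f + charge_integral nu2 f.
Proof.
move=> bf.
have fin (m1 m2 : {finite_measure set T -> \bar R}) : fin_num_fun (measure_add m1 m2).
  by move=> A mA; rewrite [X in X \is a fin_num]measure_addE fin_numD !fin_num_measure.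
have mf : measurable_fun setT (EFin \o f) by apply/measurable_EFinP; case: bf.
rewrite (@charge_integral_diff _ (measure_add (pos_part nu1) (pos_part nu2))
  (measure_add (neg_part nu1) (neg_part nu2)))//; [|exact: fin|exact: fin|].
  have E (m1 m2 : {finite_measure set T -> \bar R}) :
      \int[measure_add m1 m2]_x f x = \int[m1]_x f x + \int[m2]_x f x.
    have i1 := bounded_mfunP m1 bf; have i2 := bounded_mfunP m2 bf.
    by rewrite /Rintegral integral_measure_add// fineD//; exact: integrable_fin_num.
  by rewrite !E /charge_integral; ring.
move=> A mA; transitivity (nu1 A + nu2 A)%E => //; rewrite !pos_neg_part//.
transitivity (pos_part nu1 A + pos_part nu2 A - (neg_part nu1 A + neg_part nu2 A))%E.
  by rewrite fin_num_oppeD ?fin_num_measure// addeACA.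
by congr (_ - _)%E; apply/esym; exact: measure_addE.
Qed.

Lemma charge_integral_czero f : bounded_mfun f ->
  charge_integral (czero : {charge set T -> \bar R}) f = 0.
Proof.
move=> bf; rewrite (@charge_integral_diff _ mzero mzero)// ?subrr//.
by move=> A _; rewrite /czero subee.
Qed.

Lemma charge_integral_scale_dirac (c : R) x f : 0 <= c -> bounded_mfun f ->
  charge_integral (charge_scale c (charge_dirac R x)) f = c * f x.
Proof.
move=> c0 bf; pose c' := NngNum c0.
have fin : fin_num_fun (mscale c' (\d_x : set T -> \bar R)).
  by move=> A mA; rewrite /mscale/= fin_numM// fin_num_measure.
have mf : measurable_fun setT (EFin \o f) by apply/measurable_EFinP; case: bf.
rewrite (@charge_integral_diff _ (mscale c' \d_x) mzero)//.
  rewrite {2}/Rintegral integral_measure_zero subr0.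
  rewrite /Rintegral integralE !ge0_integral_mscale//;
    [|exact: measurable_funeneg|exact: measurable_funepos].
  rewrite !integral_dirac//; [|exact: measurable_funeneg|exact: measurable_funepos].
  rewrite diracT !mul1e -muleBr ?fin_num_adde_defr//; last first.
    by rewrite funeposE/= -EFin_max.
  have := congr1 (fun h => h x) (funeposneg (EFin \o f)) => /= <-.
  by rewrite -EFinM.
by move=> A mA; rewrite /= sube0.
Qed.

Lemma charge_integral_point_masses N (c : 'I_N -> R) (x : 'I_N -> T) f :
  (forall i, 0 <= c i) -> bounded_mfun f ->
  charge_integral (point_masses c x) f = \sum_i c i * f (x i).
Proof.
move=> c0 bf; rewrite /point_masses; elim/big_ind2: _ => //.
- exact: charge_integral_czero.
- by move=> _ nu1 _ nu2 <- <-; rewrite charge_integral_add.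
- by move=> i _; exact: charge_integral_scale_dirac.
Qed.

Lemma point_massesE N (c : 'I_N -> R) (x : 'I_N -> T) A :
  point_masses c x A = (\sum_i c i * \1_A (x i))%:E.
Proof.
rewrite /point_masses.
elim/big_ind2: _ => //.
by move=> r1 nu1 r2 nu2 h1 h2; transitivity (nu1 A + nu2 A)%E => //; rewrite h1 h2.
Qed.

Lemma total_variationE nu :
  Defs.total_variation nu = (pos_part nu setT + neg_part nu setT)%E.
Proof. by []. Qed.

Lemma total_variation_point_masses N (c : 'I_N -> R) (x : 'I_N -> T) :
  (forall i, 0 <= c i) -> (Defs.total_variation (point_masses c x) <= (\sum_i c i)%:E)%E.
Proof.
move=> c0; rewrite total_variationE.
have [[mP _] [mN _] _ _] := proj2_sig (hahn_sets (point_masses c x)).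
have -> : neg_part (point_masses c x) setT = 0%E.
  apply/eqP; rewrite eq_le measure_ge0 andbT.
  rewrite [leLHS](cjordan_negE (proj2_sig (hahn_sets (point_masses c x)))).
  rewrite /crestr0 mem_set// /crestr/= point_massesE -EFinN lee_fin oppr_le0.
  by apply: sumr_ge0 => i _; rewrite mulr_ge0.
rewrite adde0 [leLHS](cjordan_posE (proj2_sig (hahn_sets (point_masses c x)))).
rewrite /crestr0 mem_set// /crestr/= point_massesE lee_fin; apply: ler_sum => i _.
by rewrite ler_piMr// indicE; case: (_ \in _).
Qed.

Lemma bounded_mfunD f g : bounded_mfun f -> bounded_mfun g ->
  bounded_mfun (fun x => f x + g x).
Proof.
move=> [mf [M fM]] [mg [N gN]]; split; first exact: measurable_funD.
by exists (M + N) => x; rewrite (le_trans (ler_normD _ _))// lerD.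
Qed.

Lemma bounded_mfunZ a f : bounded_mfun f -> bounded_mfun (fun x => a * f x).
Proof.
move=> [mf [M fM]]; split; first exact: measurable_funM.
by exists (`|a| * M) => x; rewrite normrM ler_wpM2l.
Qed.

Lemma bounded_mfun_cst a : bounded_mfun (fun=> a).
Proof. by split => //; exists `|a|. Qed.

Lemma bounded_mfunB f g : bounded_mfun f -> bounded_mfun g ->
  bounded_mfun (fun x => f x - g x).
Proof.
move=> [mf [M fM]] [mg [N gN]]; split; first exact: measurable_funB.
by exists (M + N) => x; rewrite (le_trans (ler_normB _ _))// lerD.
Qed.

Lemma bounded_mfun_indic A : measurable A -> bounded_mfun (\1_A : T -> R).
Proof.
move=> mA; split; first exact: measurable_indic.
by exists 1 => x; rewrite indicE; case: (_ \in _); rewrite ?normr1 ?normr0.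
Qed.

Lemma charge_integral_indic nu A : measurable A ->
  nu A = (charge_integral nu \1_A)%:E.
Proof.
move=> mA; rewrite pos_neg_part// /charge_integral /Rintegral !integral_indic// setIT.
by rewrite EFinB !fineK// fin_num_measure.
Qed.

End charges.

(** * Dual coefficients and the adjoint identity *)

Section duality.
Context (R : realType) (d : nat).
Local Notation leb := (lebesgue_rV R d).
Local Notation Rd := 'rV[R]_d.
Local Notation itg f := (leb.-integrable setT (EFin \o f)).
Variables (phi lam : Rd -> R).
Hypothesis phi_dens : probability_density phi.
Hypothesis phi_reg : regular_kernel phi.
Hypothesis lam_reg : regular_kernel lam.
Variable H : rkhs (fun x y => lam (x - y)).
Local Notation dom := (rkhs_dom H).
Local Notation ip := (rkhs_ip H).
Local Notation kcomb := (kernel_comb (fun x y => lam (x - y))).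

Lemma bounded_mfun_regular f : regular_kernel f -> @bounded_mfun _ Rd R f.
Proof.
move=> [[M [Mreal fM]] cf _ _]; split; first exact: measurable_continuous.
by exists (M + 1) => x; apply: fM; rewrite ?ltrDl.
Qed.

Lemma bounded_mfun_shift f x : @bounded_mfun _ Rd R f -> @bounded_mfun _ Rd R (fun y => f (y - x)).
Proof.
move=> [mf [M fM]]; split; last by exists M => y.
exact: (measurableT_comp mf (measurable_rV_shift (- x))).
Qed.

(** Membership in the closed span of the kernels, in the form in which
    [rkhs_mem] provides it. *)
Definition approximable (c : Rd -> R) := forall e, 0 < e -> exists s,
  ip (kcomb s \- c) (kcomb s \- c) < e.

(** The reproducing property gives the identity when [c] is a kernel combination.
    Both sides are continuous in [c] for the norm of the space, because
    evaluations are bounded by [sqrt (lam 0)] times the norm. *)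
Lemma ip_convolution (c nu : Rd -> R) : dom c -> approximable c ->
  measurable_fun setT c -> itg nu -> dom (convolution lam nu) ->
  ip (convolution lam nu) c = \int[leb]_y (c y * nu y).
Proof.
move=> dc apc mc inu dh; set h := convolution lam nu in dh *.
have [mlam [B lamB]] := bounded_mfun_regular lam_reg.
have inu_bounded (f : Rd -> R) (M : R) : measurable_fun setT f -> (forall x, `|f x| <= M) ->
    itg (fun y => f y * nu y).
  move=> mf fM; under [X in itg X]eq_fun do rewrite mulrC.
  exact: itgM_bounded fM.
have mk (x : Rd) : measurable_fun setT (fun y : Rd => lam (y - x)).
  exact: (measurableT_comp mlam (measurable_rV_shift (- x))).
have ik x : itg (fun y => lam (y - x) * nu y) by exact: (inu_bounded _ B).
have hcomb s : ip h (kcomb s) = \int[leb]_y (kcomb s y * nu y).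
  rewrite rkhs_ipC//; last exact: rkhs_dom_comb.
  rewrite rkhs_ip_comb//.
  transitivity (\sum_(p <- s) \int[leb]_y (p.1 * (lam (y - p.2) * nu y))).
    apply: eq_bigr => p _; rewrite RintegralZl//; congr (_ * _).
    by apply: eq_Rintegral => y _; rewrite (regular_kernelB _ _ lam_reg).
  rewrite -Rintegral_sum; last by move=> p; exact: itgZ.
  apply: eq_Rintegral => y _; rewrite /kernel_comb mulr_suml.
  by apply: eq_bigr => p _; rewrite mulrA.
have eval_le (f : Rd -> R) x : dom f -> `|f x| <= Num.sqrt (ip f f) * Num.sqrt (lam 0).
  move=> df; rewrite -sqrtrM ?rkhs_ip_ge0// -sqrtr_sqr ler_wsqrtr//.
  by rewrite (le_trans (rkhs_eval_le x df))// subrr.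
have icnu : itg (fun y => c y * nu y) by apply: (inu_bounded _ _ mc) => x; exact: eval_le.
pose K := Num.sqrt (ip h h) + Num.sqrt (lam 0) * \int[leb]_y `|nu y|.
have K0 : 0 <= K.
  by rewrite addr_ge0 ?mulr_ge0 ?sqrtr_ge0// Rintegral_ge0.
suff small dl : 0 < dl -> `|ip h c - \int[leb]_y (c y * nu y)| <= dl * K.
  apply/eqP; rewrite -subr_eq0 -normr_le0; apply/ler_addgt0Pr => e e0.
  have K1 : 0 < K + 1 by rewrite ltr_wpDl.
  rewrite add0r (le_trans (small (e / (K + 1)) _)) ?divr_gt0//.
  by rewrite mulrAC ler_pdivrMr// ler_pM2l// lerDl.
move=> dl0; have [s] := apc _ (exprn_gt0 2 dl0); set r := kcomb s \- c => rs.
have ds := rkhs_dom_comb H s; have dr : dom r by exact: rkhs_domB.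
have rdl : Num.sqrt (ip r r) <= dl.
  by rewrite -(ger0_norm (ltW dl0)) -sqrtr_sqr ler_wsqrtr// ltW.
have mr : measurable_fun setT r.
  apply: measurable_funB => //; apply: measurable_sum => p.
  by apply: measurable_funM => //; exact: mk.
have ir : itg (fun y => r y * nu y) by apply: (inu_bounded _ _ mr) => x; exact: eval_le.
have -> : ip h c - \int[leb]_y (c y * nu y) = \int[leb]_y (r y * nu y) - ip h r.
  rewrite rkhs_ipBr// hcomb.
  have -> : \int[leb]_y (kcomb s y * nu y) =
      \int[leb]_y (r y * nu y) + \int[leb]_y (c y * nu y).
    by rewrite -RintegralD//; apply: eq_Rintegral => y _; rewrite /r/=; ring.
  by ring.
rewrite (le_trans (ler_normB _ _))// addrC /K mulrDr lerD//.
  by rewrite (le_trans (rkhs_norm_cauchy_schwarz dh dr))// mulrC ler_wpM2r ?sqrtr_ge0.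
apply: (@le_trans _ _ (\int[leb]_y (dl * Num.sqrt (lam 0) * `|nu y|))).
  apply: Rintegral_norm_le => //; first by apply: itgZ; exact: itg_norm.
  move=> y; rewrite normrM ler_wpM2r// (le_trans (eval_le _ _ dr))//.
  by rewrite ler_wpM2r ?sqrtr_ge0.
by rewrite RintegralZl ?mulrA//; exact: itg_norm.
Qed.

Section finite_measure.
Variable mu : {finite_measure set Rd -> \bar R}.
Let g y := \int[mu]_z phi (y - z).

Let mphi2 : measurable_fun setT (fun p : Rd * Rd => phi (p.1 - p.2)).
Proof. exact: (measurableT_comp (measurable_phi phi_reg) (@measurable_rV_sub R d)). Qed.

Let bphi y : @bounded_mfun _ Rd R (fun z => phi (y - z)).
Proof.
have -> : (fun z => phi (y - z)) = fun z => phi (z - y).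
  by apply/funext => z; rewrite (regular_kernelB _ _ phi_reg).
by apply: bounded_mfun_shift; exact: bounded_mfun_regular.
Qed.

Let mg : measurable_fun setT g.
Proof. exact: measurable_Rintegral mphi2. Qed.

Lemma itg_conv_measure : itg g.
Proof.
have mf : measurable_fun setT (fun p : Rd * Rd => (phi (p.1 - p.2))%:E).
  exact/measurable_EFinP.
apply/integrableP; split; first exact/measurable_EFinP.
have E y : (`|(EFin \o g) y| = \int[mu]_z (phi (y - z))%:E)%E.
  rewrite Rintegral_EFin; last exact: bounded_mfunP.
  by rewrite /= ger0_norm// Rintegral_ge0// => z _; exact: phi_ge0.
under eq_integral do rewrite E.
have := @fubini_tonelli _ _ _ _ _ (@lebesgue_rV_sf R d) mu
  (fun p : Rd * Rd => (phi (p.1 - p.2))%:E).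
move=> /= ->//; last by move=> p; rewrite lee_fin; exact: phi_ge0.
have F z : (\int[lebesgue_rV_sf (d := d)]_y (phi (y - z))%:E = 1)%E.
  rewrite [LHS](@Rintegral_EFin _ _ _ (lebesgue_rV R d) (fun y => phi (y - z))).
    rewrite -(Rintegral_phi phi_dens) (Rintegral_shift (- z))//.
    exact: measurable_phi.
  by exact: itg_phiB.
under eq_integral do rewrite F.
by rewrite integral_cst// mul1e -ge0_fin_numE ?measure_ge0// fin_num_measure.
Qed.

Lemma Rintegral_conv_measure c : @bounded_mfun _ Rd R c ->
  \int[leb]_y (c y * g y) = \int[mu]_z convolution phi c z.
Proof.
move=> [mc [M cM]].
have mf : measurable_fun setT (fun p : Rd * Rd => c p.2 * phi (p.2 - p.1)).
  apply: measurable_funM; first exact: (measurableT_comp mc measurable_snd).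
  by under eq_fun do rewrite (regular_kernelB _ _ phi_reg); exact: mphi2.
have i1 z : itg (fun y => c y * phi (y - z)).
  under [X in itg X]eq_fun do rewrite mulrC.
  by apply: itgM_bounded cM => //; exact: itg_phiB.
have i2 y : mu.-integrable setT (EFin \o (fun z => c y * phi (y - z))).
  by apply: itgZ; exact: bounded_mfunP.
transitivity (\int[leb]_y \int[mu]_z (c y * phi (y - z))).
  by apply: eq_Rintegral => y _; rewrite RintegralZl//; exact: bounded_mfunP.
transitivity (\int[mu]_z \int[leb]_y (c y * phi (y - z))); last first.
  apply: eq_Rintegral => z _; rewrite /convolution.
  by apply: eq_Rintegral => y _; rewrite mulrC (regular_kernelB _ _ phi_reg).
apply/esym; apply: (Rintegral_rV_Fubini mf i1 i2).
apply: (@le_lt_trans _ _ (\int[mu]_z M%:E)%E).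
  apply: ge0_integral_mono => z; first exact: integral_ge0.
  apply: (@le_trans _ _ (\int[leb]_y (M * phi (y - z))%:E)%E).
    apply: ge0_integral_mono => // y; rewrite lee_fin normrM.
    by rewrite (ger0_norm (phi_ge0 phi_dens _)) ler_wpM2r ?phi_ge0.
  rewrite Rintegral_EFin; last by apply: itgZ; exact: itg_phiB.
  rewrite RintegralZl//; last exact: itg_phiB.
  rewrite (Rintegral_shift (- z)) ?Rintegral_phi ?mulr1//.
  exact: measurable_phi.
rewrite integral_cst// ltey_eq fin_numM// fin_num_measure//.
Qed.

End finite_measure.

Lemma itg_charge_convolution (nu : {charge set Rd -> \bar R}) : itg (charge_convolution phi nu).
Proof. by apply: itgB; exact: itg_conv_measure. Qed.

(** Fubini: convolution by the even function [phi] is its own adjoint. *)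
Lemma charge_convolution_adjoint (nu : {charge set Rd -> \bar R}) c :
  @bounded_mfun _ Rd R c ->
  \int[leb]_y (c y * charge_convolution phi nu y) = charge_integral nu (convolution phi c).
Proof.
move=> bc; have [mc [M cM]] := bc.
have ic mu : itg (fun y => c y * \int[mu : {finite_measure set Rd -> \bar R}]_z phi (y - z)).
  under [X in itg X]eq_fun do rewrite mulrC.
  by apply: itgM_bounded cM => //; exact: itg_conv_measure.
rewrite /charge_convolution /charge_integral -!Rintegral_conv_measure// -RintegralB//.
by apply: eq_Rintegral => y _; rewrite mulrBr.
Qed.

Section residual.
Variable fhat : {charge set Rd -> \bar R}.
Hypothesis dfhat : dom (charge_convolution lam fhat).

Lemma ip_residual nu c : dom c -> approximable c -> measurable_fun setT c ->
  dom (residual phi lam fhat nu) ->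
  ip (residual phi lam fhat nu) c =
  ip (charge_convolution lam fhat) c - charge_integral nu (convolution phi c).
Proof.
move=> dc apc mc dr; set h := convolution lam (charge_convolution phi nu).
have dh : dom h.
  have -> : h = charge_convolution lam fhat \- residual phi lam fhat nu.
    by apply/funext => x; rewrite /residual/= /h; ring.
  exact: rkhs_domB.
rewrite /residual rkhs_ipBl// ip_convolution//; last exact: itg_charge_convolution.
rewrite charge_convolution_adjoint//; split => //.
exists (Num.sqrt (ip c c) * Num.sqrt (lam 0)) => x.
rewrite -sqrtrM ?rkhs_ip_ge0// -sqrtr_sqr ler_wsqrtr//.
by rewrite (le_trans (rkhs_eval_le x dc))// subrr.
Qed.

(** The empirical part, common to both residuals, cancels: two measures are
    compared through the norms of their residuals alone. *)
Lemma ip_residualB nu1 nu2 c : dom c -> approximable c -> measurable_fun setT c ->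
  dom (residual phi lam fhat nu1) -> dom (residual phi lam fhat nu2) ->
  charge_integral nu1 (convolution phi c) - charge_integral nu2 (convolution phi c) =
  ip (residual phi lam fhat nu2) c - ip (residual phi lam fhat nu1) c.
Proof.
move=> dc apc mc d1 d2.
have sub (a b p q r : R) : a = r - p -> b = r - q -> p - q = b - a by lra.
exact: sub (ip_residual dc apc mc d1) (ip_residual dc apc mc d2).
Qed.

End residual.
End duality.

(** * The coefficient of the dual certificate *)

Section dual_coefficient.
Context (R : realType) (d : nat).
Local Notation leb := (lebesgue_rV R d).
Local Notation Rd := 'rV[R]_d.
Local Notation itg f := (leb.-integrable setT (EFin \o f)).
Variables (phi lam Lam : Rd -> R).
Hypothesis phi_dens : probability_density phi.
Hypothesis phi_reg : regular_kernel phi.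
Hypothesis phi_pos : forall w, 0 <= fourier phi w.
Hypothesis lamLam : spectral_density lam Lam.
Variable H : rkhs (fun x y => lam (x - y)).
Variable m : nat.
Local Notation S := (spectral_inf phi Lam m).
Hypothesis S_gt0 : 0 < S.
Let C2pi : R := (2 * pi) ^+ d.

Let C2pi_gt0 : 0 < C2pi.
Proof. by rewrite exprn_gt0// mulr_gt0// pi_gt0. Qed.

Lemma spectral_inf_le w : cube m w -> S <= sigma phi w ^+ 2 * Lam w.
Proof.
move=> mw; apply: ge_inf; last by exists w.
by exists 0 => _ [v _ <-]; rewrite mulr_ge0 ?sqr_ge0 ?(Lam_ge0 lamLam).
Qed.

Let sigma_neq0 w : cube m w -> sigma phi w != 0.
Proof.
move=> /spectral_inf_le h; apply/eqP => s0; move: (lt_le_trans S_gt0 h).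
by rewrite s0 expr0n mul0r ltxx.
Qed.

Definition off_cube (u : Rd -> R) := forall w, ~ cube m w -> u w = 0.

Definition dual_coef (u v : Rd -> R) : Rd -> R :=
  trig_int (fun w => u w / sigma phi w) (fun w => v w / sigma phi w).

(** Dividing the density by [sigma phi] inverts the convolution, by
    [convolution_trig_int].  The squared norm is then the integral of the squared
    density over [sigma phi ^+ 2 * Lam], which is at least [S] on the cube. *)
Lemma dual_coefP (u v : Rd -> R) (c := dual_coef u v) :
  measurable_fun setT u -> measurable_fun setT v -> off_cube u -> off_cube v ->
  itg (fun w => u w ^+ 2 + v w ^+ 2) ->
  [/\ itg (fun w => u w / sigma phi w) /\ itg (fun w => v w / sigma phi w),
      rkhs_dom H c /\ approximable H c, measurable_fun setT c,
      rkhs_ip H c c <= C2pi * \int[leb]_w (u w ^+ 2 + v w ^+ 2) / S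
    & convolution phi c = trig_int u v].
Proof.
move=> mu mv u0 v0 iuv.
pose u' w := u w / sigma phi w; pose v' w := v w / sigma phi w.
have ms := measurable_invr (measurable_sigma phi_reg).
have mu' : measurable_fun setT u' by exact: measurable_funM.
have mv' : measurable_fun setT v' by exact: measurable_funM.
have uv0 w : Lam w = 0 -> u' w = 0 /\ v' w = 0.
  move=> L0; have nw : ~ cube m w.
    by move=> /spectral_inf_le; rewrite L0 mulr0 leNgt S_gt0.
  by rewrite /u' /v' u0// v0// mul0r.
pose q w := (u' w ^+ 2 + v' w ^+ 2) / Lam w.
have q_ge0 w : 0 <= q w by rewrite divr_ge0 ?addr_ge0 ?sqr_ge0 ?(Lam_ge0 lamLam).
have qle w : q w <= S^-1 * (u w ^+ 2 + v w ^+ 2).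
  have [mw|nw] := pselect (cube m w); last first.
    by rewrite /q /u' /v' u0// v0// !mul0r !expr0n addr0 mul0r mulr0.
  have SL := spectral_inf_le mw; have L0 : 0 < sigma phi w ^+ 2 * Lam w by exact: lt_le_trans SL.
  have -> : q w = (sigma phi w ^+ 2 * Lam w)^-1 * (u w ^+ 2 + v w ^+ 2).
    have := sigma_neq0 mw; have : Lam w != 0.
      by apply/eqP => h; move: L0; rewrite h mulr0 ltxx.
    by move=> ? ?; rewrite /q /u' /v'; field; apply/andP.
  by rewrite ler_wpM2r ?addr_ge0 ?sqr_ge0// lef_pV2.
have mq : measurable_fun setT q.
  apply: measurable_funM.
    by apply: measurable_funD; exact: measurable_funX.
  by apply: measurable_invr; exact: itg_measurable (itg_Lam lamLam).
have iq : itg q.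
  by apply: (itg_le mq _ (itgZ S^-1 iuv)) => w; rewrite ger0_norm.
have [dc Nc ac] := trig_int_rkhs lamLam mu' mv' uv0 iq H.
have iu' := spectral_itg_u lamLam mu' uv0 iq.
have iv' := spectral_itg_v lamLam mv' uv0 iq.
split => //.
- exact: measurable_trig_int.
- apply: le_trans Nc _; rewrite -mulrA ler_pM2l//.
  have -> : (\int[leb]_w (u w ^+ 2 + v w ^+ 2)) / S =
      \int[leb]_w (S^-1 * (u w ^+ 2 + v w ^+ 2)) by rewrite RintegralZl// mulrC.
  by apply: le_Rintegral => //; [exact: itgZ|move=> w _; exact: qle].
- apply/funext => x; rewrite convolution_trig_int//.
  apply: eq_Rintegral => w _; congr (_ * _ + _ * _).
    have [mw|nw] := pselect (cube m w); last by rewrite u0// mul0r mulr0.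
    by rewrite mulrC divfK// sigma_neq0.
  have [mw|nw] := pselect (cube m w); last by rewrite v0// mul0r mulr0.
  by rewrite mulrC divfK// sigma_neq0.
Qed.


Lemma itg_off_cube (u : Rd -> R) (M : R) : measurable_fun setT u -> off_cube u ->
  (forall w, `|u w| <= M) ->
  itg u /\ \int[leb]_w `|u w| <= M * (8 * m%:R) ^+ d.
Proof.
move=> mu u0 uM; have mc : measurable (@cube R d m).
  by rewrite cube_box; exact: measurable_box.
have cE : leb (@cube R d m) = ((8 * m%:R) ^+ d)%:E.
  rewrite cube_box lebesgue_rV_box ?mulr_ge0//; congr (_ ^+ _)%:E; ring.
have ic : itg (\1_(@cube R d m) : Rd -> R).
  apply/integrableP; split; first by apply/measurable_EFinP; exact: measurable_indic.
  under eq_integral do rewrite /= ger0_norm//.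
  by rewrite integral_indic// setIT cE ltry.
have uc w : `|u w| <= M * \1_(@cube R d m) w.
  have [mw|nw] := pselect (cube m w); first by rewrite indicE mem_set// mulr1.
  by rewrite u0// normr0 indicE memNset// mulr0.
split; first exact: (itg_le mu uc (itgZ M ic)).
apply: (@le_trans _ _ (\int[leb]_w (M * \1_(@cube R d m) w))).
  apply: le_Rintegral => //; last exact: itgZ.
  exact/itg_norm/(itg_le mu uc (itgZ M ic)).
rewrite RintegralZl// /Rintegral integral_indic// setIT cE//.
Qed.

Section certificate.
Variable P : Rd -> R.
Hypothesis itg_P : itg P.
Hypothesis P_supp : fsupport (fourier P) `<=` cube m.

Let U w := C2pi^-1 * \int[leb]_x (P x * cos (dot w x)).
Let V w := C2pi^-1 * \int[leb]_x (P x * sin (dot w x)).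

Let fourierE w : fourier P w = ((C2pi * U w) +i* (- (C2pi * V w)))%C.
Proof.
rewrite /U /V !mulrA divff ?gt_eqF// !mul1r /fourier /cintegral.
apply/eqP; rewrite eq_complex /=; apply/andP; split; apply/eqP.
  by apply: eq_Rintegral => x _ /=; rewrite mulr0 subr0 cosN mulrC.
rewrite -mulN1r -RintegralZl//; last exact: itg_sin.
by apply: eq_Rintegral => x _ /=; rewrite mulr0 add0r sinN mulN1r mulNr mulrC.
Qed.

(** The indicator of the support in [c0] is harmless: off the support the
    transform vanishes anyway. *)
Let UV0 w : ~ fsupport (fourier P) w -> U w = 0 /\ V w = 0.
Proof.
move=> nw; have /eqP : fourier P w = 0.
  by apply/eqP; apply: contrapT => /negP h; apply: nw; exact: subset_closure.
rewrite fourierE eq_complex/= oppr_eq0 => /andP[hU hV].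
have z (a : R) : C2pi * a == 0 -> a = 0 by rewrite mulf_eq0 gt_eqF//= => /eqP.
by rewrite (z _ hU) (z _ hV).
Qed.

Let U0 : off_cube U.
Proof. by move=> w nw; case: (UV0 (fun h => nw (P_supp h))). Qed.

Let V0 : off_cube V.
Proof. by move=> w nw; case: (UV0 (fun h => nw (P_supp h))). Qed.

Let mU : measurable_fun setT U.
Proof.
apply: measurable_funM => //; have mP := itg_measurable itg_P.
have := measurable_trig_int mP (measurable_cst (0 : R)).
by congr measurable_fun; apply/funext => w; apply: eq_Rintegral => x _; rewrite mul0r addr0.
Qed.

Let mV : measurable_fun setT V.
Proof.
apply: measurable_funM => //; have mP := itg_measurable itg_P.
have := measurable_trig_int (measurable_cst (0 : R)) mP.
by congr measurable_fun; apply/funext => w; apply: eq_Rintegral => x _; rewrite mul0r add0r.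
Qed.

Let B := C2pi^-1 * \int[leb]_x `|P x|.

Let UB w : `|U w| <= B.
Proof.
rewrite normrM gtr0_norm ?invr_gt0// ler_pM2l ?invr_gt0//.
apply: Rintegral_norm_le; [exact: itg_cos|exact: itg_norm|].
by move=> x; rewrite normrM ler_piMr// cos_max.
Qed.

Let VB w : `|V w| <= B.
Proof.
rewrite normrM gtr0_norm ?invr_gt0// ler_pM2l ?invr_gt0//.
apply: Rintegral_norm_le; [exact: itg_sin|exact: itg_norm|].
by move=> x; rewrite normrM ler_piMr// sin_max.
Qed.

Let iU : itg U. Proof. by have [] := itg_off_cube mU U0 UB. Qed.
Let iV : itg V. Proof. by have [] := itg_off_cube mV V0 VB. Qed.

Let iUV : itg (fun w => U w ^+ 2 + V w ^+ 2).
Proof.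
by apply: itgD; [exact: itgM_bounded iU mU UB|exact: itgM_bounded iV mV VB].
Qed.

Lemma c0_dual_coef : c0 phi P = dual_coef U V.
Proof.
have [[iu iv] _ _ _ _] := dual_coefP mU mV U0 V0 iUV.
apply/funext => x; have it := itg_trig x iu iv.
have ReM (a : R) (z : R[i]) : complex.Re (a%:C%C * z) = a * complex.Re z.
  by case: z => p q /=; rewrite mul0r subr0.
have ReE (p q : R) : complex.Re (p +i* q)%C = p by [].
rewrite /c0 /inv_fourier ReM /cintegral ReE /dual_coef /trig_int.
rewrite -[RHS](mulKf (lt0r_neq0 C2pi_gt0)); congr (_ * _).
rewrite -RintegralZl//; apply: eq_Rintegral => w _.
rewrite fourierE /= !mulr0 !subr0 !add0r.
have [mw|nw] := pselect (fsupport (fourier P) w).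
  by rewrite indicE mem_set// mulr1; field; rewrite sigma_neq0//; exact: P_supp.
by have [-> ->] := UV0 nw; rewrite !(mul0r, mulr0, oppr0, subr0, addr0).
Qed.

Hypothesis P_conv : forall x, P x = convolution phi (c0 phi P) x.

(** The hypothesis [P_conv] is an inversion formula, by [convolution_trig_int]:
    [P] is the trigonometric integral of [U] and [V].  Plancherel's identity is
    then Fubini's theorem in [P * P]. *)
Let plancherel (iP2 : itg (fun x => P x ^+ 2)) :
  \int[leb]_x (P x ^+ 2) = C2pi * \int[leb]_w (U w ^+ 2 + V w ^+ 2).
Proof.
have [_ _ _ _ PUV] := dual_coefP mU mV U0 V0 iUV.
have PE x : P x = trig_int U V x by rewrite {1}P_conv c0_dual_coef PUV.
transitivity (\int[leb]_x \int[leb]_w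
    (P x * (U w * cos (dot x w) + V w * sin (dot x w)))).
  apply: eq_Rintegral => x _; rewrite RintegralZl//; last exact: itg_trig.
  by rewrite expr2 {2}PE.
have mP := itg_measurable itg_P.
rewrite (@Rintegral_rV_Fubini_prod _ _
  (fun p => P p.1 * (U p.2 * cos (dot p.1 p.2) + V p.2 * sin (dot p.1 p.2)))
  (fun x => `|P x|) (fun w => `|U w| + `|V w|)).
- rewrite -RintegralZl//; apply: eq_Rintegral => w _ /=.
  transitivity (\int[leb]_x (U w * (P x * cos (dot w x)) + V w * (P x * sin (dot w x)))).
    by apply: eq_Rintegral => x _; rewrite (dotC w); ring.
  have ic := itg_cos w itg_P; have is_ := itg_sin w itg_P.
  rewrite RintegralD//; [|exact: itgZ..]; rewrite !RintegralZl//.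
  by rewrite /U /V; field; rewrite gt_eqF.
- apply: measurable_funM; last exact: measurable_trig_pair.
  exact: (measurableT_comp mP measurable_fst).
- exact: itg_norm.
- by apply: itgD; exact: itg_norm.
- by [].
- by move=> x w; rewrite normrM ler_wpM2l// norm_trig_le.
Qed.

Lemma c0_rkhs (iP2 : itg (fun x => P x ^+ 2)) :
  [/\ rkhs_dom H (c0 phi P), approximable H (c0 phi P), measurable_fun setT (c0 phi P)
    & rkhs_ip H (c0 phi P) (c0 phi P) <= \int[leb]_x (P x ^+ 2) / S].
Proof.
have [_ [d1 d2] d3 d4 _] := dual_coefP mU mV U0 V0 iUV.
by rewrite c0_dual_coef plancherel.
Qed.

End certificate.
End dual_coefficient.

(** * Band-limited interpolation *)

Section trig_bounds.
Context (R : realType).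
Implicit Types x y : R.

Lemma lipschitz1_deriv (f f' : R -> R) x y :
  (forall z, is_derive z (1 : R) f (f' z)) -> (forall z, `|f' z| <= 1) ->
  `|f x - f y| <= `|x - y|.
Proof.
move=> df f1; wlog xy : x y / x < y.
  move=> h; have [/h//|yx|->] := ltgtP x y; last by rewrite !subrr.
  by rewrite distrC (distrC x); exact: h.
have [z _ zE] : exists2 z, z \in `]x, y[ & f y - f x = f' z * (y - x).
  apply: MVT => //; apply: derivable_within_continuous => z _.
  by case: (df z).
by rewrite distrC zE normrM (distrC x) ler_piMl.
Qed.

Lemma norm_cosB_le x y : `|cos x - cos y| <= `|x - y|.
Proof.
by apply: (@lipschitz1_deriv (@cos R) (fun z => - sin z)) => z; rewrite normrN sin_max.
Qed.

Lemma norm_sin_le x : `|sin x| <= `|x|.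
Proof.
have := @lipschitz1_deriv sin cos x 0; rewrite sin0 !subr0; apply => z.
exact: cos_max.
Qed.

Lemma cos_half x : 1 - cos x = 2 * sin (x / 2) ^+ 2.
Proof.
have -> : cos x = cos ((x / 2) *+ 2) by congr cos; rewrite mulr2n; field.
by rewrite cos_mulr2n cos2sin2 !mulr2n; ring.
Qed.

Lemma one_sub_cos_ge0 x : 0 <= 1 - cos x.
Proof. by rewrite subr_ge0 cos_le1. Qed.

Lemma one_sub_cos_le x : 1 - cos x <= x ^+ 2.
Proof.
rewrite cos_half; have := norm_sin_le (x / 2).
rewrite -ler_sqr ?nnegrE// !real_normK ?num_real// => h.
have := sqr_ge0 x; have : (x / 2) ^+ 2 = x ^+ 2 / 4 by field.
by move: h; lra.
Qed.

Lemma one_sub_cos_gt0 x : 0 < x <= 1 -> 0 < 1 - cos x.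
Proof.
move=> /andP[x0 x1]; rewrite cos_half mulr_gt0// exprn_gt0// sin_gt0_pi//.
by have := pi_ge2 R; lra.
Qed.

End trig_bounds.

Section band_limited.
Context (R : realType) (d : nat).
Local Notation leb := (lebesgue_rV R d).
Local Notation Rd := 'rV[R]_d.
Local Notation itg f := (leb.-integrable setT (EFin \o f)).
Implicit Types (r M a b c : R) (q u v : Rd -> R) (x y w th : Rd).

(** The sup bound [M] on the density is recorded because it controls the norm of
    the dual coefficient of the function, and [r] because of the cube. *)
Definition band_density r M u :=
  [/\ measurable_fun setT u, forall w, `|u w| <= M & forall w, ~ box r w -> u w = 0].

Definition band_limited r M q := exists u v,
  [/\ band_density r M u, band_density r M v & q = trig_int u v].

Lemma band_density_itg r M u : 0 <= r -> band_density r M u -> itg u.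
Proof.
move=> r0 [mu uM u0].
have ic : itg (\1_(box r) : Rd -> R).
  apply/integrableP; split.
    by apply/measurable_EFinP; apply: measurable_indic; exact: measurable_box.
  under eq_integral do rewrite /= ger0_norm//.
  by rewrite integral_indic ?setIT ?lebesgue_rV_box ?ltry//; exact: measurable_box.
apply: (itg_le mu _ (itgZ M ic)) => w.
have [rw|nw] := pselect (box r w); first by rewrite indicE mem_set// mulr1.
by rewrite u0// normr0 indicE memNset// mulr0.
Qed.

Lemma band_densityD r M N u v : band_density r M u -> band_density r N v ->
  band_density r (M + N) (fun w => u w + v w).
Proof.
move=> [mu uM u0] [mv vN v0]; split; first exact: measurable_funD.
  by move=> w; rewrite (le_trans (ler_normD _ _))// lerD.
by move=> w nw; rewrite u0// v0// addr0.
Qed.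

Lemma band_densityZ r M a u : band_density r M u ->
  band_density r (`|a| * M) (fun w => a * u w).
Proof.
move=> [mu uM u0]; split; first exact: measurable_funM.
  by move=> w; rewrite normrM ler_wpM2l.
by move=> w nw; rewrite u0// mulr0.
Qed.

Lemma band_densityS r r' M M' u : r <= r' -> M <= M' -> band_density r M u ->
  band_density r' M' u.
Proof.
move=> rr' MM' [mu uM u0]; split => // [w|w nw]; first exact: le_trans (uM w) MM'.
by apply: u0 => rw; apply: nw => i; exact: le_trans (rw i) rr'.
Qed.

Lemma band_limitedS r r' M M' q : r <= r' -> M <= M' -> band_limited r M q ->
  band_limited r' M' q.
Proof.
by move=> rr' MM' [u [v [bu bv ->]]]; exists u, v; split => //; apply: band_densityS; eauto.
Qed.

Lemma band_limitedZ r M a q : 0 <= r -> band_limited r M q ->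
  band_limited r (`|a| * M) (fun x => a * q x).
Proof.
move=> r0 [u [v [bu bv ->]]]; exists (fun w => a * u w), (fun w => a * v w).
split; [exact: band_densityZ..|].
have iu := band_density_itg r0 bu; have iv := band_density_itg r0 bv.
apply/funext => x; rewrite /trig_int -RintegralZl//; last exact: itg_trig.
by apply: eq_Rintegral => w _; ring.
Qed.

Lemma band_limitedD r M N p q : 0 <= r -> band_limited r M p -> band_limited r N q ->
  band_limited r (M + N) (fun x => p x + q x).
Proof.
move=> r0 [u [v [bu bv ->]]] [u' [v' [bu' bv' ->]]].
exists (fun w => u w + u' w), (fun w => v w + v' w).
split; [exact: band_densityD..|].
have iu := band_density_itg r0 bu; have iv := band_density_itg r0 bv.
have iu' := band_density_itg r0 bu'; have iv' := band_density_itg r0 bv'.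
apply/funext => x; rewrite /trig_int -RintegralD//; [|exact: itg_trig..].
by apply: eq_Rintegral => w _; ring.
Qed.

Lemma band_density_shift r M u th : band_density r M u ->
  band_density (r + `|th|) M (fun w => u (w + th)).
Proof.
move=> [mu uM u0]; split.
- exact: (measurableT_comp mu (measurable_rV_shift th)).
- by [].
- move=> w nw; apply: u0 => rw; apply: nw => i.
  have -> : w ord0 i = (w + th) ord0 i - th ord0 i by rewrite mxE addrK.
  rewrite (le_trans (ler_normB _ _))// lerD//.
  have : `|th| <= `|th| by [].
  by rewrite rV_normP// => /asboolP.
Qed.

Let trig_shift u v th x : measurable_fun setT u -> measurable_fun setT v ->
  \int[leb]_w (u (w + th) * cos (dot x w) + v (w + th) * sin (dot x w)) =
  \int[leb]_w (u w * cos (dot x w - dot x th) + v w * sin (dot x w - dot x th)).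
Proof.
move=> mu mv; rewrite -[RHS](Rintegral_shift th).
  by apply: eq_Rintegral => w _; rewrite dotDr addrK.
have mc : measurable_fun setT (fun w => dot x w - dot x th).
  by apply: measurable_funB => //; exact: measurable_dot1.
apply: measurable_funD; apply: measurable_funM => //.
  exact: measurable_cos_comp.
exact: measurable_sin_comp.
Qed.

Let itg_phase u v x b : itg u -> itg v ->
  itg (fun w => u w * cos (dot x w - b) + v w * sin (dot x w - b)).
Proof.
move=> iu iv; have mc : measurable_fun setT (fun w => dot x w - b).
  by apply: measurable_funB => //; exact: measurable_dot1.
apply: itgD; apply: (itgM_bounded (M := 1)) => //.
- exact: measurable_cos_comp.
- by move=> w; exact: cos_max.
- exact: measurable_sin_comp.
- by move=> w; exact: sin_max.
Qed.

Let Rintegral_lin4 (f1 f2 f3 f4 : Rd -> R) (a b : R) :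
  itg f1 -> itg f2 -> itg f3 -> itg f4 ->
  \int[leb]_w (a * f1 w + a * f2 w + (b * f3 w - b * f4 w)) =
  a * \int[leb]_w f1 w + a * \int[leb]_w f2 w
  + (b * \int[leb]_w f3 w - b * \int[leb]_w f4 w).
Proof.
move=> i1 i2 i3 i4; rewrite -!RintegralZl// -RintegralD//; [|exact: itgZ..].
rewrite -RintegralB//; [|exact: itgZ..].
by rewrite -RintegralD//; [apply: itgD|apply: itgB]; exact: itgZ.
Qed.

(** Multiplication by a character of frequency [th] translates the density by
    [th] and [- th]. *)
Lemma band_limitedM_trig r M a b q th : 0 <= r -> band_limited r M q ->
  band_limited (r + `|th|) ((`|a| + `|b|) * M)
    (fun x => q x * (a * cos (dot x th) + b * sin (dot x th))).
Proof.
move=> r0 [u [v [bu bv ->]]].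
have r0' : 0 <= r + `|th| by rewrite addr_ge0.
have iu := band_density_itg r0 bu; have iv := band_density_itg r0 bv.
have sh p : band_density r M p ->
    band_density (r + `|th|) M (fun w => p (w - th)) /\
    band_density (r + `|th|) M (fun w => p (w + th)).
  by move=> bp; split; [rewrite -(normrN th)|]; exact: band_density_shift.
have [bum bup] := sh _ bu; have [bvm bvp] := sh _ bv.
pose U w := a / 2 * u (w - th) + a / 2 * u (w + th)
            + (- (b / 2) * v (w - th) + b / 2 * v (w + th)).
pose V w := a / 2 * v (w - th) + a / 2 * v (w + th)
            + (b / 2 * u (w - th) + - (b / 2) * u (w + th)).
have bound : `|a / 2| * M + `|a / 2| * M + (`|b / 2| * M + `|b / 2| * M)
    = (`|a| + `|b|) * M.
  have h2 : `|2^-1| = 2^-1 :> R by rewrite ger0_norm.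
  by rewrite !normrM h2; field.
exists U, V; split.
- rewrite -bound; have {1}-> : `|b / 2| = `|- (b / 2)| by rewrite normrN.
  by apply: band_densityD; apply: band_densityD; exact: band_densityZ.
- rewrite -bound; have {2}-> : `|b / 2| = `|- (b / 2)| by rewrite normrN.
  by apply: band_densityD; apply: band_densityD; exact: band_densityZ.
- have [mu _ _] := bu; have [mv _ _] := bv.
  have mNv : measurable_fun setT (fun w => - v w) by exact: measurable_funN.
  have iNv : itg (fun w => - v w).
    by under [X in itg X]eq_fun do rewrite -mulN1r; exact: itgZ.
  apply/funext => x; pose t := dot x th.
  have iS (p : Rd -> R) (e : Rd) : itg p -> itg (fun w => p (w + e)) by exact: itg_shift.
  transitivity (\int[leb]_w (
      a / 2 * (u (w - th) * cos (dot x w) + v (w - th) * sin (dot x w))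
    + a / 2 * (u (w + th) * cos (dot x w) + v (w + th) * sin (dot x w))
    + (b / 2 * ((- v (w - th)) * cos (dot x w) + u (w - th) * sin (dot x w))
     - b / 2 * ((- v (w + th)) * cos (dot x w) + u (w + th) * sin (dot x w)))));
    last by apply: eq_Rintegral => w _; rewrite /U /V; ring.
  have iSN e : itg (fun w => - v (w + e)) by exact: (iS _ e iNv).
  rewrite Rintegral_lin4; [|exact: itg_trig (iS _ _ _) (iS _ _ _)|
    exact: itg_trig (iS _ _ _) (iS _ _ _)|exact: itg_trig (iSN _) (iS _ _ _)|
    exact: itg_trig (iSN _) (iS _ _ _)].
  rewrite !(trig_shift _ x mu mv) !(trig_shift _ x mNv mu).
  rewrite -Rintegral_lin4; [|exact: itg_phase..].
  rewrite /trig_int mulrC -RintegralZl//; last exact: itg_trig.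
  apply: eq_Rintegral => w _.
  have -> : dot x (- th) = - dot x th by rewrite dotC dotNl dotC.
  by rewrite opprK !cosD !sinD cosN sinN; field.
Qed.

Lemma band_limitedM_affine r M a b c q th : 0 <= r -> band_limited r M q ->
  band_limited (r + `|th|) ((`|c| + (`|a| + `|b|)) * M)
    (fun x => q x * (c + (a * cos (dot x th) + b * sin (dot x th)))).
Proof.
move=> r0 bq; have := band_limitedM_trig a b th r0 bq => bq1.
have bq0 : band_limited (r + `|th|) (`|c| * M) (fun x => c * q x).
  by apply: (band_limitedS _ _ (band_limitedZ c r0 bq)); rewrite ?lerDl.
rewrite mulrDl; have := band_limitedD (addr_ge0 r0 (normr_ge0 th)) bq0 bq1.
by under [X in band_limited _ _ X -> _]eq_fun do rewrite mulrC -mulrDr.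
Qed.

End band_limited.

Section interpolation.
Context (R : realType) (d : nat).
Local Notation leb := (lebesgue_rV R d).
Local Notation Rd := 'rV[R]_d.
Local Notation itg f := (leb.-integrable setT (EFin \o f)).
Implicit Types (x y w s t : Rd) (q g : Rd -> R).

Lemma norm2_sqr x : norm2 x ^+ 2 = \sum_i x ord0 i ^+ 2.
Proof. by rewrite sqr_sqrtr// sumr_ge0// => i _; exact: sqr_ge0. Qed.

Lemma norm2_ge0 x : 0 <= norm2 x. Proof. exact: sqrtr_ge0. Qed.

Lemma coord_le_norm2 x i : `|x ord0 i| <= norm2 x.
Proof.
rewrite -sqrtr_sqr ler_wsqrtr// (bigD1 i)//= lerDl.
by apply: sumr_ge0 => j _; exact: sqr_ge0.
Qed.

Lemma dot_le_norm2 x y : `|dot x y| <= norm2 x * \sum_i `|y ord0 i|.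
Proof.
rewrite (le_trans (ler_norm_sum _ _ _))// mulr_sumr ler_sum// => i _.
by rewrite normrM ler_wpM2r// coord_le_norm2.
Qed.

Lemma sqr_dot_le x y : dot x y ^+ 2 <= (\sum_i `|y ord0 i|) ^+ 2 * norm2 x ^+ 2.
Proof.
rewrite -exprMn mulrC -[leLHS]real_normK ?num_real// lerXn2r// ?nnegrE ?dot_le_norm2//.
by rewrite mulr_ge0 ?norm2_ge0// sumr_ge0.
Qed.

(** [g] separates [t] from the points of [l] to second order: the quadratic bounds
    contain that the gradient vanishes at all these points.  [b] is the bandwidth
    that a multiplication by [g] costs, and [A] its cost in the size of the
    density. *)
Definition separator (t : Rd) (l : seq Rd) (b : R) g (A c : R) :=
  [/\ 0 <= c,
      forall r M q, 0 <= r -> band_limited r M q ->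
        band_limited (r + b) (A * M) (fun x => q x * g x),
      forall x, `|g x| <= c,
      forall x, `|g x - 1| <= c * norm2 (x - t) ^+ 2
    & forall s, s \in l -> forall x, `|g x| <= c * norm2 (x - s) ^+ 2].

(** With [h] a multiple of [1 - cos] of a linear form, vanishing to second order
    at [s] and normalised by [h t = 1], the polynomial [h (2 - h) = 1 - (1 - h)^2]
    keeps the double zero at [s] and has a critical point of value 1 at [t].
    The frequency [th] can be taken small, at the price of a large constant; this
    is what makes the bandwidth independent of the distances. *)
Lemma separator1 t s (b : R) : t != s -> 0 < b ->
  exists g A c, separator t [:: s] b g A c.
Proof.
move=> ts b0; pose N := \sum_i (t - s) ord0 i ^+ 2.
have N0 : 0 < N.
  rewrite lt_def sumr_ge0 ?andbT//; last by move=> i _; exact: sqr_ge0.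
  apply: contraNneq ts => /eqP; rewrite psumr_eq0; last by move=> i _; exact: sqr_ge0.
  move=> /allP h; rewrite -subr_eq0; apply/eqP/rowP => i.
  by have := h i (mem_index_enum i); rewrite sqrf_eq0 [in RHS]mxE => /eqP.
(* The first bound is for the bandwidth; the second one keeps [S t] in [0, 1],
   where [1 - cos] is positive off 0. *)
pose eta := Num.min (b / (2 * (`|t - s| + 1))) (N + 1)^-1.
have ts1 : 0 < `|t - s| + 1 by rewrite ltr_wpDl.
have eta0 : 0 < eta by rewrite lt_min divr_gt0 ?mulr_gt0//= invr_gt0 addr_gt0.
pose th := eta *: (t - s).
have thb : `|th| + `|th| <= b.
  rewrite normrZ (ger0_norm (ltW eta0)).
  apply: (@le_trans _ _ (2 * (b / (2 * (`|t - s| + 1)) * `|t - s|))).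
    rewrite mulr_natl mulr2n lerD// ler_wpM2r// ge_min lexx//.
  have -> : 2 * (b / (2 * (`|t - s| + 1)) * `|t - s|) = b * (`|t - s| / (`|t - s| + 1)).
    by field; rewrite gt_eqF.
  by rewrite ler_piMr ?(ltW b0)// ler_pdivrMr// mul1r lerDl.
pose S x := dot (x - s) th.
have SB x y : S x - S y = dot (x - y) th by rewrite /S !dotBl; ring.
have S_t : S t = eta * N.
  rewrite /S /dot /N mulr_sumr; apply: eq_bigr => i _.
  by rewrite [th _ _]mxE; ring.
have S_t01 : 0 < S t <= 1.
  rewrite S_t mulr_gt0//= (@le_trans _ _ ((N + 1)^-1 * N))//.
    by rewrite ler_wpM2r ?(ltW N0)// /eta ge_min lexx orbT.
  by rewrite mulrC ler_pdivrMr ?addr_gt0// mul1r lerDl.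
have cS := one_sub_cos_gt0 S_t01.
pose al := (1 - cos (S t))^-1.
have al0 : 0 < al by rewrite invr_gt0.
pose h x := al * (1 - cos (S x)).
pose D := (\sum_i `|th ord0 i|) ^+ 2.
have D0 : 0 <= D by exact: sqr_ge0.
have h_ge0 x : 0 <= h x by rewrite mulr_ge0 ?one_sub_cos_ge0 ?ltW.
have h_le x : h x <= 2 * al.
  by rewrite /h mulrC ler_pM2r//; have := cos_geN1 (S x); lra.
have h_s x : h x <= al * D * norm2 (x - s) ^+ 2.
  rewrite /h -mulrA ler_pM2l// (le_trans (one_sub_cos_le _))//.
  exact: sqr_dot_le.
have h_t x : `|h x - 1| <= al * `|dot (x - t) th|.
  have -> : h x - 1 = al * (cos (S t) - cos (S x)).
    have -> : 1 = al * (1 - cos (S t)) by rewrite mulVf// gt_eqF.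
    by rewrite /h; ring.
  rewrite normrM (ger0_norm (ltW al0)) ler_pM2l//.
  by rewrite (le_trans (norm_cosB_le _ _))// distrC SB.
pose c1 := (2 + 2 * al) * (2 * al).
pose c2 := (2 + 2 * al) * (al * D).
pose c3 := al ^+ 2 * D.
have al0' := ltW al0; have a2 : 0 <= 2 + 2 * al by lra.
have c10 : 0 <= c1 by rewrite mulr_ge0// mulr_ge0.
have c20 : 0 <= c2 by rewrite mulr_ge0// mulr_ge0.
have c30 : 0 <= c3 by rewrite mulr_ge0 ?sqr_ge0.
have g_h x : `|h x * (2 - h x)| <= (2 + 2 * al) * h x.
  rewrite normrM (ger0_norm (h_ge0 x)) mulrC ler_wpM2r//.
  by rewrite (le_trans (ler_normB _ _))// !ger0_norm// lerD2l.
exists (fun x => h x * (2 - h x)).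
pose p := - (al * cos (dot s th)); pose p' := - (al * sin (dot s th)).
have hE x : h x = al + (p * cos (dot x th) + p' * sin (dot x th)).
  by rewrite /h /S dotBl cosB /p /p'; ring.
have h2E x : 2 - h x = (2 - al) + ((- p) * cos (dot x th) + (- p') * sin (dot x th)).
  by rewrite hE; ring.
exists ((`|2 - al| + (`|- p| + `|- p'|)) * (`|al| + (`|p| + `|p'|))), (c1 + c2 + c3); split.
- by rewrite !addr_ge0.
- move=> r M q r0 bq.
  have b1 := band_limitedM_affine p p' al th r0 bq.
  have b2 := band_limitedM_affine (- p) (- p') (2 - al) th (addr_ge0 r0 (normr_ge0 th)) b1.
  rewrite -mulrA; apply: band_limitedS (lexx _) _; last first.
    have -> : (fun x => q x * (h x * (2 - h x))) = (fun x =>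
      q x * (al + (p * cos (dot x th) + p' * sin (dot x th))) *
      (2 - al + (- p * cos (dot x th) + - p' * sin (dot x th)))).
      by apply/funext => x; rewrite -hE -h2E mulrA.
    exact: b2.
  by rewrite -addrA lerD2l.
- move=> x; rewrite (le_trans (g_h x))//.
  have : (2 + 2 * al) * h x <= c1 by rewrite ler_wpM2l.
  by lra.
- move=> x; have -> : h x * (2 - h x) - 1 = - (h x - 1) ^+ 2 by ring.
  rewrite normrN normrX.
  have n0 := sqr_ge0 (norm2 (x - t)).
  have : `|h x - 1| ^+ 2 <= c3 * norm2 (x - t) ^+ 2.
    apply: (@le_trans _ _ ((al * `|dot (x - t) th|) ^+ 2)).
      by rewrite lerXn2r// nnegrE mulr_ge0.
    rewrite exprMn /c3 -mulrA ler_wpM2l ?sqr_ge0// real_normK ?num_real//.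
    exact: sqr_dot_le.
  have := mulr_ge0 c10 n0; have := mulr_ge0 c20 n0; lra.
- move=> s'; rewrite inE => /eqP -> x; rewrite (le_trans (g_h x))//.
  have n0 := sqr_ge0 (norm2 (x - s)).
  have : (2 + 2 * al) * h x <= c2 * norm2 (x - s) ^+ 2.
    by rewrite /c2 -mulrA ler_wpM2l.
  have := mulr_ge0 c10 n0; have := mulr_ge0 c30 n0; lra.
Qed.

Lemma separator_exists t (l : seq Rd) (b : R) : t \notin l -> 0 < b ->
  exists g A c, separator t l b g A c.
Proof.
elim: l b => [|s l IH] b; rewrite ?inE ?negb_or.
  move=> _ b0; exists (fun=> 1), 1, 1; split => //.
  - move=> r M q r0 bq; rewrite mul1r; under eq_fun do rewrite mulr1.
    by apply: band_limitedS bq => //; rewrite lerDl ltW.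
  - by move=> x; rewrite normr1.
  - by move=> x; rewrite subrr normr0 mul1r sqr_ge0.
move=> /andP[ts tl] b0; have b20 : 0 < b / 2 by rewrite divr_gt0.
have [g1 [A1 [c1 [c10 B1 g1c g1t g1s]]]] := separator1 ts b20.
have [g2 [A2 [c2 [c20 B2 g2c g2t g2s]]]] := IH _ tl b20.
have c120 : 0 <= c1 * c2 by rewrite mulr_ge0.
exists (fun x => g1 x * g2 x), (A2 * A1), (c1 * c2 + c2); split.
- by rewrite addr_ge0.
- move=> r M q r0 bq; have := B2 _ _ _ (addr_ge0 r0 (ltW b20)) (B1 _ _ _ r0 bq).
  rewrite -addrA -splitr mulrA.
  by under [X in band_limited _ _ X -> _]eq_fun do rewrite -mulrA.
- move=> x; rewrite normrM (@le_trans _ _ (c1 * c2)) ?lerDl//.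
  by rewrite ler_pM.
- move=> x; have -> : g1 x * g2 x - 1 = (g1 x - 1) * g2 x + (g2 x - 1) by ring.
  rewrite (le_trans (ler_normD _ _))// [leRHS]mulrDl lerD// normrM mulrAC.
  by rewrite ler_pM.
- move=> s'; rewrite inE => /orP[/eqP->|s'l] x; rewrite normrM mulrDl.
    have : `|g1 x| * `|g2 x| <= c1 * norm2 (x - s) ^+ 2 * c2.
      by rewrite ler_pM// g1s// inE.
    have := mulr_ge0 c20 (sqr_ge0 (norm2 (x - s))); nra.
  have : `|g1 x| * `|g2 x| <= c1 * (c2 * norm2 (x - s') ^+ 2).
    by rewrite ler_pM// g2s.
  have := mulr_ge0 c20 (sqr_ge0 (norm2 (x - s'))); nra.
Qed.

(** The transform of the normalised indicator of the box, centred at [t]: a product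
    of cardinal sines, whose density has the size [m^-d] that [Cm] requires. *)
Lemma box_kernel t (m : nat) : (0 < m)%N -> exists q,
  [/\ band_limited m%:R ((2 * m%:R) ^+ d)^-1 q, forall x, `|q x| <= 1
    & forall x, `|q x - 1| <= d%:R ^+ 2 * m%:R ^+ 2 * norm2 (x - t) ^+ 2].
Proof.
move=> m0; have m0' : 0 < m%:R :> R by rewrite ltr0n.
pose V : R := (2 * m%:R) ^+ d; have V0 : 0 < V by rewrite exprn_gt0// mulr_gt0.
have Vi : 0 <= V^-1 by rewrite invr_ge0 ltW.
have mb : measurable (@box R d m%:R) by exact: measurable_box.
pose i w : R := V^-1 * \1_(box m%:R) w.
have mi : measurable_fun setT i by apply: measurable_funM => //; exact: measurable_indic.
have i_le w : `|i w| <= V^-1.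
  rewrite normrM (ger0_norm Vi).
  by rewrite ler_piMr// indicE; case: (_ \in _); rewrite ?normr1 ?normr0.
have i0 w : ~ box m%:R w -> i w = 0.
  by move=> nw; rewrite /i indicE memNset// mulr0.
have i_ge0 w : 0 <= i w.
  by rewrite mulr_ge0.
have bi : band_density m%:R V^-1 i by split.
have ii := band_density_itg (ltW m0') bi.
have int1 : \int[leb]_w i w = 1.
  rewrite /Rintegral; under eq_integral do rewrite EFinM.
  rewrite ge0_integralZl//.
  - rewrite integral_indic// setIT [X in (_ * X)%E]lebesgue_rV_box ?ltW//.
    by rewrite -EFinM /= mulVf// gt_eqF.
  - by apply/measurable_EFinP; exact: measurable_indic.
have bc (f : Rd -> R) : measurable_fun setT f -> (forall w, `|f w| <= 1) ->
    band_density m%:R V^-1 (fun w => i w * f w).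
  move=> mf f1; split; first exact: measurable_funM.
    by move=> w; rewrite normrM (le_trans _ (i_le w))// ler_piMr.
  by move=> w nw; rewrite i0// mul0r.
have bu : band_density m%:R V^-1 (fun w => i w * cos (dot t w)).
  apply: bc => [|w]; last exact: cos_max.
  by apply: measurable_cos_comp; exact: measurable_dot1.
have bv : band_density m%:R V^-1 (fun w => i w * sin (dot t w)).
  apply: bc => [|w]; last exact: sin_max.
  by apply: measurable_sin_comp; exact: measurable_dot1.
exists (trig_int (fun w => i w * cos (dot t w)) (fun w => i w * sin (dot t w))).
have qE x : trig_int (fun w => i w * cos (dot t w)) (fun w => i w * sin (dot t w)) x
    = \int[leb]_w (i w * cos (dot (x - t) w)).
  by apply: eq_Rintegral => w _; rewrite dotBl cosB; ring.
have ic x : itg (fun w => i w * cos (dot (x - t) w)) by exact: itg_cos.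
split; first by exists (fun w => i w * cos (dot t w)), (fun w => i w * sin (dot t w)).
- move=> x; rewrite qE -int1; apply: Rintegral_norm_le => // w.
  by rewrite normrM (ger0_norm (i_ge0 w)) ler_piMr// cos_max.
- move=> x; pose c := d%:R ^+ 2 * m%:R ^+ 2 * norm2 (x - t) ^+ 2.
  have -> : d%:R ^+ 2 * m%:R ^+ 2 * norm2 (x - t) ^+ 2 = \int[leb]_w (c * i w).
    by rewrite RintegralZl// int1 mulr1.
  rewrite qE -[X in _ - X]int1 -RintegralB//.
  apply: Rintegral_norm_le; [exact: itgB|exact: itgZ|].
  move=> w; rewrite -[X in _ - X]mulr1 -mulrBr normrM (ger0_norm (i_ge0 w)) mulrC.
  have [rw|nw] := pselect (box m%:R w); last by rewrite i0// !mulr0.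
  rewrite ler_wpM2r// distrC ger0_norm ?one_sub_cos_ge0//.
  rewrite (le_trans (one_sub_cos_le _))// (le_trans (sqr_dot_le _ _))//.
  rewrite ler_wpM2r ?sqr_ge0// -exprMn lerXn2r// ?nnegrE ?sumr_ge0 ?mulr_ge0//.
  rewrite (@le_trans _ _ (\sum_(j < d) m%:R))//; first exact: ler_sum.
  by rewrite sumr_const card_ord mulr_natl.
Qed.

(** The box kernel at [t k] times a separator of bandwidth 1.  The separator does
    not depend on [m], so neither does the constant [c]. *)
Lemma interpolation_exists K (t : 'I_K -> Rd) (k : 'I_K) : injective t ->
  exists2 c, 0 < c & forall m, (0 < m)%N -> exists Q,
    [/\ band_limited (4 * m%:R) (c / m%:R ^+ d) Q, forall x, `|Q x| <= c,
        forall x, `|Q x - 1| <= c * m%:R ^+ 2 * norm2 (x - t k) ^+ 2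
      & forall j, j != k -> forall x, `|Q x| <= c * m%:R ^+ 2 * norm2 (x - t j) ^+ 2].
Proof.
move=> tinj; pose l := [seq t j | j <- enum 'I_K & j != k].
have tl : t k \notin l.
  apply/mapP => -[j]; rewrite mem_filter => /andP[jk _] /tinj jE.
  by rewrite jE eqxx in jk.
have [g [A [c [c0 gB gc gt gl]]]] := separator_exists tl (ltr01 : 0 < 1 :> R).
pose C := `|A| / 2 ^+ d + c + c * d%:R ^+ 2 + 1.
have cd0 : 0 <= c * d%:R ^+ 2 by rewrite mulr_ge0 ?sqr_ge0.
have A0 : 0 <= `|A| / 2 ^+ d by rewrite divr_ge0.
exists C; first by rewrite ltr_wpDl// !addr_ge0.
move=> m m0; have m1 : 1 <= m%:R :> R by rewrite ler1n.
have m0' : 0 < m%:R :> R by rewrite ltr0n.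
have mm1 : 1 <= m%:R ^+ 2 :> R by rewrite exprn_ege1.
have [q [bq q1 qt]] := box_kernel (t k) m0.
exists (fun x => q x * g x); split.
- apply: band_limitedS (gB _ _ _ (ltW m0') bq); first by lra.
  rewrite exprMn invfM mulrA ler_pM2r ?invr_gt0 ?exprn_gt0//.
  apply: (@le_trans _ _ (`|A| / 2 ^+ d)); last by rewrite /C; lra.
  by rewrite ler_wpM2r ?invr_ge0// ler_norm.
- move=> x; rewrite normrM (le_trans (ler_piMl _ (q1 x)))// (le_trans (gc x))//.
  by rewrite /C; lra.
- move=> x; have -> : q x * g x - 1 = (q x - 1) * g x + (g x - 1) by ring.
  rewrite (le_trans (ler_normD _ _))// normrM.
  have h1 : `|q x - 1| * `|g x| <= c * d%:R ^+ 2 * (m%:R ^+ 2 * norm2 (x - t k) ^+ 2).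
    have -> : c * d%:R ^+ 2 * (m%:R ^+ 2 * norm2 (x - t k) ^+ 2) =
      d%:R ^+ 2 * m%:R ^+ 2 * norm2 (x - t k) ^+ 2 * c by ring.
    by rewrite ler_pM.
  have h2 : `|g x - 1| <= c * (m%:R ^+ 2 * norm2 (x - t k) ^+ 2).
    by rewrite (le_trans (gt x))// ler_wpM2l// ler_peMl// sqr_ge0.
  have n0 : 0 <= m%:R ^+ 2 * norm2 (x - t k) ^+ 2 by rewrite mulr_ge0 ?sqr_ge0.
  have := mulr_ge0 A0 n0; rewrite /C -mulrA; move: h1 h2; lra.
- move=> j jk x; rewrite normrM (le_trans (ler_piMl _ (q1 x)))//.
  have tjl : t j \in l by apply: map_f; rewrite mem_filter jk mem_enum.
  rewrite (le_trans (gl _ tjl x))//.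
  have n0 : 0 <= m%:R ^+ 2 * norm2 (x - t j) ^+ 2 by rewrite mulr_ge0 ?sqr_ge0.
  have h2 : c * norm2 (x - t j) ^+ 2 <= c * (m%:R ^+ 2 * norm2 (x - t j) ^+ 2).
    by rewrite ler_wpM2l// ler_peMl// sqr_ge0.
  have := mulr_ge0 A0 n0; have := mulr_ge0 cd0 n0; rewrite /C -mulrA; move: h2; lra.
Qed.

End interpolation.

(** * The excess of a minimiser *)

Section optimality_arithmetic.
Context (R : realFieldType).
Implicit Types x y rho kappa e q : R.

(** Here and below [x] and [y] stand for the residual norms at the minimiser and
    at the true measure, [e] for the excess and [q] for the pairing with the
    certificate.  The first inequality hypothesis is the optimality of the
    minimiser, the second one the certificate inequality. *)
Lemma optimality_combine kappa rho x y (X Y e e0 q q0 : R) :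
  X = x ^+ 2 -> Y = y ^+ 2 -> q0 = 1 ->
  2^-1 * X + kappa * (e + q) <= 2^-1 * Y + kappa * (e0 + q0) ->
  kappa * (1 - q) <= rho * (x + y) -> kappa * (e0 + 1) <= kappa * 1 ->
  kappa * e <= (y ^+ 2 - x ^+ 2) / 2 + rho * (x + y).
Proof. by move=> -> -> ->; lra. Qed.

Lemma optimality_square rho x y :
  (y ^+ 2 - x ^+ 2) / 2 + rho * (x + y) <= y ^+ 2 + rho ^+ 2.
Proof. by have := sqr_ge0 (x - rho); have := sqr_ge0 (y - rho); rewrite !expr2; nra. Qed.

Lemma optimality_le rho x y : 0 <= y -> 0 < rho ->
  0 <= (y ^+ 2 - x ^+ 2) / 2 + rho * (x + y) -> x <= y + 2 * rho.
Proof.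
move=> y0 r0 h; rewrite leNgt; apply/negP => xy.
have E : (y ^+ 2 - x ^+ 2) / 2 + rho * (x + y) = (x + y) * (y + 2 * rho - x) / 2 by field.
have : (x + y) * (y + 2 * rho - x) < 0 by rewrite pmulr_rlt0//; lra.
by move: h; rewrite E; lra.
Qed.

Lemma sum_norms_le rho x y : 0 < rho -> x <= y + 2 * rho ->
  x + y <= 3 / rho * (y ^+ 2 + rho ^+ 2).
Proof.
move=> r0 xy; rewrite -(ler_pM2l r0).
have -> : rho * (3 / rho * (y ^+ 2 + rho ^+ 2)) = 3 * (y ^+ 2 + rho ^+ 2).
  by field; rewrite gt_eqF.
have : rho * (x + y) <= rho * (2 * y + 2 * rho) by rewrite ler_pM2l//; lra.
have := sqr_ge0 (y - rho); rewrite !expr2; nra.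
Qed.

End optimality_arithmetic.

Section certificate_bound.
Context (R : realType) (d : nat).
Local Notation leb := (lebesgue_rV R d).
Local Notation Rd := 'rV[R]_d.
Local Notation bmf f := (@bounded_mfun _ Rd R f).
Implicit Types (nu : {charge set Rd -> \bar R}) (f g P : Rd -> R).

Lemma measurable_near_region (c : Rd) (e : R) : measurable (near_region c e).
Proof.
have -> : near_region c e = (fun x => norm2 (x - c)) @^-1` `]-oo, e].
  by apply/seteqP; split => x; rewrite /near_region/= in_itv.
have mn : measurable_fun setT (fun x : Rd => norm2 (x - c)).
  apply: (measurableT_comp (continuous_measurable_fun (@sqrt_continuous R))).
  apply: measurable_sum => i; apply: measurable_funX.
  exact: (measurableT_comp (measurable_coord i) (measurable_rV_shift (- c))).
by rewrite -[X in measurable X]setTI; apply: mn.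
Qed.

Lemma measurable_far_region K (t : 'I_K -> Rd) (e : R) : measurable (far_region t e).
Proof.
apply: measurableC; rewrite -[X in measurable X]/(\bigcup_k _).
by apply: fin_bigcup_measurable => // k _; exact: measurable_near_region.
Qed.

(** The total variation minus the pairing with [P] ([excessE]), written as an
    integral of nonnegative functions.  It is the mass that a signed measure
    wastes: negative mass counts at least fully, and positive mass by the deficit of
    the certificate where it lies. *)
Definition excess nu P : R :=
  \int[pos_part nu]_x (1 - P x) + \int[neg_part nu]_x (1 + P x).

Section excess.
Variables (nu : {charge set Rd -> \bar R}) (P : Rd -> R).
Hypotheses (mP : measurable_fun setT P) (P01 : forall x, 0 <= P x <= 1).

Lemma bounded_certificate : bmf P.
Proof.
by split => //; exists 1 => x; have /andP[? ?] := P01 x; rewrite ger0_norm.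
Qed.

Let bP := bounded_certificate.
Let b1 : bmf (fun=> 1). Proof. exact: bounded_mfun_cst. Qed.
Let b1mP : bmf (fun x => 1 - P x). Proof. exact: bounded_mfunB. Qed.
Let b1pP : bmf (fun x => 1 + P x). Proof. exact: bounded_mfunD. Qed.

Let pos_ge0 : 0 <= \int[pos_part nu]_x (1 - P x).
Proof. by apply: Rintegral_ge0 => x _; have := P01 x; lra. Qed.

Let neg_ge0 : 0 <= \int[neg_part nu]_x (1 + P x).
Proof. by apply: Rintegral_ge0 => x _; have := P01 x; lra. Qed.

Lemma excess_ge0 : 0 <= excess nu P.
Proof. exact: addr_ge0. Qed.

Lemma excessE : Defs.total_variation nu = (excess nu P + charge_integral nu P)%:E.
Proof.
have I1 (m : {finite_measure set Rd -> \bar R}) : \int[m]_x (1 : R) = fine (m setT).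
  by rewrite Rintegral_cst// mul1r.
rewrite total_variationE /excess /charge_integral.
rewrite RintegralB ?RintegralD//; [|exact: bounded_mfunP..].
rewrite !I1 -[LHS]fineK ?fin_numD ?fin_num_measure// fineD ?fin_num_measure//.
congr EFin; ring.
Qed.

Lemma neg_part_le_excess : (neg_part nu setT <= (excess nu P)%:E)%E.
Proof.
rewrite -[leLHS]fineK ?fin_num_measure// lee_fin -[leLHS]mul1r -Rintegral_cst//.
rewrite -[leLHS]add0r lerD// le_Rintegral//; [exact: bounded_mfunP..|].
by move=> x _; have := P01 x; lra.
Qed.

Lemma pos_part_le_excess (eta : R) A : 0 < eta -> measurable A ->
  (forall x, A x -> P x <= 1 - eta) ->
  (pos_part nu A <= (eta^-1 * excess nu P)%:E)%E.
Proof.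
move=> eta0 mA PA; have bA := bounded_mfun_indic R mA.
have -> : pos_part nu A = (\int[pos_part nu]_x (\1_A x : R))%:E.
  by rewrite /Rintegral integral_indic// setIT fineK// fin_num_measure.
rewrite lee_fin -(ler_pM2l eta0) mulrA divff ?gt_eqF// mul1r.
rewrite -RintegralZl//; last exact: bounded_mfunP.
rewrite -[leLHS]addr0 lerD// le_Rintegral//.
- by apply: bounded_mfunP; exact: bounded_mfunZ.
- exact: bounded_mfunP.
- move=> x _; rewrite indicE; have [xA|xA] := boolP (x \in A).
    by move: xA; rewrite inE mulr1 => /PA; lra.
  by rewrite mulr0 subr_ge0; have /andP[] := P01 x.
Qed.

Lemma charge_integral_le_excess g (B : R) : bmf g ->
  (forall x, `|g x| <= B * (1 - P x)) -> (forall x, `|g x| <= B) -> 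
  `|charge_integral nu g| <= B * excess nu P.
Proof.
move=> bg gB1 gB; rewrite /charge_integral (le_trans (ler_normB _ _))//.
rewrite /excess mulrDr lerD//.
  rewrite -RintegralZl//; last exact: bounded_mfunP.
  apply: Rintegral_norm_le => //; first exact: bounded_mfunP.
  by apply: bounded_mfunP; exact: bounded_mfunZ.
rewrite -RintegralZl//; last exact: bounded_mfunP.
apply: Rintegral_norm_le => //; first exact: bounded_mfunP.
  by apply: bounded_mfunP; exact: bounded_mfunZ.
move=> x; have B0 : 0 <= B := le_trans (normr_ge0 _) (gB x).
have /andP[p0 _] := P01 x.
by rewrite (le_trans (gB x))// ler_peMr// lerDl.
Qed.

End excess.

Section minimizer.
Variables (phi lam : Rd -> R).
Hypothesis phi_dens : probability_density phi.
Hypothesis phi_reg : regular_kernel phi.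
Hypothesis lam_reg : regular_kernel lam.
Variable H : rkhs (fun x y => lam (x - y)).
Local Notation dom := (rkhs_dom H).
Local Notation ip := (rkhs_ip H).
Local Notation norm f := (Num.sqrt (ip f f)).
Variable fhat : {charge set Rd -> \bar R}.
Hypothesis dfhat : dom (charge_convolution lam fhat).
Local Notation res nu := (residual phi lam fhat nu).

Lemma rkhs_normE f : dom f -> rkhs_norm H f = (norm f)%:E.
Proof. by move=> df; rewrite /rkhs_norm mem_set. Qed.

Lemma rkhs_norm_sqr f : dom f -> (rkhs_norm H f ^+ 2)%E = (ip f f)%:E.
Proof.
by move=> df; rewrite rkhs_normE// -EFin_expe sqr_sqrtr// rkhs_ip_ge0.
Qed.

Lemma objectiveE kappa nu P : dom (res nu) ->
  measurable_fun setT P -> (forall x, 0 <= P x <= 1) ->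
  objective phi H kappa fhat nu =
  (2^-1 * ip (res nu) (res nu) + kappa * (excess nu P + charge_integral nu P))%:E.
Proof.
by move=> dr mP P01; rewrite /objective rkhs_norm_sqr// (excessE nu mP P01).
Qed.

Lemma residual0 : res (czero : {charge set Rd -> \bar R}) = charge_convolution lam fhat.
Proof.
apply/funext => x; rewrite /residual/= /convolution.
have c0 y : charge_convolution phi (czero : {charge set Rd -> \bar R}) y = 0.
  apply: charge_integral_czero; have := bounded_mfun_regular phi_reg.
  move=> /(bounded_mfun_shift y); congr bounded_mfun.
  by apply/funext => z; rewrite (regular_kernelB _ _ phi_reg).
under eq_Rintegral do rewrite c0 mulr0.
by rewrite Rintegral_cst// mul0r subr0.
Qed.

Variables (kappa : R) (nuhat : {charge set Rd -> \bar R}).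
Hypothesis kappa_gt0 : 0 < kappa.
Hypothesis nuhat_min : forall nu,
  (objective phi H kappa fhat nuhat <= objective phi H kappa fhat nu)%E.

(** The residual of the null measure is the smoothed empirical measure, which is
    in the space; so the objective is finite there, hence at a minimiser. *)
Lemma dom_residual_minimizer : dom (res nuhat).
Proof.
apply: contrapT => nd.
have oo : objective phi H kappa fhat nuhat = +oo%E.
  rewrite /objective /rkhs_norm memNset//.
  rewrite (_ : (+oo ^+ 2)%E = +oo%E) ?gt0_muley ?lte_fin ?invr_gt0//.
  by rewrite (@excessE _ (fun=> 0))// => x; rewrite lexx ler01.
have := nuhat_min (czero : {charge set Rd -> \bar R}).
rewrite oo (@objectiveE _ _ (fun=> 0))//; first by rewrite residual0.
by move=> x; rewrite lexx ler01.
Qed.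

Variables (nu0 : {charge set Rd -> \bar R}) (P c : Rd -> R) (rho : R).
Hypotheses (mP : measurable_fun setT P) (P01 : forall x, 0 <= P x <= 1).
Hypotheses (dc : dom c) (ac : approximable H c) (mc : measurable_fun setT c).
Hypothesis Pc : convolution phi c = P.
Hypothesis nu0P : charge_integral nu0 P = 1.
Hypothesis nu0TV : (Defs.total_variation nu0 <= 1)%E.
Hypothesis rho_gt0 : 0 < rho.
Hypothesis kappaE : kappa * norm c = rho.
Hypothesis dres0 : dom (res nu0).

Let x := norm (res nuhat).
Let y := norm (res nu0).

Let x_ge0 : 0 <= x. Proof. exact: sqrtr_ge0. Qed.
Let y_ge0 : 0 <= y. Proof. exact: sqrtr_ge0. Qed.
Let y_sqr : y ^+ 2 = ip (res nu0) (res nu0).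
Proof. by rewrite sqr_sqrtr// rkhs_ip_ge0. Qed.

Lemma ip_residual_le g : dom g -> approximable H g -> measurable_fun setT g ->
  `|charge_integral nu0 (convolution phi g) - charge_integral nuhat (convolution phi g)|
  <= norm g * (x + y).
Proof.
move=> dg ag mg; have dh := dom_residual_minimizer.
rewrite (ip_residualB phi_dens phi_reg lam_reg dfhat dg ag mg dres0 dh).
rewrite (le_trans (ler_normB _ _))// mulrDr lerD// mulrC.
  exact: rkhs_norm_cauchy_schwarz.
exact: rkhs_norm_cauchy_schwarz.
Qed.

Let optimality : kappa * excess nuhat P <= (y ^+ 2 - x ^+ 2) / 2 + rho * (x + y).
Proof.
have dh := dom_residual_minimizer.
have obj := nuhat_min nu0.
rewrite (objectiveE kappa dh mP P01) (objectiveE kappa dres0 mP P01) lee_fin in obj.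
have tv0 := nu0TV; rewrite (excessE nu0 mP P01) lee_fin nu0P in tv0.
have gap := le_trans (ler_norm _) (ip_residual_le dc ac mc); rewrite Pc nu0P in gap.
have gap' : kappa * (1 - charge_integral nuhat P) <= rho * (x + y).
  by rewrite -kappaE -mulrA ler_pM2l.
have tv0' : kappa * (excess nu0 P + 1) <= kappa * 1 by rewrite ler_pM2l.
have sqE f : dom f -> ip f f = norm f ^+ 2 by move=> df; rewrite sqr_sqrtr// rkhs_ip_ge0.
exact: optimality_combine (sqE _ dh) (sqE _ dres0) nu0P obj gap' tv0'.
Qed.

(** The source of all the bounds: optimality against [nu0] and the duality of [c]
    and [P] bound [kappa * excess] by a quadratic expression in the residual norm
    of the minimiser, which is then maximised. *)
Lemma excess_le : excess nuhat P <= norm c / rho * (ip (res nu0) (res nu0) + rho ^+ 2).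
Proof.
rewrite -y_sqr -(ler_pM2l kappa_gt0) mulrA mulrA kappaE divff ?gt_eqF// mul1r.
exact: le_trans optimality (optimality_square _ _ _).
Qed.

Lemma residual_minimizer_le : x <= y + 2 * rho.
Proof.
apply: optimality_le => //; apply: le_trans optimality.
by rewrite mulr_ge0 ?(ltW kappa_gt0)// excess_ge0.
Qed.

(** Replace the indicator of [A] by the test function [convolution phi g]: the
    pairing with it is estimated by the residuals, and the replacement costs at
    most a multiple of the excess. *)
Lemma weight_error_le g A a (B : R) : dom g -> approximable H g -> measurable_fun setT g ->
  measurable A -> charge_integral nu0 (convolution phi g) = a ->
  bmf (convolution phi g) ->
  (forall z, `|convolution phi g z - \1_A z| <= B * (1 - P z)) ->
  (forall z, `|convolution phi g z - \1_A z| <= B) -> 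
  (`|a%:E - nuhat A| <=
   ((3 * norm g + B * norm c) / rho * (ip (res nu0) (res nu0) + rho ^+ 2))%:E)%E.
Proof.
move=> dg ag mg mA ga bg gB1 gB; set Q := convolution phi g in ga bg gB1 gB *.
have bA := bounded_mfun_indic R mA.
rewrite (charge_integral_indic nuhat mA) -EFinB lee_fin.
have split3 : a - charge_integral nuhat \1_A =
    (a - charge_integral nuhat Q) + charge_integral nuhat (fun z => Q z - \1_A z).
  rewrite /charge_integral !RintegralB//; [|exact: bounded_mfunP..].
  by ring.
rewrite split3 (le_trans (ler_normD _ _))//.
have h1 := ip_residual_le dg ag mg; rewrite -/Q ga in h1.
have h2 := charge_integral_le_excess nuhat mP P01 (bounded_mfunB bg bA) gB1 gB.
have h3 := excess_le; have h4 := residual_minimizer_le.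
have B0 : 0 <= B := le_trans (normr_ge0 _) (gB 0).
rewrite -y_sqr in h3 *.
have h5 : norm g * (x + y) <= 3 * norm g / rho * (y ^+ 2 + rho ^+ 2).
  have -> : 3 * norm g / rho * (y ^+ 2 + rho ^+ 2) =
    norm g * (3 / rho * (y ^+ 2 + rho ^+ 2)) by ring.
  by rewrite ler_wpM2l ?sqrtr_ge0// sum_norms_le.
have h6 : B * excess nuhat P <= B * norm c / rho * (y ^+ 2 + rho ^+ 2).
  by rewrite -!mulrA ler_wpM2l// mulrA.
rewrite mulrDl mulrDl lerD//; first exact: le_trans h1 h5.
exact: le_trans h2 h6.
Qed.

End minimizer.
End certificate_bound.

(** * Consequences of the certificate inequalities *)

Section certificate_facts.
Context (R : realType) (d : nat).
Local Notation leb := (lebesgue_rV R d).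
Local Notation Rd := 'rV[R]_d.
Local Notation itg f := (leb.-integrable setT (EFin \o f)).

Lemma Lnorm2_le (P : Rd -> R) (B : R) : itg (fun x => P x ^+ 2) -> 0 <= B ->
  ('N[leb]_2%:E [EFin \o P] <= B%:E)%E -> \int[leb]_x (P x ^+ 2) <= B ^+ 2.
Proof.
move=> iP B0 PB; rewrite -lee_fin -Rintegral_EFin//.
have -> : (\int[leb]_x (P x ^+ 2)%:E = \int[leb]_x `|(EFin \o P) x| `^ 2)%E.
  apply: eq_integral => x _ /=.
  by rewrite powR_mulrn// real_normK ?num_real.
rewrite -poweR_Lnorm//.
apply: (@le_trans _ _ (B%:E `^ 2)%E).
  apply: gt0_ler_poweR => //; rewrite in_itv/= leey andbT ?lee_fin//.
  exact: Lnorm_ge0.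
by rewrite poweR_EFin powR_mulrn.
Qed.

Section certificate.
Variables (gamma ups C C3 : R) (K : nat) (t : 'I_K -> Rd) (m : nat) (P : Rd -> R).
Hypotheses (d_gt0 : (0 < d)%N) (gamma_gt0 : 0 < gamma) (ups_gt0 : 0 < ups).
Hypothesis C_gt0 : 0 < C.
Hypothesis cert : dual_certificate gamma ups C C3 t m P.
Let eps := near_radius d ups m.

Definition far_gap : R := gamma * ups ^+ 2 / d%:R ^+ 3.

Lemma far_gap_gt0 : 0 < far_gap.
Proof. by rewrite /far_gap divr_gt0 ?mulr_gt0 ?exprn_gt0// ltr0n. Qed.

Lemma cert_measurable : measurable_fun setT P.
Proof. exact: itg_measurable (cert_integrable cert). Qed.

Lemma cert_itg_sqr : itg (fun x => P x ^+ 2).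
Proof.
apply: (itgM_bounded (M := 1) (cert_integrable cert) cert_measurable) => x.
by have /andP[? ?] := cert_itv cert x; rewrite ger0_norm.
Qed.

Lemma cert_far_or_near x :
  P x <= 1 - far_gap \/ exists k, near_region (t k) eps x.
Proof.
have [[k kx]|nx] := pselect (exists k, near_region (t k) eps x); first by right; exists k.
by left; apply: (cert_far cert) => -[k _ kx]; apply: nx; exists k.
Qed.

Lemma cert_away x :
  (forall k, far_gap <= C * m%:R ^+ 2 * norm2 (x - t k) ^+ 2) -> P x <= 1 - far_gap.
Proof.
move=> h; have [//|[k kx]] := cert_far_or_near x.
by apply: (le_trans (cert_near cert kx)); rewrite lerD2l lerN2.
Qed.

(** Near a point the difference between the interpolant and the indicator is at
    most quadratic in the distance, and elsewhere it is bounded; the deficit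
    [1 - P] is at least quadratic near the points and bounded below elsewhere.
    The near regions may overlap. *)
Lemma interpolant_gap (Q : Rd -> R) (c : R) k (B := c / C + c / far_gap + c + 1) :
  0 < c -> (forall x, `|Q x| <= c) ->
  (forall x, `|Q x - 1| <= c * m%:R ^+ 2 * norm2 (x - t k) ^+ 2) ->
  (forall j, j != k -> forall x, `|Q x| <= c * m%:R ^+ 2 * norm2 (x - t j) ^+ 2) ->
  (forall x, `|Q x - \1_(near_region (t k) eps) x| <= B * (1 - P x)) /\
  (forall x, `|Q x - \1_(near_region (t k) eps) x| <= B).
Proof.
move=> c0 Qc Qk Qj; have g0 := far_gap_gt0.
have cC : 0 < c / C by rewrite divr_gt0.
have cg : 0 < c / far_gap by rewrite divr_gt0.
have near z x : near_region (t z) eps x ->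
    c * m%:R ^+ 2 * norm2 (x - t z) ^+ 2 <= B * (1 - P x).
  move=> zx; have := cert_near cert zx => h.
  have -> : c * m%:R ^+ 2 * norm2 (x - t z) ^+ 2 =
      c / C * (C * m%:R ^+ 2 * norm2 (x - t z) ^+ 2) by field; rewrite gt_eqF.
  have /andP[_ p1] := cert_itv cert x.
  apply: (@le_trans _ _ (c / C * (1 - P x))); first by rewrite ler_pM2l//; lra.
  by rewrite ler_wpM2r ?subr_ge0// /B; lra.
split=> x; have /andP[p0 p1] := cert_itv cert x; last first.
  rewrite (le_trans (ler_normB _ _))// (@le_trans _ _ (c + 1))//; last by rewrite /B; lra.
  by rewrite lerD// indicE; case: (_ \in _); rewrite ?normr1 ?normr0.
have [kx|nkx] := pselect (near_region (t k) eps x).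
  by rewrite indicE mem_set// (le_trans (Qk x))// near.
rewrite indicE memNset// subr0.
have [xfar|[j jx]] := cert_far_or_near x.
  apply: (@le_trans _ _ (c / far_gap * (1 - P x))).
    rewrite (le_trans (Qc x))// mulrAC ler_pdivlMr// ler_pM2l//; lra.
  by rewrite ler_wpM2r ?subr_ge0// /B; lra.
have jk : j != k by apply: contra_notN nkx => /eqP <-.
by rewrite (le_trans (Qj j jk x))// near.
Qed.

End certificate.

Section norms.
Variables (phi lam Lam : Rd -> R).
Hypothesis phi_dens : probability_density phi.
Hypothesis phi_reg : regular_kernel phi.
Hypothesis phi_pos : forall w, 0 <= fourier phi w.
Hypothesis lamLam : spectral_density lam Lam.
Variable H : rkhs (fun x y => lam (x - y)).
Local Notation ip := (rkhs_ip H).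
Variable m : nat.
Local Notation S := (spectral_inf phi Lam m).
Hypothesis S_gt0 : 0 < S.

Lemma sqr_powR_half : (m%:R `^ (- (d%:R / 2)) : R) ^+ 2 = (m%:R ^+ d)^-1.
Proof.
rewrite -powR_mulrn ?powR_ge0// -powRrM mulNr divfK// powRN powR_mulrn//.
Qed.

Lemma band_limited_rkhs (N : R) Q : band_limited (4 * m%:R) N Q ->
  exists g, [/\ rkhs_dom H g, approximable H g, measurable_fun setT g,
    convolution phi g = Q &
    ip g g <= (2 * pi) ^+ d * (2 * N ^+ 2 * (8 * m%:R) ^+ d) / S].
Proof.
move=> [u [v [[mu uN u0] [mv vN v0] QE]]].
have u0' : off_cube m u by move=> w nw; apply: u0; rewrite -cube_box.
have v0' : off_cube m v by move=> w nw; apply: v0; rewrite -cube_box.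
pose q w := u w ^+ 2 + v w ^+ 2.
have sq (a : R) : `|a| <= N -> a ^+ 2 <= N ^+ 2.
  by move=> aN; rewrite -real_normK ?num_real// lerXn2r// nnegrE (le_trans _ aN).
have mq : measurable_fun setT q by apply: measurable_funD; exact: measurable_funX.
have q0 : off_cube m q by move=> w nw; rewrite /q u0'// v0'// expr0n addr0.
have q_ge0 w : 0 <= q w by rewrite addr_ge0 ?sqr_ge0.
have qN w : `|q w| <= 2 * N ^+ 2.
  by rewrite ger0_norm// mulr_natl mulr2n lerD// sq.
have [iq Iq] := itg_off_cube mq q0 qN.
have [_ [dg ag] mg ng cg] := dual_coefP phi_dens phi_reg phi_pos lamLam H S_gt0 mu mv u0' v0' iq.
exists (dual_coef phi u v); split => //; first by rewrite QE.
apply: (le_trans ng); rewrite ler_wpM2r ?invr_ge0 ?(ltW S_gt0)//.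
rewrite ler_wpM2l ?exprn_ge0 ?mulr_ge0 ?pi_ge0//.
by apply: le_trans Iq; rewrite le_eqVlt; apply/orP; left; apply/eqP;
  apply: eq_Rintegral => w _; rewrite ger0_norm.
Qed.

End norms.
End certificate_facts.

(** * The risk bounds *)

Section final.
Context (R : realType).

(** The argument yields the constant 2, which is below the stated one. *)
Lemma sqrt2_bound : 2 <= 3 * Num.sqrt 2 / 2 :> R.
Proof.
have : (4 / 3) ^+ 2 <= 2 :> R by lra.
rewrite -(ler_sqrt _ (_ : 0 <= 2))// sqrtr_sqr ger0_norm; lra.
Qed.

Lemma dom_empirical d (lam : 'rV[R]_d -> R) (H : rkhs (fun x y => lam (x - y)))
    Om (X : nat -> Om -> 'rV[R]_d) n w :
  regular_kernel lam -> rkhs_dom H (charge_convolution lam (empirical X n w)).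
Proof.
move=> lam_reg.
have -> : charge_convolution lam (empirical X n w) = kernel_comb (fun x y => lam (x - y))
    [seq (n%:R^-1, X (nat_of_ord i) w) | i <- enum 'I_n].
  apply/funext => x; rewrite /kernel_comb big_map big_enum/=.
  rewrite /charge_convolution charge_integral_point_masses//.
  have := bounded_mfun_shift x (bounded_mfun_regular lam_reg).
  by congr bounded_mfun; apply/funext => y; rewrite (regular_kernelB _ _ lam_reg).
exact: rkhs_dom_comb.
Qed.

Section one_sample.
Variables (d : nat) (gamma ups C C3 : R) (phi lam Lam : 'rV[R]_d -> R).
Hypotheses (d_gt0 : (0 < d)%N) (gamma_gt0 : 0 < gamma) (ups_gt0 : 0 < ups).
Hypothesis C3_gt0 : 0 < C3.
Hypothesis phi_dens : probability_density phi.
Hypothesis phi_reg : regular_kernel phi.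
Hypothesis phi_pos : forall w, 0 <= fourier phi w.
Hypothesis lam_reg : regular_kernel lam.
Hypothesis lamLam : spectral_density lam Lam.
Variable H : rkhs (fun x y => lam (x - y)).
Local Notation dom := (rkhs_dom H).
Local Notation norm f := (Num.sqrt (rkhs_ip H f f)).
Variables (K : nat) (t : 'I_K -> 'rV[R]_d) (a : 'I_K -> R).
Hypotheses (a_gt0 : forall k, 0 < a k) (a_sum : \sum_k a k = 1).
Let mu0 := point_masses a t.
Variables (m : nat) (P : 'rV[R]_d -> R).
Hypothesis S_gt0 : 0 < spectral_inf phi Lam m.
Hypothesis cert : dual_certificate gamma ups C C3 t m P.
Hypothesis P_conv : forall x, P x = convolution phi (c0 phi P) x.
Let eps := near_radius d ups m.
Let c := c0 phi P.

Lemma c0P : [/\ dom c, approximable H c, measurable_fun setT c & norm c <= Cm C3 K phi Lam m].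
Proof.
have iP2 := cert_itg_sqr cert.
have [dc ac mc nc] := c0_rkhs phi_dens phi_reg phi_pos lamLam H S_gt0
  (cert_integrable cert) (cert_support cert) P_conv iP2.
split => //; have B0 : 0 <= C3 * K%:R ^+ 2 * m%:R `^ (- (d%:R / 2)).
  by rewrite !mulr_ge0 ?powR_ge0// ltW.
have PB := Lnorm2_le iP2 B0 (cert_norm cert).
rewrite /Cm -[X in _ <= X / _](ger0_norm B0) -sqrtr_sqr -sqrtrV ?(ltW S_gt0)// -sqrtrM ?sqr_ge0//.
by rewrite ler_wsqrtr// (le_trans nc)// ler_wpM2r ?invr_ge0 ?(ltW S_gt0).
Qed.

Lemma charge_integral_mu0 f : @bounded_mfun _ 'rV[R]_d R f ->
  charge_integral mu0 f = \sum_k a k * f (t k).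
Proof. by move=> bf; rewrite charge_integral_point_masses// => k; exact: ltW. Qed.

Let bP := bounded_certificate (cert_measurable cert) (cert_itv cert).

Lemma mu0P : charge_integral mu0 P = 1.
Proof.
rewrite charge_integral_mu0// -a_sum; apply: eq_bigr => k _.
by rewrite (cert_eq1 cert (t k)).2 ?mulr1//; exists k.
Qed.

Lemma mu0_TV : (Defs.total_variation mu0 <= 1)%E.
Proof.
by rewrite -a_sum; apply: total_variation_point_masses => k; exact: ltW.
Qed.

(** Otherwise [P], the convolution of [c], would vanish, but it is 1 at the points,
    and there is a point since the weights sum to 1. *)
Lemma norm_c0_gt0 : 0 < norm c.
Proof.
have [dc _ _ _] := c0P; rewrite lt_def sqrtr_ge0 andbT sqrtr_eq0 -ltNge.
rewrite lt_def rkhs_ip_ge0// andbT; apply/eqP => c00.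
have cz := rkhs_ip_eq0 dc c00.
have [k|K0] := pselect (exists k : 'I_K, True); last first.
  have := oner_neq0 R; rewrite -a_sum big1 ?eqxx// => k _.
  by exfalso; apply: K0; exists k.
have [k0 _] := k; have := (cert_eq1 cert (t k0)).2 (ex_intro _ k0 erefl).
rewrite P_conv -/c cz /convolution.
under eq_Rintegral do rewrite mulr0.
by rewrite Rintegral_cst// mul0r => /esym/eqP; rewrite oner_eq0.
Qed.

Lemma fine_norm_c0 : fine (rkhs_norm H c) = norm c.
Proof. by have [dc _ _ _] := c0P; rewrite rkhs_normE. Qed.

Variables (fhat nuhat : {charge set 'rV[R]_d -> \bar R}) (rho : R).
Hypothesis dfhat : dom (charge_convolution lam fhat).
Hypothesis rho_gt0 : 0 < rho.
Local Notation kappa := (rho / norm c).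
Hypothesis nuhat_min : forall nu,
  (objective phi H kappa fhat nuhat <= objective phi H kappa fhat nu)%E.
Let res2 := (rkhs_norm H (residual phi lam fhat mu0) ^+ 2)%E.

Let kappa_gt0 : 0 < kappa. Proof. by rewrite divr_gt0// norm_c0_gt0. Qed.

Let Pc : convolution phi c = P.
Proof. by apply/funext => x; rewrite P_conv. Qed.

(** Passage to the extended reals: where the residual of the true measure is
    outside of the space its norm is infinite, and there is nothing to prove. *)
Let lift (g : \bar R) (al : R) : 0 < al ->
  (dom (residual phi lam fhat mu0) ->
   (g <= (al * (rkhs_ip H (residual phi lam fhat mu0) (residual phi lam fhat mu0)
     + rho ^+ 2))%:E)%E) ->
  (g <= al%:E * (res2 + (rho ^+ 2)%:E))%E.
Proof.
move=> al0 h; have [dr|nd] := pselect (dom (residual phi lam fhat mu0)).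
  by rewrite /res2 rkhs_norm_sqr// -EFinD -EFinM; exact: h.
have -> : res2 = +oo%E by rewrite /res2 /rkhs_norm memNset.
by rewrite addye// gt0_muley ?lte_fin// leey.
Qed.

Let excess_bound : dom (residual phi lam fhat mu0) ->
  excess nuhat P <= norm c / rho *
    (rkhs_ip H (residual phi lam fhat mu0) (residual phi lam fhat mu0) + rho ^+ 2).
Proof.
move=> dr; have [dc ac mc _] := c0P.
apply: (excess_le phi_dens phi_reg lam_reg dfhat kappa_gt0 nuhat_min
  (cert_measurable cert) (cert_itv cert) dc ac mc Pc mu0P mu0_TV rho_gt0) => //.
by rewrite divfK// gt_eqF// norm_c0_gt0.
Qed.

Lemma neg_part_sample :
  (neg_part nuhat setT <= (norm c / rho)%:E * (res2 + (rho ^+ 2)%:E))%E.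
Proof.
apply: lift => [|dr]; first by rewrite divr_gt0// norm_c0_gt0.
apply: le_trans (neg_part_le_excess nuhat (cert_measurable cert) (cert_itv cert)) _.
by rewrite lee_fin excess_bound.
Qed.

Lemma pos_part_sample A : measurable A ->
  (forall x, A x -> P x <= 1 - far_gap d gamma ups) ->
  (pos_part nuhat A <=
    ((far_gap d gamma ups)^-1 * (norm c / rho))%:E * (res2 + (rho ^+ 2)%:E))%E.
Proof.
move=> mA PA; have g0 := far_gap_gt0 d_gt0 gamma_gt0 ups_gt0.
apply: lift => [|dr]; first by rewrite mulr_gt0 ?invr_gt0// divr_gt0// norm_c0_gt0.
apply: le_trans (pos_part_le_excess nuhat (cert_measurable cert) (cert_itv cert) g0 mA PA) _.
by rewrite lee_fin -mulrA ler_pM2l ?invr_gt0// excess_bound.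
Qed.

Lemma weight_sample k Q g (B be : R) : 0 < B ->
  convolution phi g = Q -> dom g -> approximable H g -> measurable_fun setT g ->
  norm g <= be * Cm C3 K phi Lam m -> @bounded_mfun _ 'rV[R]_d R Q -> 0 <= be ->
  (forall j, Q (t j) = (j == k)%:R) ->
  (forall x, `|Q x - \1_(near_region (t k) eps) x| <= B * (1 - P x)) ->
  (forall x, `|Q x - \1_(near_region (t k) eps) x| <= B) ->
  (`|(a k)%:E - nuhat (near_region (t k) eps)| <=
    ((3 * be + B) * Cm C3 K phi Lam m / rho)%:E * (res2 + (rho ^+ 2)%:E))%E.
Proof.
move=> B0 gQ dg ag mg ng bQ be0 Qt QB1 QB; have [dc ac mc nc] := c0P.
have Cm0 : 0 < Cm C3 K phi Lam m := lt_le_trans norm_c0_gt0 nc.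
apply: lift => [|dr].
  by rewrite divr_gt0// mulr_gt0// ltr_wpDl// mulr_ge0.
have mN := measurable_near_region (t k) eps.
have Qa : charge_integral mu0 Q = a k.
  rewrite charge_integral_mu0// (bigD1 k)//= Qt eqxx mulr1 big1 ?addr0// => j jk.
  by rewrite Qt (negbTE jk) mulr0.
rewrite -gQ in Qa bQ QB1 QB.
apply: le_trans (weight_error_le phi_dens phi_reg lam_reg dfhat kappa_gt0 nuhat_min
  (cert_measurable cert) (cert_itv cert) dc ac mc Pc mu0P mu0_TV rho_gt0 _ dr
  dg ag mg mN Qa bQ QB1 QB) _.
  by rewrite divfK// gt_eqF// norm_c0_gt0.
rewrite lee_fin ler_wpM2r ?addr_ge0 ?rkhs_ip_ge0 ?sqr_ge0//.
rewrite ler_wpM2r ?invr_ge0 ?(ltW rho_gt0)// [leRHS]mulrDl lerD//.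
  by rewrite -mulrA ler_wpM2l.
by rewrite ler_wpM2l// ltW.
Qed.

Lemma rkhs_norm_sqr_ge0 f : (0 <= rkhs_norm H f ^+ 2)%E.
Proof.
rewrite /rkhs_norm; case: ifP => _; last by rewrite (_ : (+oo ^+ 2)%E = +oo%E)// leey.
by rewrite -EFin_expe lee_fin sqr_ge0.
Qed.

End one_sample.

(** The ratio between the norm of the coefficient of an interpolant with constant
    [c] and the normalisation [Cm]; it depends neither on [m] nor on the
    kernels. *)
Definition weight_factor (d : nat) (C3 : R) (K : nat) (c : R) : R :=
  Num.sqrt (2 * (2 * pi) ^+ d * 8 ^+ d) * c / (C3 * K%:R ^+ 2).

Lemma interpolant_norm d (C3 c S : R) K m (N : R) :
  (0 < m)%N -> (0 < K)%N -> 0 < C3 -> 0 < c -> 0 < S ->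
  N <= (2 * pi) ^+ d * (2 * (c / m%:R ^+ d) ^+ 2 * (8 * m%:R) ^+ d) / S ->
  Num.sqrt N <= weight_factor d C3 K c *
    (C3 * K%:R ^+ 2 * m%:R `^ (- (d%:R / 2)) / Num.sqrt S).
Proof.
move=> m0 K0 C30 c0 S0 NB; have m0' : 0 < m%:R :> R by rewrite ltr0n.
have K0' : 0 < K%:R :> R by rewrite ltr0n.
have k0 : 0 <= 2 * (2 * pi) ^+ d * 8 ^+ d :> R.
  by rewrite !mulr_ge0 ?exprn_ge0 ?mulr_ge0 ?pi_ge0.
rewrite /weight_factor; set s := Num.sqrt (2 * _ * _).
have -> : s * c / (C3 * K%:R ^+ 2) * (C3 * K%:R ^+ 2 * m%:R `^ (- (d%:R / 2)) / Num.sqrt S) =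
    s * c * m%:R `^ (- (d%:R / 2)) / Num.sqrt S.
  by field; rewrite !gt_eqF// sqrtr_gt0.
have Y0 : 0 <= s * c * m%:R `^ (- (d%:R / 2)) / Num.sqrt S.
  by rewrite divr_ge0 ?sqrtr_ge0// !mulr_ge0 ?sqrtr_ge0 ?powR_ge0 ?(ltW c0).
rewrite -(ger0_norm Y0) -sqrtr_sqr ler_wsqrtr// (le_trans NB)// le_eqVlt; apply/orP; left.
apply/eqP; have -> (p q : R) : (s * c * p / q) ^+ 2 = s ^+ 2 * c ^+ 2 * p ^+ 2 / q ^+ 2.
  by rewrite !exprMn exprVn.
rewrite (sqr_sqrtr (ltW S0)) sqr_powR_half (sqr_sqrtr k0) (exprMn d 8).
by field; rewrite !gt_eqF// exprn_gt0.
Qed.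

End final.

Theorem theorem10 (R : realType) :
  exists C0 gamma ups : R,
    [/\ 0 < C0, 0 < gamma, 0 < ups,
      (* non-vacuity of the certificate hypothesis below: no constants outside
         the range allowed by the existence theorem for dual certificates *)
      (exists C0' gamma' ups' : R, certificate_constants C0' gamma' ups') ->
        certificate_constants C0 gamma ups
    & forall (d : nat) (C C3 : R), (0 < d)%N -> 0 < C -> 0 < C3 ->
      forall (phi lam Lam : 'rV[R]_d -> R),
      probability_density phi -> regular_kernel phi -> regular_kernel lam ->
      (forall w, 0 <= fourier phi w) -> spectral_density lam Lam ->
      forall (H : rkhs (fun x y => lam (x - y)))
        (K : nat) (t : 'I_K -> 'rV[R]_d) (a : 'I_K -> R),
      injective t -> (forall k, 0 < a k) -> \sum_k a k = 1 ->
      let mu0 := point_masses a t in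
      let f0 := charge_convolution phi mu0 in
      exists M : R, 0 < M /\
      forall (m : nat) (P : 'rV[R]_d -> R),
      (0 < m)%N -> bandwidth_ok C0 t m ->
      cube m `<=` [set w | sigma phi w != 0] -> 0 < spectral_inf phi Lam m ->
      dual_certificate gamma ups C C3 t m P ->
      (forall x, P x = convolution phi (c0 phi P) x) ->
      forall (disp : measure_display) (Om : measurableType disp)
        (Pr : probability Om R) (X : nat -> Om -> 'rV[R]_d),
      mutually_independent Pr X -> (forall i, has_density Pr (X i) f0) ->
      forall rho : nat -> R,
      (forall n, (0 < n)%N -> 0 < rho n) ->
      (forall n, (0 < n)%N ->
        (\int[Pr]_w (rkhs_norm H (residual phi lam (empirical X n w) mu0) ^+ 2)
          <= (rho n ^+ 2)%:E)%E) ->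
      let kappa n := rho n / fine (rkhs_norm H (c0 phi P)) in
      forall muhat : nat -> Om -> {charge set 'rV[R]_d -> \bar R},
      (forall n A, (0 < n)%N -> measurable A ->
        measurable_fun setT (fun w => muhat n w A)) ->
      (forall n w, (0 < n)%N -> forall mu : {charge set 'rV[R]_d -> \bar R},
        (objective phi H (kappa n) (empirical X n w) (muhat n w)
          <= objective phi H (kappa n) (empirical X n w) mu)%E) ->
      let eps := near_radius d ups m in
      let far_bound n := 3 * Num.sqrt 2 / 2 * (d%:R ^+ 3 / (gamma * ups ^+ 2))
                         * rho n * Cm C3 K phi Lam m in
      forall n, (0 < n)%N ->
      [/\ (* (i) *)
          (\int[Pr]_w neg_part (muhat n w) setT
            <= (3 * Num.sqrt 2 / 2 * rho n * Cm C3 K phi Lam m)%:E)%E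
          /\ (\int[Pr]_w pos_part (muhat n w) (far_region t eps)
            <= (far_bound n)%:E)%E,
          (* (ii) *)
          forall A, measurable A ->
            ((far_bound n)%:E < \int[Pr]_w pos_part (muhat n w) A)%E ->
            (\big[Order.min/+oo]_(k < K)
               ereal_inf [set (norm2 (x - t k) ^+ 2)%:E | x in A]
             <= (gamma * ups ^+ 2 / (C * d%:R ^+ 3 * m%:R ^+ 2))%:E)%E
        & (* (iii) *)
          forall k, (\int[Pr]_w `|(a k)%:E - muhat n w (near_region (t k) eps)|
            <= (M * rho n * Cm C3 K phi Lam m)%:E)%E]].
Proof.
(* Nothing in the bounds depends on the size of the constants, so those for which
   certificates exist can be taken, if there are any. *)
have [C0 [gamma [ups [C00 gamma0 ups0 cst]]]] : exists C0 gamma ups : R,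
    [/\ 0 < C0, 0 < gamma, 0 < ups &
     (exists C0' gamma' ups' : R, certificate_constants C0' gamma' ups') ->
        certificate_constants C0 gamma ups].
  have [[C0 [gamma [ups cst]]]|ncst] :=
      pselect (exists C0' gamma' ups' : R, certificate_constants C0' gamma' ups').
    by exists C0, gamma, ups; have [] := cst.
  by exists 1, 1, 1; split.
exists C0, gamma, ups; split => //.
move=> d C C3 d0 C_gt0 C3_gt0 phi lam Lam phi_dens phi_reg lam_reg phi_pos lamLam
  H K t a tinj a_gt0 a_sum mu0 f0.
have [ck ck0 ckP] : exists2 ck : 'I_K -> R, forall k, 0 < ck k &
    forall k m, (0 < m)%N -> exists Q,
    [/\ band_limited (4 * m%:R) (ck k / m%:R ^+ d) Q, forall x, `|Q x| <= ck k,
        forall x, `|Q x - 1| <= ck k * m%:R ^+ 2 * norm2 (x - t k) ^+ 2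
      & forall j, j != k -> forall x,
          `|Q x| <= ck k * m%:R ^+ 2 * norm2 (x - t j) ^+ 2].
  have h k : exists c, 0 < c /\ forall m, (0 < m)%N -> exists Q,
    [/\ band_limited (4 * m%:R) (c / m%:R ^+ d) Q, forall x, `|Q x| <= c,
        forall x, `|Q x - 1| <= c * m%:R ^+ 2 * norm2 (x - t k) ^+ 2
      & forall j, j != k -> forall x, `|Q x| <= c * m%:R ^+ 2 * norm2 (x - t j) ^+ 2].
    by have [c c0 cP] := interpolation_exists k tinj; exists c.
  have [ck ckP] := choice h.
  by exists ck => k; have [] := ckP k.
pose gap := far_gap d gamma ups.
have gap0 : 0 < gap by exact: far_gap_gt0.
pose be k := weight_factor d C3 K (ck k).
pose B k := ck k / C + ck k / gap + ck k + 1.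
have be0 k : 0 <= be k.
  by rewrite /be /weight_factor divr_ge0 ?mulr_ge0 ?sqrtr_ge0 ?sqr_ge0 ?(ltW (ck0 k)) ?(ltW C3_gt0).
have B0 k : 0 < B k.
  have c0 := ck0 k; have := divr_gt0 c0 C_gt0; have := divr_gt0 c0 gap0; rewrite /B; lra.
pose Mk k := 2 * (3 * be k + B k).
have Mk0 k : 0 <= Mk k by have := be0 k; have := B0 k; rewrite /Mk; lra.
(* The interpolants are chosen for all [k] before [m], and [Mk] does not involve
   [m]; the added 1 is for positivity. *)
exists (1 + \sum_k Mk k); split; first by rewrite ltr_pwDl// sumr_ge0.
move=> m P m0 _ _ S0 cert P_conv disp Om Pr X _ _ rho rho0 risk kappa muhat _ muhat_min
  eps far_bound n n0.
have [_ _ _ nc] := c0P C3_gt0 phi_dens phi_reg phi_pos lamLam H S0 cert P_conv.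
set c := c0 phi P in nc.
set nrm := Num.sqrt (rkhs_ip H c c) in nc.
have nrm0 : 0 < nrm.
  exact: (norm_c0_gt0 C3_gt0 phi_dens phi_reg phi_pos lamLam H a_sum S0 cert P_conv).
have Cm0 : 0 < Cm C3 K phi Lam m := lt_le_trans nrm0 nc.
have r0 := rho0 n n0.
have min' w nu : (objective phi H (rho n / nrm) (empirical X n w) (muhat n w)
    <= objective phi H (rho n / nrm) (empirical X n w) nu)%E.
  have := muhat_min n w n0 nu; rewrite /kappa.
  by rewrite (fine_norm_c0 C3_gt0 phi_dens phi_reg phi_pos lamLam H S0 cert P_conv).
pose F w := (rkhs_norm H (residual phi lam (empirical X n w) mu0) ^+ 2)%E.
(* Each quantity is at most [al * (F + rho ^+ 2)] at every sample, and the mean of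
   [F] is at most [rho ^+ 2]. *)
have integrate (g : Om -> \bar R) (al : R) : 0 < al -> (forall w, 0 <= g w)%E ->
    (forall w, g w <= al%:E * (F w + (rho n ^+ 2)%:E))%E ->
    (\int[Pr]_w g w <= (al * (rho n ^+ 2 + rho n ^+ 2))%:E)%E.
  move=> al0 g0 gF; apply: (ge0_integral_affine_le (f := F)) => //.
  - exact: probability_setT.
  - exact: sqr_ge0.
  - by move=> w; exact: rkhs_norm_sqr_ge0.
  - exact: risk.
have s2 := sqrt2_bound R.
have dfhat w := @dom_empirical R d lam H Om X n w lam_reg.
have pos_bound A : measurable A -> (forall x, A x -> P x <= 1 - gap) ->
    (\int[Pr]_w pos_part (muhat n w) A <= (far_bound n)%:E)%E.
  move=> mA PA.
  apply: le_trans (integrate _ (gap^-1 * (nrm / rho n)) _ _ _) _.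
  - by rewrite mulr_gt0 ?invr_gt0// divr_gt0.
  - by move=> w; exact: measure_ge0.
  - by move=> w; exact: (pos_part_sample d0 gamma0 ups0 C3_gt0 phi_dens phi_reg phi_pos
      lam_reg lamLam a_gt0 a_sum S0 cert P_conv (dfhat w) r0 (min' w) mA PA).
  rewrite lee_fin /far_bound.
  have -> : d%:R ^+ 3 / (gamma * ups ^+ 2) = gap^-1.
    by rewrite /gap /far_gap invf_div.
  have -> : gap^-1 * (nrm / rho n) * (rho n ^+ 2 + rho n ^+ 2) = 2 * (gap^-1 * (rho n * nrm)).
    by field; rewrite !gt_eqF.
  have -> : 3 * Num.sqrt 2 / 2 * gap^-1 * rho n * Cm C3 K phi Lam m =
    3 * Num.sqrt 2 / 2 * (gap^-1 * (rho n * Cm C3 K phi Lam m)) by ring.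
  apply: ler_pM => //; first by rewrite !mulr_ge0 ?invr_ge0 ?ltW.
  by rewrite ler_pM2l ?invr_gt0// ler_pM2l.
split; first split.
- apply: le_trans (integrate _ (nrm / rho n) _ _ _) _.
  + by rewrite divr_gt0.
  + by move=> w; exact: measure_ge0.
  + by move=> w; exact: (neg_part_sample C3_gt0 phi_dens phi_reg phi_pos
      lam_reg lamLam a_gt0 a_sum S0 cert P_conv (dfhat w) r0 (min' w)).
  rewrite lee_fin.
  have -> : nrm / rho n * (rho n ^+ 2 + rho n ^+ 2) = 2 * (rho n * nrm).
    by field; rewrite gt_eqF.
  rewrite -(mulrA _ (rho n)); apply: ler_pM => //; first by rewrite mulr_ge0 ?ltW.
  by rewrite ler_pM2l.
- apply: pos_bound; first exact: measurable_far_region.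
  by move=> x; exact: (cert_far cert).
(* If all points of [A] are far from the [t k], then [A] satisfies the hypothesis
   of [pos_bound]. *)
- move=> A mA; rewrite ltNge => /negP hA; rewrite leNgt; apply/negP => hmin; apply: hA.
  apply: pos_bound => // x Ax; apply: (cert_away cert) => k.
  have := lt_le_trans hmin (bigmin_le _ k _) => /lt_le_trans.
  move=> /(_ (norm2 (x - t k) ^+ 2)%:E); rewrite lte_fin => h.
  have {}h := h (ereal_inf_lbound (ex_intro2 _ _ x Ax erefl)).
  have m0' : 0 < m%:R :> R by rewrite ltr0n.
  have d0' : 0 < d%:R :> R by rewrite ltr0n.
  have -> : far_gap d gamma ups =
      C * m%:R ^+ 2 * (gamma * ups ^+ 2 / (C * d%:R ^+ 3 * m%:R ^+ 2)).
    by rewrite /far_gap; field; rewrite !gt_eqF.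
  by rewrite ler_pM2l ?mulr_gt0 ?exprn_gt0// ltW.
- move=> k; have [Q [bQ Qc Qk Qj]] := ckP k m m0.
  have K0 : (0 < K)%N by case: (K) (k) => // -[].
  have [g [dg ag mg gQ ng]] := band_limited_rkhs phi_dens phi_reg phi_pos lamLam H S0 bQ.
  have ng' : Num.sqrt (rkhs_ip H g g) <= be k * Cm C3 K phi Lam m.
    exact: interpolant_norm ng.
  have mQ : measurable_fun setT Q.
    by have [u [v [[mu _ _] [mv _ _] ->]]] := bQ; exact: measurable_trig_int.
  have bmQ : @bounded_mfun _ 'rV[R]_d R Q by split => //; exists (ck k).
  have n20 y : norm2 (y - y : 'rV[R]_d) ^+ 2 = 0.
    by rewrite norm2_sqr big1// => i _; rewrite subrr mxE expr0n.
  have Qt j : Q (t j) = (j == k)%:R.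
    have [->|jk] := eqVneq j k.
      have := Qk (t k); rewrite n20 mulr0 normr_le0 subr_eq0 => /eqP ->//.
    by have := Qj j jk (t j); rewrite n20 mulr0 normr_le0 => /eqP ->.
  have [QB1 QB] := interpolant_gap d0 gamma0 ups0 C_gt0 cert (ck0 k) Qc Qk Qj.
  apply: le_trans (integrate _ ((3 * be k + B k) * Cm C3 K phi Lam m / rho n) _ _ _) _.
  + by rewrite divr_gt0// mulr_gt0// ltr_wpDl// mulr_ge0.
  + by move=> w; exact: abse_ge0.
  + by move=> w; exact: (weight_sample C3_gt0 phi_dens phi_reg phi_pos
      lam_reg lamLam a_gt0 a_sum S0 cert P_conv (dfhat w) r0 (min' w)
      (B0 k) gQ dg ag mg ng' bmQ (be0 k) Qt QB1 QB).
  rewrite lee_fin.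
  have -> : (3 * be k + B k) * Cm C3 K phi Lam m / rho n * (rho n ^+ 2 + rho n ^+ 2) =
      Mk k * rho n * Cm C3 K phi Lam m by rewrite /Mk; field; rewrite gt_eqF.
  rewrite ler_wpM2r ?(ltW Cm0)// ler_wpM2r ?(ltW r0)//.
  by rewrite (bigD1 k)//= addrCA lerDl addr_ge0// sumr_ge0.
Qed.
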